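(* (i) Let $Q$ be a Polish space with Borel $\sigma$-field $\mathscr{B}(Q)$, and let $(\Omega,\mathcal{F},\mathbb{P}^x,(\xi_t)_{t\ge0})_{x\in Q}$ be a (universal) Markov process with state space $(Q,\mathscr{B}(Q))$. Assume that the transition semigroup $(T^0_t)_{t\ge0}$, $T^0_tu_0(x):=\mathbb{E}^x[u_0(\xi_t)]$, is a strongly continuous semigroup on some Banach space $X\subset B_b(Q)$, where $B_b(Q)$ is the space of bounded Borel measurable functions on $Q$. Let $(L_0,\mathrm{Dom}(L_0))$ be the generator of $(T^0_t)_{t\ge0}$. Let $k$ be an admissible kernel whose associated function $\Phi$ satisfies the complete monotonicity assumption, and let the associated nonnegative random variables $(A(t))_{t\ge0}$ be taken independent of $(\xi_t)_{t\ge0}$ (terms defined in the context). Then, for each $u_0\in\mathrm{Dom}(L_0)$, the function $$u(t,x):=\mathbb{E}^x\left[u_0(\xi_{A(t)})\right],\qquad t\ge0,\ x\in Q,$$ solves the evolution equation $$u(t,x)=u_0(x)+\int_0^tk(t,s)L_0u(s,x)\,ds,\quad t>0,\ x\in Q,\qquad \lim_{t\searrow0}u(t,x)=u_0(x),\quad x\in Q.$$ (ii) In addition to the assumptions of (i), let $V:Q\to\mathbb{R}$ be Borel measurable with $\sup_{x\in Q}V(x)\le c$ for some $c\in\mathbb{R}$, such that the (closure of the) operator $(L_0+V,\mathrm{Dom}(L_0+V))$ generates a strongly continuous semigroup $(T_t)_{t\ge0}$ on $X$ with stochastic representation $$T_tu_0(x)=\mathbb{E}^x\left[u_0(\xi_t)\exp\left(\int_0^tV(\xi_s)\,ds\right)\right],\qquad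 t\ge0,\ x\in Q,\ u_0\in X.$$ Then, for each $u_0\in\mathrm{Dom}(L_0+V)$, the Feynman-Kac formula $$u(t,x):=\mathbb{E}^x\left[u_0(\xi_{A(t)})\exp\left(\int_0^{A(t)}V(\xi_s)\,ds\right)\right],\qquad t\ge0,\ x\in Q,$$ provides a solution to the evolution equation $$u(t,x)=u_0(x)+\int_0^tk(t,s)\bigl(L_0u(s,x)+V(x)u(s,x)\bigr)ds,\quad t>0,\ x\in Q,\qquad \lim_{t\searrow0}u(t,x)=u_0(x),\quad x\in Q.$$ (iii) Suppose additionally that $k$ is homogeneous of order $\theta-1$ for some $\theta>0$, i.e. $k(t,ts)=t^{\theta-1}k(1,s)$ for all $t\in(0,\infty)$, $s\in(0,1)$. Then one can choose $A(t):=At^\theta$ in the formulas for $u$ in (i) and in (ii), where $A$ is a nonnegative random variable which is independent of $(\xi_t)_{t\ge0}$ and satisfies $\int_0^\infty e^{-\lambda a}\,\mathcal{P}_A(da)=\Phi(1,-\lambda)$ for all $\lambda\in\mathbb{C}$ with $\mathrm{Re}\,\lambda\ge0$.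
   Context: Admissible kernel: a Borel-measurable function $k:(0,\infty)\times(0,\infty)\to\mathbb{R}$ for which there exist $\alpha^*\in[0,1)$ and $\varepsilon>0$ such that for each $T>0$ $$\sup_{0<t\le T} t^{\alpha^*-\frac{1}{1+\varepsilon}}\,\|k(t,\cdot)\|_{L^{1+\varepsilon}((0,t))}<\infty .$$ Associated function $\Phi:[0,\infty)\times\mathbb{C}\to\mathbb{C}$: $\Phi(t,\lambda):=\sum_{n=0}^\infty c_n(t)\lambda^n$, where $c_0(t):=1$ for all $t\ge0$ and, for $n\in\mathbb{N}$, $c_n(t):=\int_0^t k(t,s)c_{n-1}(s)\,ds$ for $t>0$ and $c_n(0):=0$. (For an admissible kernel it is known that these integrals exist and that $\Phi(t,\cdot)$ is entire for each $t\ge 0$.) Complete monotonicity assumption: for every $t\ge0$ the function $\lambda\mapsto\Phi(t,-\lambda)$ is completely monotone on $(0,\infty)$; i.e. for each $t\ge0$ there is a nonnegative random variable $A(t)$ whose distribution $\mathcal{P}_{A(t)}$ satisfies $\int_0^\infty e^{-\lambda a}\,\mathcal{P}_{A(t)}(da)=\Phi(t,-\lambda)$ for all $\lambda\in\mathbb{C}$ with $\mathrm{Re}\,\lambda\ge0$. (In particular $\mathcal{P}_{A(0)}=\delta_0$.) $\mathcal{P}_Y$ denotes the distribution of a random variable $Y$. $\mathbb{E}^x$ denotes expectation with respect to $\mathbb{P}^x$; under $\mathbb{P}^x$ the process starts at $\xi_0=x$. When the closure of $L_0+V$ has to be taken, $(L_0+V,\mathrm{Dom}(L_0+V))$ denotes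 the resulting generator of $(T_t)_{t\ge0}$ and $L_0u+Vu$ is understood as its action on $u$. ''Solves'' means that $u(t,\cdot)\in X$ lies in the domain of the operator appearing in the equation, and that the equation holds with the integral understood as an $X$-valued Bochner integral.
   Formalization: The formal statement additionally assumes that (t,ω) ↦ ξ_t(ω) is jointly measurable with respect to the σ-field generated by ξ; without this ξ at the independent time A(t) may not be a random variable, or the claim may fail. *)

(* Defs.v *)
From HB Require Import structures.
From mathcomp Require Import all_boot all_order all_algebra.
From mathcomp Require Import all_classical all_reals all_analysis.
From mathcomp Require Import measurable_realfun complex.

Set Implicit Arguments.
Unset Strict Implicit.
Unset Printing Implicit Defensive.

Import Order.TTheory GRing.Theory Num.Theory numFieldNormedType.Exports.

Local Open Scope classical_set_scope.
Local Open Scope complex_scope.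
Local Open Scope ring_scope.

Section kernels.
Context {R : realType}.
Implicit Types (k : R -> R -> R) (t : R) (l : R[i]).

Notation leb := (@lebesgue_measure R).

(* [k] is a total function of which only the values on (0,oo)^2 matter; the
   L^p norm over (0,t) is the norm over the line of the extension by zero. *)
Definition admissible_kernel k : Prop :=
  measurable_fun ((`]0, +oo[ : set R) `*` (`]0, +oo[ : set R))
    (fun p : R * R => k p.1 p.2) /\
  exists alpha eps : R, [/\ 0 <= alpha < 1, 0 < eps &
    forall T : R, 0 < T ->
      (ereal_sup [set ((t `^ (alpha - (1 + eps)^-1))%:E *
                       'N[leb]_((1 + eps)%:E)[EFin \o (k t \_ `]0%R, t[%classic)])%E
                 | t in `]0%R, T]] < +oo)%E].

Fixpoint kernel_coef k (n : nat) t : R :=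
  if n is m.+1 then
    (if 0 < t then \int[leb]_(s in `]0, t[) (k t s * kernel_coef k m s) else 0)
  else 1.

Definition Phi k t l : R[i] :=
  limn (series (fun n => (kernel_coef k n t)%:C * l ^+ n
                         : (R[i] : numFieldType))).

Definition homogeneous_kernel k (theta : R) : Prop :=
  forall t s, 0 < t -> 0 < s < 1 ->
    k t (t * s) = t `^ (theta - 1) * k 1 s.

Definition completely_monotone (f : R -> R) : Prop :=
  forall n x, 0 < x ->
    derivable (derive1n n f) x 1 /\ 0 <= (-1) ^+ n * derive1n n f x.

Definition cexp (z : R[i]) : R[i] :=
  (expR (complex.Re z) * cos (complex.Im z)) +i*
  (expR (complex.Re z) * sin (complex.Im z)).

Definition laplace_transform (mu : {measure set R -> \bar R}) l : R[i] :=
  (\int[mu]_(a in `[0, +oo[) complex.Re (cexp (- l * a%:C))) +i*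
  (\int[mu]_(a in `[0, +oo[) complex.Im (cexp (- l * a%:C))).

End kernels.

Definition polish (R : realType) (Q : topologicalType) : Prop :=
  (exists D : set Q, countable D /\ dense D) /\
  exists dist : Q -> Q -> R,
    [/\ forall x y, 0 <= dist x y /\ (dist x y = 0 <-> x = y),
        forall x y, dist x y = dist y x,
        forall x y z, dist x z <= dist x y + dist y z,
        forall x (U : set Q), nbhs x U <->
          exists2 e : R, 0 < e & [set y | dist x y < e] `<=` U
      & forall v : nat -> Q,
          (forall e : R, 0 < e -> exists N, forall m n,
             (N <= m)%N -> (N <= n)%N -> dist (v m) (v n) < e) ->
          exists x : Q, v n @[n --> \oo] --> x].

Notation borel Q := (g_sigma_algebraType (@open Q)).

Definition process_sigma {R : realType} {d d'} {Omega : measurableType d}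
    {S : measurableType d'} (Y : R -> {mfun Omega >-> S}) (I : set R)
    : set (set Omega) :=
  <<s [set E | exists r (B : set S), [/\ I r, measurable B & E = Y r @^-1` B]]>>.

Definition independent {R : realType} {d} {Omega : measurableType d}
    (P : probability Omega R) (G H : set (set Omega)) : Prop :=
  forall E F, G E -> H F -> (P (E `&` F) = P E * P F)%E.

Section markov.
Context {R : realType} {Q : ptopologicalType} {d : measure_display}
  {Omega : measurableType d}.
Variables (P : Q -> probability Omega R) (xi : R -> {mfun Omega >-> borel Q}).

(* Only the times [t >= 0] matter, here and for all time-indexed families
   below. The Markov property is the defining identity of the conditional
   probability [P^x(xi_(s+t) \in B | xi_r, r <= s) = P^(xi_s)(xi_t \in B)]. *)
Record universal_markov_process : Prop := {
  markov_start : forall x, P x [set w | xi 0 w = x] = 1%E ;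
  markov_measurable : forall t (B : set (borel Q)), 0 <= t -> measurable B ->
    measurable_fun [set: borel Q]
      (fun x : borel Q => P x (xi t @^-1` B)) ;
  markov_property : forall x s t (B : set (borel Q)) (E : set Omega),
    0 <= s -> 0 <= t -> measurable B -> process_sigma xi `[0, s] E ->
    P x (E `&` xi (s + t) @^-1` B) =
      (\int[P x]_(w in E) P (xi s w) (xi t @^-1` B))%E }.

(* Joint measurability of [(t, w) |-> xi_t(w)] with respect to the sigma-field
   generated by the process: this makes [xi] evaluated at an independent random
   time, and the time integrals of [V(xi_s)], random variables. *)
Definition measurable_process : Prop :=
  measurable_fun ((`[0, +oo[ : set R) `*` setT)
    (fun p : R * g_sigma_algebraType (process_sigma xi `[0, +oo[) =>
       xi p.1 p.2 : borel Q).

(* The exponential is that of an extended real: the integral exists in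
   [-oo, +oo[ when [V] is bounded above, and exp(-oo) = 0. *)
Definition fk_weight (V : Q -> R) (a : R) (w : Omega) : R :=
  fine (expeR (\int[lebesgue_measure]_(s in `[0%R, a]) (V (xi s w))%:E)).

(* A nonnegative random variable whose law under every [P^x] has the Laplace
   transform [Phi(t, - .)]. *)
Definition associated_time (k : R -> R -> R) (t : R)
    (Y : {mfun Omega >-> R}) : Prop :=
  (forall w, 0 <= Y w) /\
  forall x (l : R[i]), 0 <= complex.Re l ->
    laplace_transform (distribution (P x) Y) l = Phi k t (- l).

Definition associated_times (k : R -> R -> R)
    (A : R -> {mfun Omega >-> R}) : Prop :=
  forall t, 0 <= t -> associated_time k t (A t).

Definition scaled_time (Y : {mfun Omega >-> R}) (theta t : R)
    : {mfun Omega >-> R} := (t `^ theta) \o* Y.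

End markov.

Section semigroups.
Context {R : realType} {X : normedModType R}.

Record C0_semigroup (T : R -> X -> X) : Prop := {
  semigroup_linear : forall t, 0 <= t -> linear (T t) ;
  semigroup_bounded : forall t, 0 <= t -> continuous (T t) ;
  semigroup0 : forall u, T 0 u = u ;
  semigroupD : forall s t u, 0 <= s -> 0 <= t -> T (s + t) u = T s (T t u) ;
  semigroup_cvg0 : forall u, T t u @[t --> 0^'+] --> u }.

(* Unbounded operators are represented by their graphs. *)
Definition generator (T : R -> X -> X) : set (X * X) :=
  [set p | h^-1 *: (T h p.1 - p.1) @[h --> 0^'+] --> p.2].

Definition Dom (L : set (X * X)) : set X := [set u | exists v, L (u, v)].

End semigroups.

Section bochner.
Context {d} {T : measurableType d} {R : realType} {X : normedModType R}.
Variables (mu : {measure set T -> \bar R}) (D : set T).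

Definition bochner_simple (s : T -> X) : Prop :=
  finite_set (s @` D) /\
  forall y, y != 0 -> measurable (D `&` s @^-1` [set y]) /\
                      (mu (D `&` s @^-1` [set y]) < +oo)%E.

Definition bochner_simple_integral (s : T -> X) : X :=
  \sum_(y \in s @` D) fine (mu (D `&` s @^-1` [set y])) *: y.

Definition is_bochner_integral (f : T -> X) (I : X) : Prop :=
  exists s : nat -> T -> X,
    [/\ forall n, bochner_simple (s n),
        {ae mu, forall x, D x -> s n x @[n --> \oo] --> f x},
        (\int[mu]_(x in D) `|s n x - f x|%:E)%E @[n --> \oo] --> 0%E
      & bochner_simple_integral (s n) @[n --> \oo] --> I].

End bochner.

Section evolution.
Context {R : realType} {Q : ptopologicalType} {X : completeNormedModType R}.
Variable iota : X -> Q -> R.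

(* [X] as a Banach space contained in B_b(Q): [iota u] is [u] as a function on
   [Q], and the norm of [X] dominates the supremum norm up to a constant. *)
Record bounded_borel_space : Prop := {
  space_linear : forall (a : R) (u v : X) (x : Q),
    iota (a *: u + v) x = a * iota u x + iota v x ;
  space_inj : injective iota ;
  space_measurable : forall u,
    measurable_fun [set: borel Q] (iota u : borel Q -> R) ;
  space_bounded : exists C : R, forall u x, `|iota u x| <= C * `|u| }.

(* [L + V] with its natural domain: the [u] in [Dom L] such that [L u + V u]
   belongs to [X]. *)
Definition add_potential (L : set (X * X)) (V : Q -> R) : set (X * X) :=
  [set p | exists2 v, L (p.1, v) &
             forall x, iota p.2 x = iota v x + V x * iota p.1 x].

(* [U t] is [u(t, .)] as an element of [X] and [W t] is the image of [U t]
   under [L]. *)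
Definition solves (L : set (X * X)) (k : R -> R -> R) (u0 : X)
    (u : R -> Q -> R) : Prop :=
  exists U W : R -> X,
    [/\ forall t, 0 <= t -> iota (U t) = u t,
        forall t, 0 <= t -> L (U t, W t),
        forall t, 0 < t -> exists2 I : X,
          is_bochner_integral lebesgue_measure `]0, t[
            (fun s => k t s *: W s) I &
          forall x, u t x = iota u0 x + iota I x
      & forall x, u t x @[t --> 0^'+] --> iota u0 x].

Context {d : measure_display} {Omega : measurableType d}.
Variables (P : Q -> probability Omega R) (xi : R -> {mfun Omega >-> borel Q}).

Definition transition_semigroup (T0 : R -> X -> X) : Prop :=
  forall t u0 x, 0 <= t ->
    iota (T0 t u0) x = fine 'E_(P x)[fun w => iota u0 (xi t w)].

Record feynman_kac_semigroup (L0 : set (X * X)) (V : Q -> R)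
    (T : R -> X -> X) : Prop := {
  potential_measurable : measurable_fun [set: borel Q] (V : borel Q -> R) ;
  potential_bounded : exists c : R, forall x, V x <= c ;
  fk_C0 : C0_semigroup T ;
  fk_generator : closure (add_potential L0 V) = generator T ;
  fk_representation : forall t u0 x, 0 <= t ->
    iota (T t u0) x =
      fine 'E_(P x)[fun w => iota u0 (xi t w) * fk_weight xi V t w] }.

End evolution.

(* Main.v *)
(* The operator [u0 |-> E (T_{A(t)} u0)], the integral of the semigroup against
   the law of [A(t)], solves the equation. To have it in [X] although the law may
   depend on the starting point, it is defined as a limit of Bernstein sums: for
   [om] above the growth bound, [F(y) = y^om T_{-ln y} u0] is continuous on [0, 1],
   [T_a u0 = e^{om a} F(e^{-a})], and the weights [E (e^{om A(t)} b_{N,j}(e^{-A(t)}))]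
   are combinations of the values [Phi(t, om - i)]. The limit commutes with the
   generator because the sums do.
   The Laplace transform gives the moments [E A(t)^n = n! c_n(t)], hence
   [E e^{l A(t)} = Phi(t, l)] for all real [l]. The recursion for the [c_n] says that
   [l int_0^t k(t, s) Phi(s, l) ds = Phi(t, l) - 1], that is,
   [E h(A(t)) - h(0) = int_0^t k(t, s) E h'(A(s)) ds] for exponentials [h]; by the
   Weierstrass theorem in [y = e^{-a}] this extends to [h(a) = (T_a u0)(x)].
   Independence and Fubini identify the operator with the stochastic
   representations, the weight being 1 or the Feynman-Kac functional. For a
   homogeneous kernel, [c_n(t) = t^{n theta} c_n(1)]. *)
Require Import Defs.
From HB Require Import structures.
From mathcomp Require Import all_boot all_order all_algebra finmap.
From mathcomp Require Import all_classical all_reals all_analysis.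
From mathcomp Require Import measurable_realfun complex ring lra.

Set Implicit Arguments.
Unset Strict Implicit.
Unset Printing Implicit Defensive.

Import Order.TTheory GRing.Theory Num.Theory numFieldNormedType.Exports.
Import HBSimple.

Local Open Scope classical_set_scope.
Local Open Scope complex_scope.
Local Open Scope ring_scope.

(** * Weighted estimates for the Volterra operator of the kernel *)

Section kernel_hoelder.
Context {R : realType}.
Local Notation leb := (@lebesgue_measure R).
Implicit Types (k : R -> R -> R) (t : R).

(** No exponential moment of A(t) is assumed, yet the semigroup may grow like expR (w * a), so that
    E expR (om * A(t)) must first be shown finite. Admissibility of k does this: c_n(t) decays
    faster than every geometric sequence, uniformly for t in bounded intervals, and the moments,
    once identified, sum up to the exponential. The laws of A(t) under the various P^x share one
    moment generating function. The operator is therefore built from [Phi] alone, and positivity on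
    polynomials in y takes the place of a law. The dependence of Phi(s, l) on s enters only through
    measurability and local boundedness. Bochner integrability is obtained from the Bernstein sums,
    where fixed vectors carry scalar weights measurable in s: these weights can be rounded to
    finitely many values. The limit at t = 0 is read off from the integral equation, because the
    integral of |k t| over (0, t) tends to 0 with t. *)

Lemma measurable_kernel_triangle k : admissible_kernel k ->
  measurable_fun [set: R * R]
    ((fun p => k p.1 p.2) \_ [set p : R * R | 0 < p.2 < p.1]).
Proof.
case=> mk _.
have mT : measurable [set p : R * R | 0 < p.2 < p.1].
  have mb : measurable_fun [set: R * R] (fun p : R * R => 0 < p.2 < p.1).
    by apply: measurable_and; exact: measurable_fun_ltr.
  by have := mb measurableT [set true] I; rewrite setTI.
apply/(measurable_restrictT _ mT).
apply: (measurable_funS _ _ mk); first exact: measurableX.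
move=> -[x y] /= /andP[y0 yx]; split; rewrite /= in_itv/= andbT //.
exact: lt_trans yx.
Qed.

Lemma mem_triangle (s t : R) :
  ((t, s) \in [set p : R * R | 0 < p.2 < p.1]) = (s \in `]0, t[%classic).
Proof. by apply/idP/idP; rewrite !in_setE /= ?in_itv. Qed.

Lemma measurable_kernel_section k t : admissible_kernel k ->
  measurable_fun [set: R] (k t \_ `]0, t[).
Proof.
move=> /measurable_kernel_triangle mk.
rewrite (_ : k t \_ _ = (fun p => k p.1 p.2) \_ [set p : R * R | 0 < p.2 < p.1]
  \o (fun s => (t, s))); last first.
  apply/funext => s; rewrite /= /patch.
  by rewrite mem_triangle.
exact: measurableT_comp mk (pair1_measurable t).
Qed.

Lemma is_derive_expRM (g x : R) :
  is_derive x 1 (fun s => expR (g * s)) (g * expR (g * x)).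
Proof.
have -> : (fun s => expR (g * s)) = expR \o (g \*: id) by apply/funext.
have d1 : is_derive x 1 (g \*: (@id R)) (g *: 1) by exact: is_deriveZ.
have := is_derive1_comp (is_derive_expR ((g \*: (@id R)) x)) d1.
by rewrite /GRing.scale/= mulr1 mulrC.
Qed.

Lemma continuous_expRM (g : R) : continuous (fun s : R => expR (g * s)).
Proof.
by move=> s; apply: continuous_comp;
  [exact: mulrl_continuous|exact: continuous_expR].
Qed.

Lemma integral_expR (g t : R) : 0 < g -> 0 < t ->
  (\int[leb]_(s in `]0%R, t[) (expR (g * s))%:E = ((expR (g * t) - 1) / g)%:E)%E.
Proof.
move=> g0 t0.
have cf := @continuous_expRM g.
rewrite integral_itv_bndo_bndc; last first.
  apply/measurable_EFinP/measurable_funTS; exact: continuous_measurable_fun.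
rewrite integral_itv_obnd_cbnd; last first.
  apply/measurable_EFinP/measurable_funTS; exact: continuous_measurable_fun.
have dF (x : R) : is_derive x 1 (fun s : R => g^-1 * expR (g * s)) (expR (g * x)).
  have dg := is_derive_expRM g x.
  have -> : (fun s => g^-1 * expR (g * s)) = g^-1 \*: (fun s => expR (g * s)).
    by apply/funext.
  by have := is_deriveZ g^-1 dg; rewrite /GRing.scale/= mulKf ?gt_eqF.
rewrite (@continuous_FTC2 _ _ (fun s => g^-1 * expR (g * s)))//.
- by rewrite mulr0 expR0 -EFinB -mulrBr mulrC.
- exact: continuous_subspaceT.
- have cF : continuous (fun s : R => g^-1 * expR (g * s)).
    move=> s; apply/differentiable_continuous/derivable1_diffP.
    exact: (@ex_derive _ _ _ _ _ _ _ (dF s)).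
  split => //.
  + by apply: cvg_at_right_filter; exact: cF.
  + by apply: cvg_at_left_filter; exact: cF.
- by move=> x _; rewrite derive1E; apply: derive_val.
Qed.

(** Interpolation between the bounds x and 1. With x = g q t it trades a power of t for a negative
    power of g in the norm of the exponential weight. *)
Lemma one_minus_expR_le (x sg : R) : 0 < x -> 0 <= sg <= 1 ->
  1 - expR (- x) <= x `^ sg.
Proof.
move=> x0 /andP[s0 s1]; have [x1|x1] := leP x 1.
  apply: (@le_trans _ _ x); last by rewrite ger1_powR// x0.
  by have := expR_ge1Dx (- x); lra.
apply: (@le_trans _ _ 1).
  by rewrite gerBl expR_ge0.
by rewrite -(powRr0 x) ler_powR// ltW.
Qed.

(* Bielecki's weight: the factor [expR (g * s)] makes the Volterra operator of
   [k] an arbitrarily small contraction on [0, T]. *)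
Lemma kernel_weighted k (T b : R) : admissible_kernel k -> 0 < T -> 0 < b ->
  exists2 g, 0 < g & forall t, 0 < t <= T ->
    (\int[leb]_(s in `]0%R, t[) (`|k t s| * expR (g * s))%:E
      <= (b * expR (g * t))%:E)%E.
Proof.
move=> hk T0 b0; have [_ [al [eps [/andP[al0 al1] eps0 hK]]]] := hk.
have {hK} := hK _ T0; set S := [set _ | _ in _] => hS.
have [K K0 hK] : exists2 K : R, 0 < K & forall t, 0 < t <= T ->
    ('N[leb]_((1 + eps)%:E)[EFin \o (k t \_ `]0%R, t[%classic)]
     <= (K * t `^ ((1 + eps)^-1 - al))%:E)%E.
  have S0 : (0 <= ereal_sup S)%E.
    apply: le_trans (ereal_sup_ubound _); last first.
      by exists T => //=; rewrite in_itv/= T0 lexx.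
    by apply: mule_ge0; rewrite ?Lnorm_ge0// lee_fin powR_ge0.
  exists (fine (ereal_sup S) + 1); first by rewrite ltr_wpDl// fine_ge0.
  move=> t tT; have : ((t `^ (al - (1 + eps)^-1))%:E *
     'N[leb]_((1 + eps)%:E)[EFin \o (k t \_ `]0%R, t[%classic)] <= ereal_sup S)%E.
    by apply: ereal_sup_ubound; exists t => //=; rewrite in_itv.
  have t0 : 0 < t by case/andP: tT.
  move=> h; have tp0 : 0 < t `^ ((1 + eps)^-1 - al) by rewrite powR_gt0.
  rewrite mulrC EFinM -lee_pdivrMl// (le_trans (y := ereal_sup S))//.
    by rewrite -opprB powRN in h.
  by rewrite -[leLHS]fineK ?lee_fin ?lerDl// ge0_fin_numE.
set p := 1 + eps in hK; have p0 : 0 < p by rewrite /p addr_gt0.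
have [q q0 pq] : exists2 q : R, 0 < q & p^-1 + q^-1 = 1.
  exists (p / eps); first by rewrite divr_gt0.
  by rewrite invf_div -[X in X + _]mul1r -mulrDl divff// gt_eqF.
(* The power of t left over at the end is e = 1/p - al + sg/q. This sg is the least value in [0, 1]
   with e >= 0, which keeps t^e bounded on (0, T]; sg < 1, due to al < 1, leaves a negative power (g
   q)^(-r), small for large g. *)
pose sg := Num.max 0 (1 - (1 - al) * q).
have al1' : 0 < 1 - al by rewrite subr_gt0.
have sg0 : 0 <= sg <= 1.
  rewrite /sg le_max lexx/= ge_max ler01/= gerBl ltW// mulr_gt0//.
have sg1 : sg < 1 by rewrite /sg gt_max ltr01/= ltrBlDr ltrDl mulr_gt0.
pose r := (1 - sg) / q; have r0 : 0 < r by rewrite divr_gt0// subr_gt0.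
pose e := p^-1 - al + sg / q.
have e0 : 0 <= e.
  have : (1 - (1 - al) * q) / q <= sg / q.
    by rewrite ler_pM2r ?invr_gt0// /sg le_max lexx orbT.
  rewrite mulrBl mulfK ?gt_eqF// /e; move: pq; rewrite mul1r; lra.
pose C := K * T `^ e + 1.
have C0 : 0 < C by rewrite ltr_pwDr// mulr_ge0 ?powR_ge0 ?ltW.
have Cb : 0 < C / b by rewrite divr_gt0.
(* g is tuned so that C * (g q)^(-r) = b. *)
have [g g0 gq] : exists2 g, 0 < g & g * q = (C / b) `^ r^-1.
  exists ((C / b) `^ r^-1 / q); first by rewrite divr_gt0// powR_gt0.
  by rewrite divfK ?gt_eqF.
exists g => // t tT; have t0 : 0 < t by case/andP: tT.
have tT' : t <= T by case/andP: tT.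
have mg : measurable_fun [set: R] ((fun s => expR (g * s)) \_ `]0, t[).
  apply/(measurable_restrictT _ (measurable_itv _)); apply: measurable_funTS.
  by apply: continuous_measurable_fun; exact: continuous_expRM.
have := hoelder leb (measurable_kernel_section t hk) mg p0 q0 pq.
rewrite Lnorm1 => H; apply: le_trans.
  apply: le_trans H; rewrite [leLHS]integral_mkcond le_eqVlt; apply/orP; left; apply/eqP.
  apply: eq_integral => s _; rewrite /patch/=; case: ifPn => _.
    by rewrite normrM (ger0_norm (expR_ge0 _)).
  by rewrite mulr0 normr0.
have Ng : ('N[leb]_q%:E[EFin \o ((fun s => expR (g * s)) \_ `]0%R, t[)]
    <= (t `^ (sg / q) * (g * q) `^ (- r) * expR (g * t))%:E)%E.
  rewrite unlock /Lnorm.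
  rewrite (_ : (\int[_]_x _)%E = (\int[leb]_(s in `]0%R, t[) (expR (g * q * s))%:E)%E); last first.
    rewrite [RHS]integral_mkcond; apply: eq_integral => s _.
    rewrite /= /patch; case: ifPn => _.
      by rewrite ger0_norm ?expR_ge0// -expRM mulrAC.
    by rewrite normr0 powR0 ?gt_eqF.
  have gq0 : 0 < g * q by rewrite mulr_gt0.
  rewrite (integral_expR gq0 t0) poweR_EFin lee_fin.
  set X := g * q * t.
  have X0 : 0 < X by rewrite mulr_gt0.
  have -> : expR X - 1 = expR X * (1 - expR (- X)).
    by rewrite mulrBr mulr1 -expRD subrr expR0.
  apply: (@le_trans _ _ ((expR X * X `^ sg / (g * q)) `^ q^-1)).
    rewrite ge0_ler_powR ?invr_ge0 ?(ltW q0)//.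
    - rewrite nnegrE mulr_ge0 ?invr_ge0 ?(ltW gq0)// mulr_ge0 ?expR_ge0//.
      by rewrite subr_ge0 -expR0 ler_expR oppr_le0 ltW.
    - by rewrite nnegrE mulr_ge0 ?invr_ge0 ?(ltW gq0)// mulr_ge0 ?expR_ge0 ?powR_ge0.
    - by rewrite ler_pM2r ?invr_gt0// ler_pM2l ?expR_gt0// one_minus_expR_le.
  have -> : X `^ sg = t `^ sg * (g * q) `^ sg.
    by rewrite /X powRM ?(ltW gq0) ?(ltW t0)// mulrC.
  rewrite [X in X `^ q^-1](_ : _ = expR (g * q * t) * (t `^ sg * (g * q) `^ (sg - 1))); last first.
    rewrite powRB; last by apply/implyP => _; rewrite gt_eqF.
    by rewrite powRr1 ?(ltW gq0)// !mulrA /X.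
  rewrite [leLHS]powRM; [|exact: expR_ge0|by rewrite mulr_ge0 ?powR_ge0].
  rewrite powRM ?powR_ge0// -expRM -!powRrM.
  rewrite (_ : g * q * t / q = g * t); last by rewrite mulrAC mulfK ?gt_eqF.
  rewrite (_ : (sg - 1) / q = - r); last by rewrite /r -mulNr opprB.
  by rewrite mulrC.
apply: le_trans (lee_pmul _ _ (hK _ tT) Ng) _; rewrite ?Lnorm_ge0//.
rewrite -EFinM lee_fin.
rewrite gq -powRrM mulrN mulVf ?gt_eqF// powR_inv1 ?(ltW Cb)// invf_div.
rewrite mulrA ler_pM2r ?expR_gt0//.
rewrite mulrA -[X in X * (b / C)]mulrA -powRD; last by apply/implyP => _; rewrite gt_eqF.
rewrite -/e mulrCA ger_pMr//.
rewrite ler_pdivrMr// mul1r /C (le_trans (y := K * T `^ e)) ?lerDl//.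
by rewrite ler_pM2l// ge0_ler_powR// nnegrE ltW.
Qed.

End kernel_hoelder.

(** * The coefficients c_n and their generating series *)

Section geometric_bound.
Context {R : realType}.
Implicit Types u c : nat -> R.

Lemma sum_half_le (N M : nat) :
  \sum_(N <= n < M) (2^-1 : R) ^+ n <= 2 * 2^-1 ^+ N.
Proof.
have h2 : 0 <= 2^-1 ^+ N :> R by rewrite exprn_ge0// invr_ge0.
have [NM|MN] := leqP N M; last by rewrite big_geq ?mulr_ge0// ltnW.
rewrite -(subnKC NM) geometric_partial_tail.
apply: le_trans (geometric_le_lim (M - N) h2 _ _) _.
- by rewrite invr_gt0.
- by rewrite ger0_norm ?invr_ge0// invf_lt1// ltr1n.
- by rewrite mulrC ler_wpM2r// (_ : 1 - 2^-1 = 2^-1 :> R) ?invrK//; lra.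
Qed.

Lemma series_geometric_bound u (C : R) :
  (forall n, `|u n| <= C * 2^-1 ^+ n) ->
  cvgn (series u) /\
  forall N, `|limn (series u) - series u N| <= 2 * C * 2^-1 ^+ N.
Proof.
move=> hu; have C0 : 0 <= C.
  by have := hu 0; rewrite expr0 mulr1; exact: le_trans.
have cu : cvgn (series u).
  apply: normed_cvg; apply: (@series_le_cvg _ _ (geometric C 2^-1)) => //=.
  - by move=> n; rewrite mulr_ge0// exprn_ge0// invr_ge0.
  - apply: is_cvg_geometric_series.
    by rewrite ger0_norm ?invr_ge0// invf_lt1// ltr1n.
split=> // N; have h : forall M, (N <= M)%N ->
    `|series u M - series u N| <= 2 * C * 2^-1 ^+ N.
  move=> M NM; rewrite sub_series_geq//.
  apply: le_trans (ler_norm_sum _ _ _) _.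
  apply: (@le_trans _ _ (\sum_(N <= n < M) C * 2^-1 ^+ n)).
    by apply: ler_sum => n _.
  rewrite -mulr_sumr [2 * C]mulrC -mulrA ler_wpM2l//.
  exact: sum_half_le.
apply: (@cvgr_to_le _ \oo _ _ (fun M => `|series u M - series u N|)).
  by apply: cvg_norm; apply: cvgB => //; exact: cvg_cst.
by exists N => // M /=; exact: h.
Qed.

End geometric_bound.

Lemma Rintegral_sum {d : measure_display} {T : measurableType d} {R : realType}
    (mu : {measure set T -> \bar R}) (D : set T) (I : Type) (r : seq I) (f : I -> T -> R) :
  measurable D -> (forall i, mu.-integrable D (EFin \o f i)) ->
  mu.-integrable D (EFin \o (fun x => \sum_(i <- r) f i x)) /\
  \int[mu]_(x in D) (\sum_(i <- r) f i x) = \sum_(i <- r) \int[mu]_(x in D) f i x.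
Proof.
move=> mD fi.
have -> : EFin \o (fun x => \sum_(i <- r) f i x) =
    fun x => (\sum_(i <- r) (EFin \o f i) x)%E.
  by apply/funext => x /=; rewrite sumEFin.
split; first exact: integrable_sum.
rewrite /Rintegral; under eq_integral do rewrite -sumEFin.
rewrite integral_sum//.
transitivity (fine (\sum_(i <- r) (\int[mu]_(x in D) f i x)%:E)%E); last by rewrite sumEFin.
congr fine; apply: eq_bigr => i _; rewrite fineK//.
by apply: integrable_fin_num => //; exact: fi.
Qed.

Section kernel_coef.
Context {R : realType}.
Local Notation leb := (@lebesgue_measure R).
Implicit Types (k : R -> R -> R) (t : R).

Lemma normr_Rintegral_le (D : set R) (f : R -> R) (B : R) :
  measurable D -> measurable_fun D f ->
  (\int[leb]_(x in D) `|f x|%:E <= B%:E)%E ->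
  leb.-integrable D (EFin \o f) /\ `|\int[leb]_(x in D) f x| <= B.
Proof.
move=> mD mf hB; have fi : leb.-integrable D (EFin \o f).
  apply/integrableP; split; first exact/measurable_EFinP.
  by apply: le_lt_trans hB _; exact: ltry.
by split => //; rewrite -lee_fin EFin_normr_Rintegral//; apply: le_trans hB;
  apply: le_abse_integral => //; exact/measurable_EFinP.
Qed.

Lemma lebesgue_integrableZr (D : set R) (f : R -> R) (r : R) : measurable D ->
  leb.-integrable D (EFin \o f) -> leb.-integrable D (EFin \o (fun x => f x * r)).
Proof.
move=> mD fi; rewrite (_ : EFin \o _ = fun x => ((f x)%:E * r%:E)%E); last exact/funext.
exact: integrableZr.
Qed.

Lemma lebesgue_integrableB (D : set R) (f h : R -> R) : measurable D ->
  leb.-integrable D (EFin \o f) -> leb.-integrable D (EFin \o h) ->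
  leb.-integrable D (EFin \o (fun x => f x - h x)).
Proof.
move=> mD fi hi; rewrite (_ : EFin \o _ = fun x => ((f x)%:E - (h x)%:E)%E); last exact/funext.
exact: integrableB.
Qed.

(** The moving interval (0, t) is absorbed into the extension of k by zero from the triangle 0 < s <
    t; Tonelli then applies to the positive and negative parts of the integrand, integrable or
    not. *)
Lemma measurable_kernel_coef k n : admissible_kernel k ->
  measurable_fun [set: R] (kernel_coef k n).
Proof.
move=> hk; elim: n => [|n IH]; first exact: measurable_cst.
pose F : R * R -> \bar R := fun p => (((fun p => k p.1 p.2) \_
  [set p : R * R | 0 < p.2 < p.1]) p * kernel_coef k n p.2)%:E.
have mF : measurable_fun setT F.
  apply/measurable_EFinP; apply: measurable_funM.
    exact: measurable_kernel_triangle.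
  exact: measurableT_comp.
have -> : kernel_coef k n.+1 = fun t =>
    fine (\int[leb]_s (F^\+ (t, s)) - \int[leb]_s (F^\- (t, s)))%E.
  apply/funext => t /=.
  transitivity (fine (\int[leb]_s F (t, s)))%E; last first.
    congr fine; rewrite integralE; congr (_ - _)%E; apply: eq_integral => s _.
      by rewrite !funeposE.
    by rewrite !funenegE.
  case: ifPn => t0.
    rewrite /Rintegral integral_mkcond; congr fine.
    apply: eq_integral => s _; rewrite /F /patch mem_triangle.
    by case: ifPn => //; rewrite mul0r.
  rewrite integral0_eq// => s _; rewrite /F /patch memNset ?mul0r//= => /andP[s0].
  by apply/negP; rewrite -leNgt (le_trans _ (ltW s0))// leNgt.
apply: measurableT_comp => //; apply: emeasurable_funB.
  apply: (measurable_fun_fubini_tonelli_F (m2 := leb) _ (measurable_funepos mF)).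
  by move=> x; exact: funepos_ge0.
apply: (measurable_fun_fubini_tonelli_F (m2 := leb) _ (measurable_funeneg mF)).
by move=> x; exact: funeneg_ge0.
Qed.

Lemma kernel_measurable k t : admissible_kernel k ->
  measurable_fun (`]0, t[ : set R) (k t).
Proof.
move=> hk; apply/(measurable_restrictT _ (measurable_itv _)).
exact: measurable_kernel_section.
Qed.

(** The weight expR (g * s) is at least 1 on (0, t), so the weighted bound controls the plain
    integral of |k t|. *)
Lemma kernel_integrableM k t (h : R -> R) (B : R) : admissible_kernel k ->
  0 < t -> measurable_fun (`]0, t[ : set R) h ->
  (forall s, 0 < s < t -> `|h s| <= B) ->
  leb.-integrable `]0, t[ (EFin \o (fun s => k t s * h s)).
Proof.
move=> hk t0 mh hB; have [g g0 hg] := kernel_weighted hk t0 ltr01.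
have mk := @kernel_measurable k t hk.
apply: (proj1 (normr_Rintegral_le (B := B * expR (g * t)) _ _ _)) => //.
  exact: measurable_funM.
have B0 : 0 <= B by apply: le_trans (hB (t / 2) _) => //; rewrite divr_gt0//=; lra.
have := hg t; rewrite t0 lexx mul1r => /(_ isT) {}hg.
rewrite EFinM; apply: le_trans (lee_wpmul2l _ hg); last by rewrite lee_fin.
have mke : measurable_fun (`]0, t[ : set R) (fun s => `|k t s| * expR (g * s)).
  apply: measurable_funM; first exact: measurableT_comp.
  by apply: measurable_funTS; apply: continuous_measurable_fun; exact: continuous_expRM.
rewrite -ge0_integralZl//.
- apply: ge0_le_integral => //.
  + by apply/measurable_EFinP; apply: measurableT_comp => //; exact: measurable_funM.
  + by apply/measurable_EFinP; exact: measurable_funM.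
  + move=> s /=; rewrite in_itv/= => st; rewrite lee_fin normrM mulrC.
    have /andP[s0 _] := st.
    by rewrite ler_pM ?hB// ler_peMr// -expR0 ler_expR mulr_ge0// ltW.
- exact/measurable_EFinP.
Qed.

Lemma kernel_integrable k t : admissible_kernel k -> 0 < t ->
  leb.-integrable `]0, t[ (EFin \o k t).
Proof.
move=> hk t0; have := @kernel_integrableM k t (cst 1) 1 hk t0.
rewrite (_ : (fun s => k t s * cst 1 s) = k t); last first.
  by apply/funext => s; rewrite /= mulr1.
by apply => // s _; rewrite normr1.
Qed.

Lemma kernel_integral_cvg0 k (e : R) : admissible_kernel k -> 0 < e ->
  exists2 d, 0 < d & forall t, 0 < t < d ->
    \int[leb]_(s in `]0, t[) `|k t s| <= e.
Proof.
move=> hk e0; have e20 : 0 < e / 2 by rewrite divr_gt0.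
have [g g0 hg] := kernel_weighted hk ltr01 e20.
(* With b = e / 2 it remains to have expR (g * t) <= 2; the minimum with 1 keeps t in the range for
   which g was chosen. *)
exists (Num.min 1 (ln 2 / g)).
  by rewrite lt_min ltr01 divr_gt0// ln_gt0// ltr1n.
move=> t; rewrite lt_min => /and3P[t0 t1 tg].
have := hg t; rewrite t0 (ltW t1) => /(_ isT) {}hg.
rewrite -lee_fin /Rintegral fineK; last first.
  apply: integrable_fin_num => //.
  exact: (integrable_norm (kernel_integrable hk t0)).
apply: (@le_trans _ _ (e / 2 * expR (g * t))%:E); last first.
  rewrite lee_fin -ler_pdivlMl// invf_div divfK ?gt_eqF//.
  by rewrite -[leRHS]lnK ?posrE// ler_expR mulrC -ler_pdivlMr// ltW.
apply: le_trans hg; have mk := @kernel_measurable k t hk.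
apply: ge0_le_integral => //.
- by apply/measurable_EFinP; exact: measurableT_comp.
- apply/measurable_EFinP; apply: measurable_funM; first exact: measurableT_comp.
  by apply: measurable_funTS; apply: continuous_measurable_fun; exact: continuous_expRM.
- move=> s /=; rewrite in_itv/= => /andP[s0 _].
  by rewrite lee_fin ler_peMr// -expR0 ler_expR mulr_ge0// ltW.
Qed.

(** Each integration against k gains a factor b in the weighted norm. As b is arbitrary, the c_n
    decay faster than any geometric sequence, uniformly on [0, T]; this makes [Phi] entire. *)
Lemma kernel_coef_le k (T b : R) : admissible_kernel k -> 0 < T -> 0 < b ->
  exists2 g, 0 < g & forall n t, 0 <= t <= T ->
    `|kernel_coef k n t| <= b ^+ n * expR (g * t).
Proof.
move=> hk T0 b0; have [g g0 hg] := kernel_weighted hk T0 b0.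
exists g => //; elim=> [|n IH] t /andP[t0 tT] /=.
  by rewrite normr1 expr0 mul1r -expR0 ler_expR mulr_ge0// ltW.
case: ifPn => [t1|_]; last by rewrite normr0 mulr_ge0 ?expR_ge0 ?exprn_ge0 ?ltW.
have mk := @kernel_measurable k t hk.
have me : measurable_fun (`]0, t[ : set R) (fun s => expR (g * s)).
  by apply: measurable_funTS; apply: continuous_measurable_fun; exact: continuous_expRM.
have mc : measurable_fun (`]0, t[ : set R) (kernel_coef k n).
  by apply: measurable_funTS; exact: measurable_kernel_coef.
apply: (proj2 (normr_Rintegral_le (B := b ^+ n.+1 * expR (g * t)) _ _ _)) => //.
  exact: measurable_funM.
have := hg t; rewrite t1 tT => /(_ isT) {}hg.
have bn0 : 0 <= b ^+ n by rewrite exprn_ge0// ltW.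
rewrite exprSr -mulrA EFinM; apply: le_trans (lee_wpmul2l _ hg); last by rewrite lee_fin.
have mke : measurable_fun (`]0, t[ : set R) (fun s => `|k t s| * expR (g * s)).
  by apply: measurable_funM => //; exact: measurableT_comp.
rewrite -ge0_integralZl//.
- apply: ge0_le_integral => //.
  + by apply/measurable_EFinP; apply: measurableT_comp => //; exact: measurable_funM.
  + by apply/measurable_EFinP; exact: measurable_funM.
  + move=> s /=; rewrite in_itv/= => /andP[s0 st]; rewrite lee_fin normrM mulrCA.
    by rewrite ler_wpM2l// IH// (ltW s0) (le_trans (ltW st)).
- exact/measurable_EFinP.
Qed.

End kernel_coef.

Section kernel_series.
Context {R : realType}.
Local Notation leb := (@lebesgue_measure R).
Implicit Types (k : R -> R -> R) (t l : R).

(** [Phi] on the real axis as a real number, by [Phi_real]. Complex arguments return only when an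
    associated time is rescaled. *)
Definition kernel_series k t l : R :=
  limn (series (fun n => kernel_coef k n t * l ^+ n)).

Lemma kernel_series_tail k (T l : R) : admissible_kernel k -> 0 < T ->
  exists2 C, 0 <= C & forall t, 0 <= t <= T ->
    cvgn (series (fun n => kernel_coef k n t * l ^+ n)) /\
    forall N, `|kernel_series k t l -
                series (fun n => kernel_coef k n t * l ^+ n) N|
              <= C * 2^-1 ^+ N.
Proof.
(* This ratio makes b * |l| at most 1/2, so that the terms are dominated by 2^-n; adding 1 covers l
   = 0. *)
move=> hk T0; pose b := (2 * (`|l| + 1))^-1.
have l1 : 0 < `|l| + 1 by rewrite ltr_wpDl.
have b0 : 0 < b by rewrite invr_gt0 mulr_gt0.
have [g g0 hg] := kernel_coef_le hk T0 b0.
exists (2 * expR (g * T)); first by rewrite mulr_ge0// expR_ge0.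
move=> t /andP[t0 tT]; apply: series_geometric_bound => n.
rewrite normrM normrX.
apply: (@le_trans _ _ (b ^+ n * expR (g * T) * `|l| ^+ n)).
  rewrite ler_wpM2r ?exprn_ge0//; apply: le_trans (hg _ _ _) _; first by rewrite t0.
  by rewrite ler_wpM2l ?exprn_ge0 ?(ltW b0)// ler_expR ler_wpM2l// ltW.
rewrite mulrAC -exprMn mulrC ler_wpM2l ?expR_ge0// lerXn2r ?nnegrE ?invr_ge0//.
  by rewrite mulr_ge0// ltW.
by rewrite /b invfM -mulrA ler_piMr ?invr_ge0// mulrC ler_pdivrMr// mul1r lerDl.
Qed.

Lemma kernel_series_le k (T l : R) : admissible_kernel k -> 0 < T ->
  exists2 B, 0 <= B & forall t, 0 <= t <= T -> `|kernel_series k t l| <= B.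
Proof.
move=> hk T0; have [C C0 hC] := kernel_series_tail l hk T0.
exists C => // t tT; have [_ /(_ 0)] := hC t tT.
by rewrite /series /= big_geq// subr0 expr0 mulr1.
Qed.

Lemma measurable_kernel_series k t l : admissible_kernel k -> 0 < t ->
  measurable_fun (`]0, t[ : set R) (kernel_series k ^~ l).
Proof.
move=> hk t0; have [C C0 hC] := kernel_series_tail l hk t0.
apply: (@measurable_fun_cvg _ _ _ _
  (fun n s => series (fun n => kernel_coef k n s * l ^+ n) n)).
  move=> n; apply: measurable_funTS; apply: measurable_sum => i.
  by apply: measurable_funM => //; exact: measurable_kernel_coef.
move=> s /=; rewrite in_itv/= => /andP[s0 st].
by have [] := hC s _; first by rewrite !ltW.
Qed.

(** Integration turns c_n into c_{n+1} and thus shifts the partial sums by one, up to the term c_0 =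
    1. The tails, of order 2^-N uniformly in s, are integrated against |k t|. *)
Lemma kernel_series_integral k t l : admissible_kernel k -> 0 < t ->
  l * \int[leb]_(s in `]0, t[) (k t s * kernel_series k s l) =
  kernel_series k t l - 1.
Proof.
move=> hk t0; have [C C0 hC] := kernel_series_tail l hk t0.
pose S s := series (fun n => kernel_coef k n s * l ^+ n).
have Sk N : exists2 B, 0 <= B & forall s, 0 < s < t -> `|S s N| <= B.
  have [B B0 hB] := kernel_series_le l hk t0.
  exists (B + C * 2^-1 ^+ N); first by rewrite addr_ge0// mulr_ge0// exprn_ge0// invr_ge0.
  move=> s /andP[s0 st]; have sT : 0 <= s <= t by rewrite !ltW.
  have [_ /(_ N) h] := hC s sT; rewrite -[S s N](subKr (kernel_series k s l)).
  by apply: le_trans (ler_normB _ _) _; rewrite lerD// hB.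
have mS N : measurable_fun (`]0, t[ : set R) (S ^~ N).
  apply: measurable_funTS; apply: measurable_sum => i.
  by apply: measurable_funM => //; exact: measurable_kernel_coef.
have iS N : leb.-integrable `]0, t[ (EFin \o (fun s => k t s * S s N)).
  by have [B _ hB] := Sk N; exact: kernel_integrableM hB.
have SE N : l * \int[leb]_(s in `]0, t[) (k t s * S s N) = S t N.+1 - 1.
  elim: N => [|N IH].
    rewrite /S /series /= big_nat1 expr0 mulr1 subrr.
    under eq_Rintegral do rewrite big_geq// mulr0.
    by rewrite Rintegral_cst// mul0r mulr0.
  have -> : S t N.+2 - 1 = S t N.+1 - 1 + kernel_coef k N.+1 t * l ^+ N.+1.
    by rewrite {1}/S /series/= big_nat_recr//= addrAC.
  rewrite -IH /= t0.
  have iN : leb.-integrable `]0, t[ (EFin \o (fun s => k t s * kernel_coef k N s)).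
    have [g g0 hg] := kernel_coef_le hk t0 ltr01.
    apply: (kernel_integrableM (B := expR (g * t)) hk t0).
      by apply: measurable_funTS; exact: measurable_kernel_coef.
    move=> s /andP[s0 st]; apply: le_trans (hg _ _ _) _; first by rewrite !ltW.
    by rewrite expr1n mul1r ler_expR ler_pM2l// ltW.
  rewrite exprSr mulrA [X in _ = _ + X]mulrC -mulrDr; congr (l * _).
  rewrite -RintegralZr//.
  rewrite -RintegralD//; last exact: lebesgue_integrableZr.
  apply: eq_Rintegral => s _.
  by rewrite /S /series/= big_nat_recr//= mulrDr mulrA.
have [B B0 hB] := kernel_series_le l hk t0.
have iP : leb.-integrable `]0, t[ (EFin \o (fun s => k t s * kernel_series k s l)).
  apply: (kernel_integrableM (B := B) hk t0); first exact: measurable_kernel_series.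
  by move=> s /andP[s0 st]; rewrite hB// !ltW.
set I := \int[leb]_(_ in _) _.
have cI : (\int[leb]_(s in `]0, t[) (k t s * S s N)) @[N --> \oo] --> I.
  apply/cvgrPdist_le => e e0.
  have K0 : 0 <= \int[leb]_(s in `]0, t[) `|k t s| by exact: Rintegral_ge0.
  have c0 : (C * \int[leb]_(s in `]0, t[) `|k t s|) * 2^-1 ^+ N @[N --> \oo] --> (0 : R).
    rewrite -[X in _ --> X](mulr0 (C * \int[leb]_(s in `]0, t[) `|k t s|)).
    apply: cvgM; first exact: cvg_cst.
    by apply: cvg_expr; rewrite ger0_norm ?invr_ge0// invf_lt1// ltr1n.
  move/cvgr0Pnorm_le : c0 => /(_ _ e0); apply: filterS => N.
  apply: le_trans; rewrite [leRHS]ger0_norm; last by rewrite !mulr_ge0// exprn_ge0// invr_ge0.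
  rewrite /I -RintegralB//.
  have -> : C * \int[leb]_(s in `]0, t[) `|k t s| * 2^-1 ^+ N =
      \int[leb]_(s in `]0, t[) (`|k t s| * (C * 2^-1 ^+ N)).
    rewrite RintegralZr//; first by rewrite mulrA [_ * C]mulrC.
    exact: (integrable_norm (kernel_integrable hk t0)).
  apply: le_trans (le_normr_Rintegral _ _) _ => //.
    exact: lebesgue_integrableB.
  apply: le_Rintegral => //.
  - exact: (integrable_norm (lebesgue_integrableB _ iP (iS N))).
  - apply: lebesgue_integrableZr => //.
    exact: (integrable_norm (kernel_integrable hk t0)).
  - move=> s /=; rewrite in_itv/= => /andP[s0 st]; rewrite -mulrBr normrM ler_wpM2l//.
    by have [|_ h] := hC s; [rewrite !ltW|exact: h].
have c1 : (S t N.+1 - 1) @[N --> \oo] --> kernel_series k t l - 1.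
  apply: cvgB; last exact: cvg_cst.
  by rewrite (cvg_shiftS (S t)); have [] := hC t _; rewrite ?(ltW t0) ?lexx.
have c2 : (S t N.+1 - 1) @[N --> \oo] --> l * I.
  rewrite (_ : (fun N => S t N.+1 - 1) =
    (fun N => l * \int[leb]_(s in `]0, t[) (k t s * S s N))); last by apply/funext => N; rewrite SE.
  by apply: cvgM => //; exact: cvg_cst.
exact: (cvg_unique _ c2 c1).
Qed.

Lemma Phi_real k t l : admissible_kernel k -> 0 <= t ->
  Phi k t l%:C = (kernel_series k t l)%:C.
Proof.
move=> hk t0; have T0 : 0 < t + 1 by rewrite ltr_wpDl.
have [C C0 hC] := kernel_series_tail l hk T0.
have [|cs _] := hC t; first by rewrite t0 lerDl ler01.
apply: (@cvg_lim (R[i] : numFieldType)); first exact: norm_hausdorff.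
apply/cvgrPdist_lt => e e0.
(* In the order of R[i] a positive number is real, so the tolerance can be read in R. *)
have [e1 e2] : 0 < complex.Re e /\ e = (complex.Re e)%:C.
  case: e e0 => a b; rewrite ltcE/= => /andP[/eqP -> a0]; split => //.
move/cvgrPdist_lt : cs => /(_ _ e1); apply: filterS => N hN.
rewrite [series _ N](_ : _ = (series (fun n => kernel_coef k n t * l ^+ n) N)%:C); last first.
  rewrite /series/= rmorph_sum/=; apply: eq_bigr => i _.
  by rewrite rmorphM rmorphXn.
by rewrite -rmorphB/= normc_def/= expr0n/= addr0 sqrtr_sqr e2 ltcR.
Qed.

End kernel_series.

(** * Moments and exponential moments from the Laplace transform *)

Section exp_remainder.
Context {R : realType}.
Implicit Types (x l : R).

(* [(-1) ^+ n] times the remainder of the Taylor expansion of [expR (- x)] at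
   order [n]: it lies between [0] and [x ^+ n / n`!], so that the Laplace transform
   near 0 yields the moments one after the other. *)
Fixpoint exp_remainder (n : nat) x : R :=
  if n is m.+1 then x ^+ m / m`!%:R - exp_remainder m x else expR (- x).

Lemma is_derive_exp_remainder n x :
  is_derive x 1 (exp_remainder n.+1) (exp_remainder n x).
Proof.
elim: n => [|n IH].
  have h : is_derive x 1 (fun y => expR (- 1 * y)) (- 1 * expR (- 1 * x)).
    exact: is_derive_expRM.
  rewrite (_ : exp_remainder 1 = cst 1 \- (fun y => expR (- 1 * y))); last first.
    by apply/funext => y /=; rewrite expr0 fact0 divr1 mulN1r.
  have := is_deriveB (is_derive_cst (1 : R) x 1) h.
  by rewrite [- 1 * expR _]mulN1r sub0r opprK mulN1r.
have hX : is_derive x 1 (fun y => y ^+ n.+1 / n.+1`!%:R) (x ^+ n / n`!%:R).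
  have -> : (fun y : R => y ^+ n.+1 / n.+1`!%:R) = (n.+1`!%:R)^-1 \*: (@id R ^+ n.+1).
    by apply/funext => y; rewrite /= exprfctE /GRing.scale/= mulrC.
  have := is_deriveZ (n.+1`!%:R^-1) (is_deriveX n.+1 (is_derive_id x (1 : R))).
  rewrite /GRing.scale/= mulr1 factS natrM invfM mulrACA mulVf ?pnatr_eq0//.
  by rewrite mul1r [_^-1 * x ^+ _]mulrC.
exact: is_deriveB hX IH.
Qed.

Lemma continuous_exp_remainder n : continuous (exp_remainder n).
Proof.
case: n => [|n] x.
  apply: (@continuous_comp _ _ _ (fun x => - x) expR); last exact: continuous_expR.
  exact: opp_continuous.
apply/differentiable_continuous/derivable1_diffP.
exact: (@ex_derive _ _ _ _ _ _ _ (is_derive_exp_remainder n x)).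
Qed.

Lemma exp_remainder0 n : exp_remainder n.+1 0 = 0.
Proof.
elim: n => [|n IH]; first by rewrite /= expr0 fact0 oppr0 expR0 divr1 subrr.
by rewrite [exp_remainder _ _]/= -/(exp_remainder n.+1 0) IH expr0n mul0r subr0.
Qed.

(** Beyond order 0 each remainder vanishes at 0 and has the preceding one as its derivative. *)
Lemma exp_remainder_ge0 n x : 0 <= x -> 0 <= exp_remainder n x.
Proof.
elim: n x => [|n IH] x x0; first exact: expR_ge0.
rewrite -(exp_remainder0 n).
apply: (@ger0_derive1_ndecr _ (exp_remainder n.+1) 0 x) => //.
- move=> y _; exact: (@ex_derive _ _ _ _ _ _ _ (is_derive_exp_remainder n y)).
- move=> y; rewrite in_itv/= => /andP[y0 _]; rewrite derive1E.
  by rewrite (@derive_val _ _ _ _ _ _ _ (is_derive_exp_remainder n y)) IH// ltW.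
- by apply: continuous_subspaceT; exact: continuous_exp_remainder.
Qed.

Lemma exp_remainder_le n x : 0 <= x -> exp_remainder n x <= x ^+ n / n`!%:R.
Proof. by move=> x0; rewrite -subr_ge0; exact: (exp_remainder_ge0 n.+1). Qed.

Lemma exp_remainder_ge n x : 0 <= x ->
  x ^+ n / n`!%:R - x ^+ n.+1 / n.+1`!%:R <= exp_remainder n x.
Proof. by move=> x0; have := exp_remainder_le n.+1 x0; rewrite /=; lra. Qed.

End exp_remainder.

Section moments.
Context {R : realType} {d : measure_display} {Omega : measurableType d}.
Variables (P : probability Omega R) (Y : Omega -> R) (c : nat -> R).
Hypotheses (mY : measurable_fun setT Y) (Y0 : forall w, 0 <= Y w).
Hypothesis c_le : forall b, 0 < b -> exists2 C : R, 0 <= C & forall n, `|c n| <= C * b ^+ n.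
Hypothesis Lap : forall l, 0 <= l ->
  (\int[P]_w (expR (- (l * Y w)))%:E =
   (limn (series (fun n => c n * (- l) ^+ n)))%:E)%E.

(** The counterpart of [exp_remainder] on the side of the series: up to the sign (-1)^n, the tail at
    -l from index n on. It will turn out to be the expectation of exp_remainder n (l * Y). *)
Let e := fix e n l : R := if n is m.+1 then l ^+ m * c m - e m l
  else limn (series (fun n => c n * (- l) ^+ n)).

(** The tail starts with the term l^n c_n; all later ones carry l^(n+1), with a summable factor from
    the decay of c. *)
Let e_le n : exists C, forall l, 0 < l <= 1 ->
  `|e n l - l ^+ n * c n| <= C * l ^+ n.+1.
Proof.
have [|C C0 hC] := c_le (b := 2^-1); first by rewrite invr_gt0.
exists (2 * C) => l /andP[l0 l1].
have ee m : e m l = (-1) ^+ m * (limn (series (fun n => c n * (- l) ^+ n)) -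
    series (fun n => c n * (- l) ^+ n) m).
  elim: m => [|m IH]; first by rewrite expr0 mul1r /series/= big_geq// subr0.
  rewrite /= -/e IH /series/= big_nat_recr//= exprS.
  set S := \sum_(_ <= _ < _) _; set L := limn _.
  have -> : l ^+ m * c m = (-1) ^+ m * (c m * (- l) ^+ m).
    rewrite [(- l) ^+ m]exprNn mulrCA [_ * (_ * l ^+ m)]mulrA -exprMn mulrNN mulr1.
    by rewrite expr1n mul1r mulrC.
  ring.
have hu m : `|c m * (- l) ^+ m| <= C * 2^-1 ^+ m.
  rewrite normrM normrX normrN (ger0_norm (ltW l0)); apply: le_trans (hC m).
  by rewrite ler_piMr// exprn_ile1// ltW.
have [cu _] := series_geometric_bound hu.
rewrite ee.
have -> : l ^+ n * c n = (-1) ^+ n * (c n * (- l) ^+ n).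
  rewrite [(- l) ^+ n]exprNn mulrCA [_ * (_ * l ^+ n)]mulrA -exprMn mulrNN mulr1.
  by rewrite expr1n mul1r mulrC.
rewrite -mulrBr normrM normrX normrN1 expr1n mul1r -addrA -opprD.
have -> : series (fun n => c n * (- l) ^+ n) n + c n * (- l) ^+ n =
          series (fun n => c n * (- l) ^+ n) n.+1.
  by rewrite /series/= big_nat_recr.
apply: (@cvgr_to_le _ \oo _ _ (fun M => `|series (fun n => c n * (- l) ^+ n) M -
    series (fun n => c n * (- l) ^+ n) n.+1|)).
  by apply: cvg_norm; apply: cvgB => //; exact: cvg_cst.
exists n.+1 => // M /= nM; rewrite sub_series_geq//.
apply: le_trans (ler_norm_sum _ _ _) _.
apply: (@le_trans _ _ (\sum_(n.+1 <= m < M) (C * l ^+ n.+1) * 2^-1 ^+ m)).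
  rewrite big_nat_cond [leRHS]big_nat_cond.
  apply: ler_sum => m /andP[/andP[nm _] _].
  rewrite normrM normrX normrN (ger0_norm (ltW l0)) mulrAC.
  by rewrite ler_pM ?hC ?exprn_ge0 ?(ltW l0)// ler_wiXn2l// ltW.
rewrite -mulr_sumr [leRHS](_ : _ = C * l ^+ n.+1 * 2); last first.
  by rewrite -[LHS]mulrA mulrC.
apply: ler_wpM2l; first by rewrite mulr_ge0// exprn_ge0// ltW.
apply: le_trans (sum_half_le _ _) _.
rewrite exprS mulrA mulfV ?pnatr_eq0// mul1r.
have h0 : 0 <= 2^-1 :> R by rewrite invr_ge0.
have h1 : 2^-1 <= 1 :> R by lra.
by apply: le_trans (exprn_ile1 _ h0 h1) _; rewrite ler1n.
Qed.

Let measurable_remainder n l : measurable_fun setT (fun w => exp_remainder n (l * Y w)).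
Proof.
apply: (@measurableT_comp _ _ _ _ _ _ (exp_remainder n)).
  by apply: continuous_measurable_fun; exact: continuous_exp_remainder.
by apply: measurable_funM.
Qed.

Let measurable_power n l : measurable_fun setT (fun w => (l * Y w) ^+ n / n`!%:R).
Proof.
apply: measurable_funM => //; apply: measurable_funX; exact: measurable_funM.
Qed.

(** Divided by l^n, the remainder tends to Y^n / n! as l -> 0. Since the moment might still be
    infinite, Fatou gives the upper bound c_n for it; the inequality remainder <= (l Y)^n / n! gives
    the lower one. *)
Let moment_of_remainder n :
  (forall l, 0 < l -> (\int[P]_w (exp_remainder n (l * Y w))%:E = (e n l)%:E)%E) ->
  (\int[P]_w (Y w ^+ n / n`!%:R)%:E = (c n)%:E)%E.
Proof.
move=> hn; have [C hC] := e_le n.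
have le1 : (\int[P]_w (Y w ^+ n / n`!%:R)%:E <= (c n)%:E)%E.
  (* The remainder divided by l^n, at l = 1 / (j + 1). *)
  pose f (j : nat) w := (j.+1%:R ^+ n * exp_remainder n (j.+1%:R^-1 * Y w))%:E.
  have j0 (j : nat) : 0 < j.+1%:R :> R by rewrite ltr0n.
  have mf j : measurable_fun setT (f j).
    by apply/measurable_EFinP; exact: measurable_funM.
  have f0 j w : setT w -> (0 <= f j w)%E.
    move=> _; rewrite lee_fin mulr_ge0 ?exprn_ge0//; apply: exp_remainder_ge0.
    by rewrite mulr_ge0// invr_ge0.
  have := fatou P measurableT mf f0.
  have -> : (limn_einf (fun j => \int[P]_w f j w) = (c n)%:E)%E.
    apply: (cvg_limn_einf_sup _).1.
    have -> : (fun j => \int[P]_w f j w)%E =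
        (fun j => (j.+1%:R ^+ n * e n j.+1%:R^-1)%:E).
      apply/funext => j; rewrite EFinM -hn ?invr_gt0// -ge0_integralZl//.
      + exact/measurable_EFinP.
      + move=> w _; rewrite lee_fin; apply: exp_remainder_ge0.
        by rewrite mulr_ge0// invr_ge0.
    apply/cvg_EFin; first by apply: nearW.
    apply/cvgrPdist_le => eps eps0.
    have : C * (harmonic j) @[j --> \oo] --> (0 : R).
      rewrite -[X in _ --> X](mulr0 C); apply: cvgM; first exact: cvg_cst.
      exact: cvg_harmonic.
    move/cvgr0Pnorm_le => /(_ _ eps0); apply: filterS => j; apply: le_trans.
    have := hC j.+1%:R^-1; rewrite invr_gt0 j0 invf_le1 ?ler1n// => /(_ isT) h.
    apply: le_trans (ler_norm _); rewrite /= distrC.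
    have jn0 : 0 < j.+1%:R ^+ n :> R by rewrite exprn_gt0.
    have -> : j.+1%:R ^+ n * e n j.+1%:R^-1 - c n =
        j.+1%:R ^+ n * (e n j.+1%:R^-1 - j.+1%:R^-1 ^+ n * c n).
      by rewrite mulrBr mulrA -exprMn divff ?pnatr_eq0// expr1n mul1r.
    rewrite normrM ger0_norm ?(ltW jn0)// -ler_pdivlMl// -exprVn.
    by apply: le_trans h _; rewrite exprSr mulrCA.
  apply: le_trans; rewrite le_eqVlt; apply/orP; left; apply/eqP.
  apply: eq_integral => w _; apply/esym/(cvg_limn_einf_sup _).1.
  apply/cvg_EFin; first by apply: nearW.
  have sq (j : nat) : Y w ^+ n / n`!%:R - j.+1%:R^-1 * (Y w ^+ n.+1 / n.+1`!%:R)
     <= j.+1%:R ^+ n * exp_remainder n (j.+1%:R^-1 * Y w) <= Y w ^+ n / n`!%:R.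
    have y0 : 0 <= j.+1%:R^-1 * Y w by rewrite mulr_ge0// invr_ge0.
    have jn0 : 0 < j.+1%:R ^+ n :> R by rewrite exprn_gt0.
    have jK : j.+1%:R ^+ n * j.+1%:R^-1 ^+ n = 1 :> R.
      by rewrite -exprMn divff ?pnatr_eq0// expr1n.
    have E1 : Y w ^+ n / n`!%:R = j.+1%:R ^+ n * ((j.+1%:R^-1 * Y w) ^+ n / n`!%:R).
      by rewrite exprMn !mulrA jK mul1r.
    have E2 : j.+1%:R^-1 * (Y w ^+ n.+1 / n.+1`!%:R) =
        j.+1%:R ^+ n * ((j.+1%:R^-1 * Y w) ^+ n.+1 / n.+1`!%:R).
      by rewrite exprMn [j.+1%:R^-1 ^+ n.+1]exprSr !mulrA jK mul1r.
    by rewrite E1 E2 -mulrBr !ler_pM2l// exp_remainder_le// exp_remainder_ge.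
  apply: (@squeeze_cvgr _ _ _ _ (fun j : nat => Y w ^+ n / n`!%:R -
    j.+1%:R^-1 * (Y w ^+ n.+1 / n.+1`!%:R)) (fun=> Y w ^+ n / n`!%:R)).
  - by apply: nearW => j; exact: sq.
  - rewrite -[X in _ --> X]subr0; apply: cvgB; first exact: cvg_cst.
    rewrite -[X in _ --> X](mul0r (Y w ^+ n.+1 / n.+1`!%:R)).
    by apply: cvgM; [exact: cvg_harmonic|exact: cvg_cst].
  - exact: cvg_cst.
apply/eqP; rewrite eq_le le1/=.
have m0 : (0 <= \int[P]_w (Y w ^+ n / n`!%:R)%:E)%E.
  by apply: integral_ge0 => w _; rewrite lee_fin divr_ge0// exprn_ge0.
set I := (\int[P]_w _)%E in m0 le1 *.
have If : I = (fine I)%:E by rewrite fineK// ge0_fin_numE// (le_lt_trans le1) ?ltry.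
rewrite If lee_fin; apply/ler_addgt0Pr => eps eps0.
(* Small enough for the error C l^(n+1) of [e_le] to be at most eps * l^n. *)
pose l := Num.min 1 (eps / (`|C| + 1)).
have C1 : 0 < `|C| + 1 by rewrite ltr_wpDl.
have l0 : 0 < l by rewrite lt_min ltr01 divr_gt0.
have l1 : l <= 1 by rewrite ge_min lexx.
have Cl : `|C| * l <= eps.
  apply: (@le_trans _ _ ((`|C| + 1) * l)); first by rewrite ler_wpM2r ?(ltW l0)// lerDl.
  by rewrite -ler_pdivlMl// mulrC ge_min lexx orbT.
have ln0 : 0 < l ^+ n by rewrite exprn_gt0.
have h1 : e n l <= l ^+ n * fine I.
  rewrite -lee_fin -hn// EFinM -If -ge0_integralZl//; last 3 first.
  - by have := measurable_power n 1; under eq_fun do rewrite mul1r; move/measurable_EFinP.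
  - by move=> w _; rewrite lee_fin divr_ge0// exprn_ge0.
  - by rewrite lee_fin ltW.
  apply: ge0_le_integral => //.
  - by move=> w _; rewrite lee_fin exp_remainder_ge0// mulr_ge0// ltW.
  - exact/measurable_EFinP.
  - apply/measurable_EFinP; apply: measurable_funM => //.
    by have := measurable_power n 1; under eq_fun do rewrite mul1r.
  - move=> w _; rewrite lee_fin mulrA -exprMn; apply: exp_remainder_le.
    by rewrite mulr_ge0// ltW.
have := hC l; rewrite l0 l1 => /(_ isT); rewrite ler_norml => /andP[h2 _].
have h3 : l ^+ n * c n <= l ^+ n * (fine I + eps).
  rewrite mulrDr; have : C * l ^+ n.+1 <= l ^+ n * eps.
    rewrite exprSr mulrCA ler_pM2l//; apply: le_trans Cl.
    by rewrite ler_wpM2r ?(ltW l0)// ler_norm.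
  by move: h1 h2; lra.
by move: h3; rewrite ler_pM2l.
Qed.

(** Once the n-th moment is known to be finite it may be subtracted, which gives the expectation of
    the next remainder and from it the next moment. *)
Lemma moment_eq n : (\int[P]_w (Y w ^+ n / n`!%:R)%:E = (c n)%:E)%E.
Proof.
apply: moment_of_remainder; elim: n => [|n IH] l l0 /=.
  by rewrite Lap// ltW.
have Mn := moment_of_remainder IH.
under eq_integral do rewrite EFinB.
have p0 w : 0 <= (l * Y w) ^+ n / n`!%:R.
  by rewrite divr_ge0// exprn_ge0// mulr_ge0// ltW.
have ln0 : 0 <= l ^+ n by rewrite exprn_ge0// ltW.
have Mp : (\int[P]_w ((l * Y w) ^+ n / n`!%:R)%:E = (l ^+ n * c n)%:E)%E.
  rewrite EFinM -Mn -ge0_integralZl//.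
  - by apply: eq_integral => w _; rewrite -EFinM mulrA -exprMn.
  - by have := measurable_power n 1; under eq_fun do rewrite mul1r; move/measurable_EFinP.
  - by move=> w _; rewrite lee_fin divr_ge0// exprn_ge0.
have i1 : P.-integrable setT (EFin \o (fun w => (l * Y w) ^+ n / n`!%:R)).
  apply/integrableP; split; first exact/measurable_EFinP.
  under eq_integral do rewrite /= ger0_norm//.
  by rewrite Mp ltry.
have i2 : P.-integrable setT (EFin \o (fun w => exp_remainder n (l * Y w))).
  apply/integrableP; split; first exact/measurable_EFinP.
  under eq_integral do rewrite /= ger0_norm ?exp_remainder_ge0 ?mulr_ge0 ?(ltW l0)//.
  by rewrite IH// ltry.
by rewrite integralB_EFin// Mp IH.
Qed.

(** For l > 0 the terms of the exponential series are nonnegative and may be integrated one by one,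
    so the exponential moment is finite by the decay of c. For l <= 0 it is the given Laplace
    transform. *)
Lemma exp_moment_eq l :
  (\int[P]_w (expR (l * Y w))%:E = (limn (series (fun n => c n * l ^+ n)))%:E)%E.
Proof.
have [l0|l0] := leP l 0.
  rewrite -(opprK l) -Lap ?oppr_ge0//; by under eq_integral do rewrite mulNr.
have c0 n : 0 <= c n.
  rewrite -lee_fin -moment_eq; apply: integral_ge0 => w _.
  by rewrite lee_fin divr_ge0// exprn_ge0.
have l2 : 0 < (2 * l)^-1 by rewrite invr_gt0 mulr_gt0.
have [C C0 hC] := c_le l2.
have hu m : `|c m * l ^+ m| <= C * 2^-1 ^+ m.
  rewrite normrM normrX (ger0_norm (ltW l0)).
  apply: (@le_trans _ _ (C * (2 * l)^-1 ^+ m * l ^+ m)).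
    by rewrite ler_wpM2r ?exprn_ge0 ?(ltW l0).
  by rewrite -mulrA -exprMn invfM mulfVK ?gt_eqF.
have [cu _] := series_geometric_bound hu.
transitivity (\int[P]_w (\sum_(0 <= n <oo) ((l * Y w) ^+ n / n`!%:R)%:E))%E.
  apply: eq_integral => w _; rewrite /expR -EFin_lim; last exact: is_cvg_series_exp_coeff.
  by congr (limn _); apply/funext => n /=; rewrite /series/= sumEFin.
rewrite integral_nneseries//; first last.
- by move=> n w _; rewrite lee_fin divr_ge0// exprn_ge0// mulr_ge0// ltW.
- by move=> n; exact/measurable_EFinP.
rewrite -EFin_lim//; congr (limn _); apply/funext => n /=.
rewrite /series/= -sumEFin; apply: eq_bigr => i _.
under eq_integral do rewrite exprMn -mulrA EFinM.
rewrite ge0_integralZl//.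
- by rewrite moment_eq -EFinM mulrC.
- by have := measurable_power i 1; under eq_fun do rewrite mul1r; move/measurable_EFinP.
- by move=> w _; rewrite lee_fin divr_ge0// exprn_ge0.
- by rewrite lee_fin exprn_ge0// ltW.
Qed.

End moments.

(** * Bernstein polynomials and vector-valued approximation on [0, 1] *)

Section bernstein.
Context {R : realType}.
Implicit Types (N j : nat) (y : R).

(** The probability of j successes in N trials with success probability X, by conditioning on one
    trial. In this form positivity, total mass and variance are inductions on N. *)
Fixpoint bernstein N j : {poly R} :=
  match N, j with
  | 0, 0 => 1
  | 0, _.+1 => 0
  | M.+1, 0 => (1 - 'X) * bernstein M 0
  | M.+1, i.+1 => 'X * bernstein M i + (1 - 'X) * bernstein M i.+1
  end.

Lemma bernstein_gt N j : (N < j)%N -> bernstein N j = 0.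
Proof.
elim: N j => [|N IH] [|j]//=; rewrite ltnS => Nj.
by rewrite !IH ?mulr0 ?addr0// ltnW.
Qed.

Lemma bernstein_ge0 N j y : 0 <= y <= 1 -> 0 <= (bernstein N j).[y].
Proof.
move=> /andP[y0 y1]; have y1' : 0 <= 1 - y by rewrite subr_ge0.
elim: N j => [|N IH] [|j] /=; rewrite ?hornerE ?ler01//.
  by rewrite mulr_ge0.
by rewrite addr_ge0// mulr_ge0.
Qed.

Lemma bernstein_rec (N : nat) (V : lmodType {poly R}) (f : nat -> V) :
  \sum_(j < N.+2) bernstein N.+1 j *: f j =
  'X *: \sum_(j < N.+1) bernstein N j *: f j.+1 +
  (1 - 'X) *: \sum_(j < N.+1) bernstein N j *: f j.
Proof.
have -> : \sum_(j < N.+1) bernstein N j *: f j = \sum_(j < N.+2) bernstein N j *: f j.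
  by rewrite [RHS]big_ord_recr/= bernstein_gt// scale0r addr0.
rewrite big_ord_recl [X in _ = _ + _ *: X]big_ord_recl /= scalerDr.
rewrite addrCA scalerA; congr (_ + _).
rewrite !scaler_sumr -big_split/=; apply: eq_bigr => i _.
by rewrite !scalerA scalerDl.
Qed.

Lemma bernstein_sum N : \sum_(j < N.+1) bernstein N j = 1.
Proof.
elim: N => [|N IH]; first by rewrite big_ord1.
have := @bernstein_rec N {poly R}^o (fun=> 1).
have E M : \sum_(j < M.+1) bernstein M j *: (1 : {poly R}^o) = \sum_(j < M.+1) bernstein M j.
  by apply: eq_bigr => i _; rewrite /GRing.scale/= mulr1.
by rewrite !E IH /GRing.scale/= !mulr1 => ->; rewrite addrC subrK.
Qed.

(** The variance of a binomial law: one more trial adds y (1 - y), the cross term vanishing because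
    the centred trial has mean zero. *)
Lemma bernstein_variance N y :
  \sum_(j < N.+1) (bernstein N j).[y] * (j%:R - N%:R * y) ^+ 2 =
  N%:R * (y * (1 - y)).
Proof.
have rec M (f : nat -> R) : \sum_(j < M.+2) (bernstein M.+1 j).[y] * f j =
    \sum_(j < M.+1) (bernstein M j).[y] * (y * f j.+1 + (1 - y) * f j).
  have E K L (g : nat -> R) :
      (\sum_(j < K) bernstein L j * (g j)%:P).[y] = \sum_(j < K) (bernstein L j).[y] * g j.
    by rewrite horner_sum; apply: eq_bigr => i _; rewrite hornerM hornerC.
  rewrite -E (@bernstein_rec M {poly R}^o (fun j => (f j)%:P)) /GRing.scale/=.
  rewrite hornerD !hornerM (E _ _ (fun j => f j.+1)) !E !hornerE.
  rewrite !mulr_sumr -big_split/=; apply: eq_bigr => i _; ring.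
elim: N => [|N IH]; first by rewrite big_ord1 !mul0r subr0 expr0n/= mulr0.
rewrite (rec N (fun j => (j%:R - N.+1%:R * y) ^+ 2)).
transitivity (\sum_(j < N.+1) ((bernstein N j).[y] * (j%:R - N%:R * y) ^+ 2 +
    (bernstein N j).[y] * (y * (1 - y)))).
  by apply: eq_bigr => i _; rewrite -(natr1 N) -(natr1 i); ring.
rewrite big_split/= IH -mulr_suml -horner_sum bernstein_sum hornerC mul1r.
by rewrite -natr1 mulrDl mul1r.
Qed.

Context {X : normedModType R}.

Lemma uniformly_continuous_segment (F : R -> X) (e : R) : continuous F -> 0 < e ->
  exists2 d, 0 < d & forall y z, 0 <= y <= 1 -> `|y - z| < d -> `|F z - F y| <= e.
Proof.
move=> cF e0.
have /compact_near_coveringP : compact (`[0, 1] : set R) by exact: segment_compact.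
move=> /(_ R (0^'+) (fun d y => forall z, `|y - z| < d -> `|F z - F y| <= e) _) H.
have {H}/H H : forall y : R, `[0, 1]%classic y -> \forall y' \near y & d \near 0^'+,
    forall z, `|y' - z| < d -> `|F z - F y'| <= e.
  move=> y _; have e20 : 0 < e / 2 by rewrite divr_gt0.
  have /cvgrPdist_le /(_ _ e20) /nbhs_ballP [r /= r0 hr] := cF y.
  have r20 : 0 < r / 2 by rewrite divr_gt0.
  exists (ball y (r / 2), [set d | 0 < d < r / 2]).
    split => /=; first exact: nbhsx_ballx.
    near=> d; apply/andP; split; near: d; [exact: nbhs_right_gt|exact: nbhs_right_lt].
  move=> [y' d] [/= yy' /andP[d0 dr]] z y'z.
  have {}yy' : `|y - y'| < r / 2 by [].
  have h1 : `|F y - F y'| <= e / 2.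
    apply: hr; apply: (lt_trans yy').
    by rewrite ltr_pdivrMr// ltr_pMr// ltr1n.
  have h2 : `|F y - F z| <= e / 2.
    apply: hr; rewrite /ball/= -[y - z](subrKA y').
    apply: le_lt_trans (ler_normD _ _) _; rewrite [r]splitr ltrD//.
    exact: lt_trans y'z dr.
  rewrite -(subrKA (F y)) [e]splitr (le_trans (ler_normD _ _))// lerD//.
  by rewrite distrC.
have [d [d0 hd]] := filter_ex (filterI (nbhs_right_gt (0 : R)) H).
by exists d => // y z y01; apply: hd; rewrite /= in_itv.
Unshelve. all: by end_near. Qed.

(** Chebyshev's inequality: nodes within d of y contribute at most e / 2 by uniform continuity, the
    others at most 2 M / (d^2 N) by the variance. The norm stands inside the sum because sums for
    different N are later compared node by node. *)
Lemma bernstein_error (F : R -> X) (e : R) : continuous F -> 0 < e ->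
  \forall N \near \oo, forall y, 0 <= y <= 1 ->
    \sum_(j < N.+1) (bernstein N j).[y] * `|F (j%:R / N%:R) - F y| <= e.
Proof.
move=> cF e0; have e20 : 0 < e / 2 by rewrite divr_gt0.
have [d d0 hd] := uniformly_continuous_segment cF e20.
have [M M0 hM] : exists2 M, 0 <= M & forall y, 0 <= y <= 1 -> `|F y| <= M.
  have [c _ hc] := @EVT_max R (fun y => `|F y|) 0 1 ler01
    (continuous_subspaceT (fun y => continuous_comp (cF y) (@norm_continuous _ _ _))).
  by exists `|F c| => // y y01; apply: hc; rewrite in_itv.
have K0 : 0 <= 4 * M / (d ^+ 2 * e) by rewrite divr_ge0 ?mulr_ge0 ?exprn_ge0 ?(ltW d0) ?(ltW e0).
near=> N => y /andP[y0 y1]; have y01 : 0 <= y <= 1 by rewrite y0.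
have N0 : 0 < N%:R :> R by rewrite ltr0n; near: N; exists 1%N.
have NK : 4 * M / (d ^+ 2 * e) <= N%:R by near: N; exact: nbhs_infty_ger.
apply: (@le_trans _ _ (\sum_(j < N.+1) ((bernstein N j).[y] * (e / 2) +
    2 * M / (d * N%:R) ^+ 2 * ((bernstein N j).[y] * (j%:R - N%:R * y) ^+ 2)))).
  apply: ler_sum => j _; rewrite [2 * M / _ * _]mulrCA -mulrDr.
  apply: ler_wpM2l; first exact: bernstein_ge0.
  have q0 : 0 <= 2 * M / (d * N%:R) ^+ 2 * (j%:R - N%:R * y) ^+ 2.
    by rewrite mulr_ge0 ?sqr_ge0// divr_ge0 ?sqr_ge0// mulr_ge0.
  have j01 : 0 <= (j%:R : R) / N%:R <= 1.
    by rewrite divr_ge0//= ler_pdivrMr// mul1r ler_nat -ltnS.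
  have [hj|hj] := ltP `|y - j%:R / N%:R| d.
    by apply: le_trans (hd _ _ y01 hj) _; rewrite lerDl.
  apply: (@le_trans _ _ (2 * M)).
    apply: le_trans (ler_normB _ _) _; have := hM _ j01; have := hM _ y01; lra.
  rewrite -[leLHS]add0r lerD ?(ltW e20)// -(mulrA (2 * M)) ler_peMr ?mulr_ge0//.
  rewrite mulrC ler_pdivlMr ?exprn_gt0 ?mulr_gt0// mul1r -ler_sqrt ?sqr_ge0//.
  rewrite !sqrtr_sqr ger0_norm ?mulr_ge0 ?(ltW d0)//.
  have -> : j%:R - N%:R * y = N%:R * (j%:R / N%:R - y).
    by rewrite mulrBr mulrCA mulfV ?gt_eqF// mulr1.
  by rewrite normrM ger0_norm// mulrC distrC ler_wpM2l.
rewrite big_split/= -mulr_suml -mulr_sumr -horner_sum bernstein_sum hornerC mul1r.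
rewrite bernstein_variance [leRHS]splitr lerD2l.
apply: (@le_trans _ _ (2 * M / (d * N%:R) ^+ 2 * N%:R)).
  apply: ler_wpM2l; first by rewrite divr_ge0 ?sqr_ge0// mulr_ge0.
  rewrite ler_piMr// mulr_ile1 ?subr_ge0//; lra.
have -> : 2 * M / (d * N%:R) ^+ 2 * N%:R = 2 * M / d ^+ 2 / N%:R.
  by field; rewrite !gt_eqF.
rewrite ler_pdivrMr// -ler_pdivrMl//; apply: le_trans NK.
rewrite le_eqVlt; apply/orP; left; apply/eqP.
by field; rewrite !gt_eqF.
Unshelve. all: by end_near. Qed.

End bernstein.

(** * Integration of vector-valued functions by a positive functional on polynomials *)

Section exp_functional.
Context {R : realType}.
Variables (om : R) (phi : R -> R).
Implicit Types (p q : {poly R}) (N : nat).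

(* If [phi] is the moment generating function of [Y], then [exp_functional p]
   is the expectation of [expR (om * Y) * p.[expR (- Y)]]. *)
Definition exp_functional p : R := \sum_(i < size p) p`_i * phi (om - i%:R).

Lemma exp_functional_widen p n : (size p <= n)%N ->
  exp_functional p = \sum_(i < n) p`_i * phi (om - i%:R).
Proof.
move=> pn; rewrite /exp_functional (big_ord_widen n (fun i : nat => p`_i * phi (om - i%:R)) pn).
rewrite big_mkcond/=; apply: eq_bigr => i _; case: ltnP => // pi.
by rewrite nth_default// mul0r.
Qed.

Lemma exp_functionalD p q : exp_functional (p + q) = exp_functional p + exp_functional q.
Proof.
pose n := maxn (size p) (size q).
rewrite (@exp_functional_widen (p + q) n); last exact: size_polyD.
rewrite (@exp_functional_widen p n) ?leq_maxl// (@exp_functional_widen q n) ?leq_maxr//.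
by rewrite -big_split/=; apply: eq_bigr => i _; rewrite coefD mulrDl.
Qed.

Lemma exp_functionalZ c p : exp_functional (c *: p) = c * exp_functional p.
Proof.
rewrite (@exp_functional_widen _ (size p)); last exact: size_scale_leq.
by rewrite mulr_sumr; apply: eq_bigr => i _; rewrite coefZ mulrA.
Qed.

Lemma exp_functional0 : exp_functional 0 = 0.
Proof. by rewrite /exp_functional size_poly0 big_ord0. Qed.

Lemma exp_functional_sum (I : Type) (r : seq I) (F : I -> {poly R}) :
  exp_functional (\sum_(i <- r) F i) = \sum_(i <- r) exp_functional (F i).
Proof.
elim: r => [|i r IH]; first by rewrite !big_nil exp_functional0.
by rewrite !big_cons exp_functionalD IH.
Qed.

Lemma exp_functional1 : exp_functional 1 = phi om.
Proof. by rewrite /exp_functional size_poly1 big_ord1 coef1 mul1r subr0. Qed.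

(** The form in which a law enters the construction: a condition on [phi] alone, which makes no
    reference to a starting point. *)
Definition positive_functional : Prop := forall p,
  (forall y, 0 <= y <= 1 -> 0 <= p.[y]) -> 0 <= exp_functional p.

Hypothesis ev_ge0 : positive_functional.

Lemma exp_functional_le p q : (forall y, 0 <= y <= 1 -> p.[y] <= q.[y]) ->
  exp_functional p <= exp_functional q.
Proof.
move=> pq; rewrite -subr_ge0 -[- exp_functional p]mulN1r -exp_functionalZ.
rewrite -exp_functionalD; apply: ev_ge0 => y y01.
by rewrite scaleN1r hornerD hornerN subr_ge0 pq.
Qed.

Lemma bernstein_functional_ge0 N j : 0 <= exp_functional (bernstein N j).
Proof. by apply: ev_ge0 => y; exact: bernstein_ge0. Qed.

Lemma bernstein_functional_sum N :
  \sum_(j < N.+1) exp_functional (bernstein N j) = phi om.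
Proof. by rewrite -exp_functional_sum bernstein_sum exp_functional1. Qed.

Context {X : completeNormedModType R}.
Implicit Types F : R -> X.

Definition bernstein_integral N F : X :=
  \sum_(j < N.+1) exp_functional (bernstein N j) *: F (j%:R / N%:R).

Definition bernstein_error_le F N (e : R) : Prop := forall y, 0 <= y <= 1 ->
  \sum_(j < N.+1) (bernstein N j).[y] * `|F (j%:R / N%:R) - F y| <= e.

(* The weights of the products of two Bernstein polynomials are nonnegative and
   have both families of Bernstein weights as their marginals. *)
Lemma bernstein_integral_dist F N M (e e' : R) :
  bernstein_error_le F N e -> bernstein_error_le F M e' ->
  `|bernstein_integral N F - bernstein_integral M F| <= (e + e') * phi om.
Proof.
move=> hN hM.
pose w (j i : nat) := exp_functional (bernstein N j * bernstein M i).
have -> : bernstein_integral N F =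
    \sum_(j < N.+1) \sum_(i < M.+1) w j i *: F (j%:R / N%:R).
  apply: eq_bigr => j _; rewrite -scaler_suml; congr (_ *: _).
  by rewrite -exp_functional_sum -mulr_sumr bernstein_sum mulr1.
have -> : bernstein_integral M F =
    \sum_(j < N.+1) \sum_(i < M.+1) w j i *: F (i%:R / M%:R).
  rewrite exchange_big/=; apply: eq_bigr => i _.
  rewrite -scaler_suml; congr (_ *: _).
  by rewrite -exp_functional_sum -mulr_suml bernstein_sum mul1r.
rewrite -sumrB; under eq_bigr do rewrite -sumrB.
pose D (j i : nat) := `|F (j%:R / N%:R) - F (i%:R / M%:R)|.
apply: (@le_trans _ _ (\sum_(j < N.+1) \sum_(i < M.+1) D j i * w j i)).
  apply: le_trans (ler_norm_sum _ _ _) _; apply: ler_sum => j _.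
  apply: le_trans (ler_norm_sum _ _ _) _; apply: ler_sum => i _.
  rewrite -scalerBr normrZ mulrC ler_wpM2l// ger0_norm//.
  by apply: ev_ge0 => y y01; rewrite hornerM mulr_ge0 ?bernstein_ge0.
have -> : \sum_(j < N.+1) \sum_(i < M.+1) D j i * w j i = exp_functional
    (\sum_(j < N.+1) \sum_(i < M.+1) D j i *: (bernstein N j * bernstein M i)).
  rewrite exp_functional_sum; apply: eq_bigr => j _.
  by rewrite exp_functional_sum; apply: eq_bigr => i _; rewrite exp_functionalZ.
(* Positivity reduces the estimate to one between polynomials on [0, 1], where both nodes are
   compared with F y. *)
rewrite -exp_functional1 -exp_functionalZ; apply: exp_functional_le => y y01.
rewrite hornerZ hornerC mulr1 horner_sum.
under eq_bigr do rewrite horner_sum.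
pose b K (j : nat) := (bernstein K j).[y].
apply: (@le_trans _ _ (\sum_(j < N.+1) \sum_(i < M.+1)
   (b M i * (b N j * `|F (j%:R / N%:R) - F y|) +
    b N j * (b M i * `|F (i%:R / M%:R) - F y|)))).
  apply: ler_sum => j _; apply: ler_sum => i _.
  rewrite hornerZ hornerM mulrC [b M i * _]mulrCA -mulrDr -mulrDr -mulrA.
  rewrite ler_wpM2l ?bernstein_ge0// ler_wpM2l ?bernstein_ge0//.
  by rewrite /D -(subrKA (F y)) (le_trans (ler_normD _ _))// lerD2l distrC.
under eq_bigr do rewrite big_split/=.
rewrite big_split/= lerD//.
  under eq_bigr do rewrite -mulr_suml.
  by rewrite -mulr_sumr -horner_sum bernstein_sum hornerC mul1r hN.
under eq_bigr do rewrite -mulr_sumr.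
by rewrite -mulr_suml -horner_sum bernstein_sum hornerC mul1r hM.
Qed.

Lemma bernstein_integral_cvg F : continuous F -> cvgn (bernstein_integral ^~ F).
Proof.
move=> cF; apply/cauchy_cvgP/cauchyP => e e0.
pose e1 := e / (3 * (phi om + 1)).
have phi0 : 0 <= phi om.
  by rewrite -exp_functional1; apply: ev_ge0 => y _; rewrite hornerC.
have e10 : 0 < e1 by rewrite divr_gt0// mulr_gt0// ltr_wpDl.
have [N _ hN] := bernstein_error cF e10.
exists (bernstein_integral N F), N => // M /= NM.
rewrite -ball_normE /=.
apply: le_lt_trans (bernstein_integral_dist (hN _ (leqnn N)) (hN _ NM)) _.
rewrite /e1 -mulrDl mulrAC ltr_pdivrMr ?mulr_gt0 ?ltr_wpDl//.
nra.
Qed.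

Definition bernstein_limit F : X := limn (bernstein_integral ^~ F).

Lemma bernstein_limit_dist F N (e : R) : continuous F -> bernstein_error_le F N e ->
  `|bernstein_limit F - bernstein_integral N F| <= e * phi om.
Proof.
move=> cF hN; have phi0 : 0 <= phi om.
  by rewrite -exp_functional1; apply: ev_ge0 => y _; rewrite hornerC.
apply/ler_addgt0Pr => eps eps0.
have e20 : 0 < eps / (phi om + 1) by rewrite divr_gt0// ltr_wpDl.
apply: (@cvgr_to_le _ \oo _ _
  (fun M => `|bernstein_integral M F - bernstein_integral N F|)).
  by apply: cvg_norm; apply: cvgB; [exact: bernstein_integral_cvg|exact: cvg_cst].
have := bernstein_error cF e20; apply: filterS => M hM.
apply: le_trans (bernstein_integral_dist hM hN) _.
rewrite mulrDl addrC lerD2l mulrAC ler_pdivrMr ?ltr_wpDl//.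
by rewrite ler_wpM2l ?(ltW eps0)// lerDl.
Qed.

End exp_functional.

Section bounded_functional.
Context {R : realType} {X : normedModType R}.
Variables (l : X -> R) (C : R).
Hypotheses (lin : forall (a : R) (u v : X), l (a *: u + v) = a * l u + l v)
  (lb : forall u, `|l u| <= C * `|u|).

Lemma functional0 : l 0 = 0.
Proof.
have := lin 1 0 0; rewrite scale1r addr0 mul1r => /eqP.
by rewrite -subr_eq0 opprD addNKr oppr_eq0 => /eqP.
Qed.

Lemma functionalZ a u : l (a *: u) = a * l u.
Proof. by rewrite -[a *: u]addr0 lin functional0 addr0. Qed.

Lemma functionalD u v : l (u + v) = l u + l v.
Proof. by rewrite -[u in LHS]scale1r lin mul1r. Qed.

Lemma functionalB u v : l (u - v) = l u - l v.
Proof. by rewrite functionalD -scaleN1r functionalZ mulN1r. Qed.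

Lemma functional_le u : `|l u| <= `|C| * `|u|.
Proof. by apply: le_trans (lb u) _; rewrite ler_wpM2r// ler_norm. Qed.

Lemma functional_continuous : continuous (l : X -> R).
Proof.
move=> u; apply/cvgrPdist_le => e e0.
have C1 : 0 < `|C| + 1 by rewrite ltr_wpDl.
have d0 : 0 < e / (`|C| + 1) by rewrite divr_gt0.
have /cvgrPdist_le /(_ _ d0) := @cvg_id _ (nbhs u).
apply: filterS => v uv; rewrite -functionalB; apply: le_trans (functional_le _) _.
apply: (@le_trans _ _ ((`|C| + 1) * `|u - v|)); first by rewrite ler_wpM2r// lerDl.
by rewrite mulrC -ler_pdivlMr.
Qed.

End bounded_functional.

Section exp_functional_expectation.
Context {R : realType} {d : measure_display} {Omega : measurableType d}.
Variables (P : probability Omega R) (Y : Omega -> R) (om : R) (phi : R -> R).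

Definition has_mgf : Prop := [/\ measurable_fun setT Y, forall w, 0 <= Y w &
  forall l, (\int[P]_w (expR (l * Y w))%:E = (phi l)%:E)%E].

Hypothesis hY : has_mgf.

Let mY : measurable_fun setT Y. Proof. by case: hY. Qed.
Let Y0 w : 0 <= Y w. Proof. by case: hY. Qed.
Let hphi l : (\int[P]_w (expR (l * Y w))%:E = (phi l)%:E)%E. Proof. by case: hY. Qed.

Let measurable_exp l : measurable_fun setT (fun w => expR (l * Y w)).
Proof. by apply: measurableT_comp => //; exact: measurable_funM. Qed.

Lemma mgf_integrable l : P.-integrable setT (EFin \o (fun w => expR (l * Y w))).
Proof.
apply/integrableP; split; first exact/measurable_EFinP.
under eq_integral do rewrite /= ger0_norm ?expR_ge0//.
by rewrite hphi ltry.
Qed.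

Lemma mgf_dominated (h : Omega -> R) (C l : R) : measurable_fun setT h ->
  (forall w, `|h w| <= C * expR (l * Y w)) ->
  P.-integrable setT (EFin \o h) /\ `|\int[P]_w h w| <= C * phi l.
Proof.
move=> mh hC; have C0 : 0 <= C.
  have := hC point; move/(le_trans (normr_ge0 _)).
  by rewrite pmulr_lge0// expR_gt0.
have iC : P.-integrable setT (EFin \o (fun w => C * expR (l * Y w))).
  rewrite (_ : EFin \o _ = fun w => (C%:E * (expR (l * Y w))%:E)%E); last exact/funext.
  by apply: integrableZl => //; exact: mgf_integrable.
have ih : P.-integrable setT (EFin \o h).
  apply: le_integrable iC => //; first exact/measurable_EFinP.
  move=> w _ /=; rewrite lee_fin [leRHS]ger0_norm//.
  by rewrite mulr_ge0// expR_ge0.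
split=> //; apply: le_trans (le_normr_Rintegral _ ih) _ => //.
have -> : C * phi l = \int[P]_w (C * expR (l * Y w)).
  rewrite RintegralZl//; last exact: mgf_integrable.
  by rewrite /Rintegral hphi.
by apply: le_Rintegral => //; exact: (integrable_norm ih).
Qed.

Lemma exp_functionalE (p : {poly R}) :
  P.-integrable setT (EFin \o (fun w => expR (om * Y w) * p.[expR (- Y w)])) /\
  \int[P]_w (expR (om * Y w) * p.[expR (- Y w)]) = exp_functional om phi p.
Proof.
have E w : expR (om * Y w) * p.[expR (- Y w)] =
    \sum_(i < size p) p`_i * expR ((om - i%:R) * Y w).
  rewrite horner_coef mulr_sumr; apply: eq_bigr => i _.
  by rewrite mulrCA -expRM_natl -expRD mulrBl mulrN.
have ip (i : 'I_(size p)) : P.-integrable setT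
    (fun w => (p`_i * expR ((om - i%:R) * Y w))%:E).
  by under eq_fun do rewrite EFinM; apply: integrableZl => //; exact: mgf_integrable.
have -> : EFin \o (fun w => expR (om * Y w) * p.[expR (- Y w)]) =
   (fun w => (\sum_(i < size p) (p`_i * expR ((om - i%:R) * Y w))%:E)%E).
  by apply/funext => w /=; rewrite E sumEFin.
split; first exact: integrable_sum.
rewrite /Rintegral; under eq_integral do rewrite E -sumEFin.
rewrite integral_sum//.
transitivity (fine (\sum_(i < size p) (p`_i * phi (om - i%:R))%:E)%E); last by rewrite sumEFin.
congr fine; apply: eq_bigr => i _; under eq_integral do rewrite EFinM.
by rewrite integralZl//; [rewrite hphi|exact: mgf_integrable].
Qed.

Lemma mgf_positive_functional : positive_functional om phi.
Proof.
move=> p p0; have [_ <-] := exp_functionalE p; apply: Rintegral_ge0 => w _.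
rewrite mulr_ge0 ?expR_ge0// p0// expR_ge0/= -expR0 ler_expR oppr_le0//.
Qed.

(* [l] is a bounded linear functional on [X]; it is kept as a bare function in
   view of evaluation at a point. *)
Lemma bernstein_limit_functional {X : completeNormedModType R} (F : R -> X)
    (l : X -> R) (C : R) : continuous F ->
  (forall (a : R) (u v : X), l (a *: u + v) = a * l u + l v) ->
  (forall u, `|l u| <= C * `|u|) ->
  P.-integrable setT (EFin \o (fun w => expR (om * Y w) * l (F (expR (- Y w))))) /\
  l (bernstein_limit om phi F) =
    \int[P]_w (expR (om * Y w) * l (F (expR (- Y w)))).
Proof.
move=> cF lin lb; have ev0 := mgf_positive_functional.
have lZ := functionalZ lin; have lB := functionalB lin.
have lsum n (f : 'I_n -> X) : l (\sum_(i < n) f i) = \sum_(i < n) l (f i).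
  exact: (big_morph l (functionalD lin) (functional0 lin)).
have cl := functional_continuous lin lb.
have clF : continuous (fun y => l (F y)).
  by move=> y; apply: continuous_comp; [exact: cF|exact: cl].
pose h w := expR (om * Y w) * l (F (expR (- Y w))).
have mh : measurable_fun setT h.
  apply: measurable_funM => //.
  apply: (@measurableT_comp _ _ _ _ _ _ (fun y => l (F y))).
    exact: continuous_measurable_fun.
  by apply: measurableT_comp => //; apply: measurableT_comp.
have y01 w : 0 <= expR (- Y w) <= 1.
  by rewrite expR_ge0/= -expR0 ler_expR oppr_le0.
have key e : 0 < e -> P.-integrable setT (EFin \o h) /\
    `|l (bernstein_limit om phi F) - \int[P]_w h w| <= e * (2 * `|C| * phi om).
  move=> e0; have [N _ /(_ N (leqnn N)) hN] := bernstein_error cF e0.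
  (* p approximates y |-> l (F y), and its functional is exactly l of the Bernstein sum. The two
     remaining errors are at most |C| * e * phi om each. *)
  pose p := \sum_(j < N.+1) l (F (j%:R / N%:R)) *: bernstein N j.
  have pE y : p.[y] = \sum_(j < N.+1) (bernstein N j).[y] * l (F (j%:R / N%:R)).
    by rewrite horner_sum; apply: eq_bigr => j _; rewrite hornerZ mulrC.
  have hp y : 0 <= y <= 1 -> `|p.[y] - l (F y)| <= `|C| * e.
    move=> y01'; have -> : l (F y) = \sum_(j < N.+1) (bernstein N j).[y] * l (F y).
      by rewrite -mulr_suml -horner_sum bernstein_sum hornerC mul1r.
    rewrite pE -sumrB; apply: le_trans (ler_norm_sum _ _ _) _.
    apply: (@le_trans _ _ (`|C| * \sum_(j < N.+1) (bernstein N j).[y] * `|F (j%:R / N%:R) - F y|)).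
      rewrite mulr_sumr; apply: ler_sum => j _.
      rewrite -mulrBr -lB normrM ger0_norm ?bernstein_ge0// mulrCA.
      by rewrite ler_wpM2l ?bernstein_ge0// (le_trans (lb _))// ler_wpM2r// ler_norm.
    by rewrite ler_wpM2l// hN.
  have lI : l (bernstein_integral om phi N F) = exp_functional om phi p.
    rewrite lsum exp_functional_sum; apply: eq_bigr => j _.
    by rewrite lZ exp_functionalZ mulrC.
  have [ip pI] := exp_functionalE p.
  pose q w := expR (om * Y w) * p.[expR (- Y w)].
  have mq : measurable_fun setT q.
    by apply/measurable_EFinP; exact: measurable_int ip.
  have hq w : `|h w - q w| <= `|C| * e * expR (om * Y w).
    rewrite -mulrBr normrM ger0_norm ?expR_ge0// mulrC ler_wpM2r ?expR_ge0//.
    by rewrite distrC hp.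
  have [ihq hqI] := mgf_dominated (measurable_funB mh mq) hq.
  have ih : P.-integrable setT (EFin \o h).
    rewrite (_ : EFin \o h = fun w => ((h w - q w)%:E + (q w)%:E)%E); last first.
      by apply/funext => w; rewrite -EFinD subrK.
    exact: integrableD.
  split=> //.
  rewrite -(subrKA (l (bernstein_integral om phi N F))).
  apply: le_trans (ler_normD _ _) _.
  rewrite [leRHS](_ : _ = `|C| * (e * phi om) + `|C| * e * phi om); last by ring.
  apply: lerD.
    rewrite -lB; apply: le_trans (lb _) _.
    apply: (@le_trans _ _ (`|C| * `|bernstein_limit om phi F - bernstein_integral om phi N F|)).
      by rewrite ler_wpM2r// ler_norm.
    by rewrite ler_wpM2l// bernstein_limit_dist.
  rewrite distrC lI -pI -RintegralB//.
have [ih _] := key _ ltr01; split => //.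
apply/eqP; rewrite -subr_eq0 -normr_le0; apply/ler_addgt0Pr => e e0; rewrite add0r.
have phi0 : 0 <= phi om.
  by rewrite -exp_functional1; apply: ev0 => y _; rewrite hornerC.
have K0 : 0 <= 2 * `|C| * phi om by rewrite !mulr_ge0.
have e'0 : 0 < e / (2 * `|C| * phi om + 1) by rewrite divr_gt0// ltr_wpDl.
have [_ h1] := key _ e'0; apply: le_trans h1 _.
by rewrite mulrAC ler_pdivrMr ?ltr_wpDl// ler_wpM2l ?(ltW e0)// lerDl.
Qed.

End exp_functional_expectation.

Lemma weierstrass_approximation {R : realType} (f : R -> R) (e : R) :
  continuous f -> 0 < e ->
  exists p : {poly R}, forall y, 0 <= y <= 1 -> `|p.[y] - f y| <= e.
Proof.
move=> cf e0; have [N _ /(_ N (leqnn N)) hN] := @bernstein_error R R^o f e cf e0.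
exists (\sum_(j < N.+1) f (j%:R / N%:R) *: bernstein N j) => y y01.
have -> : f y = \sum_(j < N.+1) (bernstein N j).[y] * f y.
  by rewrite -mulr_suml -horner_sum bernstein_sum hornerC mul1r.
rewrite horner_sum -sumrB; apply: le_trans (ler_norm_sum _ _ _) _.
apply: le_trans (hN y y01); apply: ler_sum => j _.
by rewrite hornerZ mulrC -mulrBr normrM ger0_norm ?bernstein_ge0.
Qed.

(** * Strongly continuous semigroups: exponential growth bound *)

Section semigroup.
Context {R : realType} {X : completeNormedModType R}.
Variable T : R -> X -> X.
Hypothesis hT : C0_semigroup T.
Implicit Types (a b h : R) (u v : X).

Lemma semigroupZD a (c : R) u v : 0 <= a -> T a (c *: u + v) = c *: T a u + T a v.
Proof. by move=> a0; rewrite (semigroup_linear hT a0). Qed.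

Lemma semigroup_at0 a : 0 <= a -> T a 0 = 0.
Proof.
move=> a0; have := semigroupZD (-1) 0 0 a0.
by rewrite scaler0 addr0 scaleN1r addNr.
Qed.

Lemma semigroupZ a (c : R) u : 0 <= a -> T a (c *: u) = c *: T a u.
Proof. by move=> a0; rewrite -[c *: u]addr0 semigroupZD// semigroup_at0// addr0. Qed.

Lemma semigroupB a u v : 0 <= a -> T a (u - v) = T a u - T a v.
Proof.
by move=> a0; rewrite -scaleN1r addrC semigroupZD// scaleN1r addrC.
Qed.

Let semigroup_bounded_fun a : 0 <= a ->
  forall r, exists M, forall u, `|u| <= r -> `|T a u| <= M.
Proof.
move=> a0.
pose f : {linear X -> X} :=
  HB.pack (T a) (GRing.isLinear.Build _ _ _ _ _ (semigroup_linear hT a0)).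
apply/(bounded_funP f)/linear_bounded_continuous.
exact: (semigroup_bounded hT a0).
Qed.

(** Otherwise there are times a_n <= 1 / (n + 1) whose operators have norm above n + 1. Strong
    continuity at 0 makes this family pointwise bounded, contradicting the uniform boundedness
    principle. *)
Let semigroup_bounded_near0 : exists d K : R, [/\ 0 < d, 1 <= K &
  forall a u, 0 <= a <= d -> `|T a u| <= K * `|u|].
Proof.
apply: contrapT => noK.
have bad n : exists au : R * X, 0 <= au.1 <= n.+1%:R^-1 /\ n.+1%:R * `|au.2| < `|T au.1 au.2|.
  apply: contrapT => H; apply: noK; exists n.+1%:R^-1, n.+1%:R; split.
  - by rewrite invr_gt0.
  - by rewrite ler1n.
  - move=> a u ad; rewrite leNgt; apply/negP => lt; apply: H.
    by exists (a, u).
have [f hf] := choice bad.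
pose F : set (X -> X) := [set T (f n).1 | n in [set: nat]].
have a0 n : 0 <= (f n).1 by have [/andP[]] := hf n.
have F1 g : F g -> bounded_fun_norm g /\ linear g.
  move=> [n _ <-]; split; first exact: semigroup_bounded_fun.
  exact: (semigroup_linear hT).
have F2 : pointwise_bounded F.
  move=> u.
  have /cvgrPdist_le /(_ _ ltr01) := semigroup_cvg0 hT (u := u).
  rewrite near_withinE => /nbhs_ballP [r /= r0 hr].
  have [m hm] : exists m : nat, m.+1%:R^-1 < r.
    exists (Num.truncn r^-1); rewrite invf_plt ?posrE//.
    by have := truncn_itv (ltW _ : 0 <= r^-1); rewrite invr_gt0 => /(_ r0) /andP[].
  have M0 n : 0 <= `|T (f n).1 u| by [].
  (* From index m on, the times are so small that T a u is within 1 of u; the finitely many other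
     norms are simply added. *)
  exists (`|u| + 1 + \sum_(i < m) `|T (f i).1 u|) => _ [n _ <-].
  have [nm|mn] := ltnP n m.
    by rewrite (bigD1 (Ordinal nm))//= addrCA lerDl !addr_ge0// sumr_ge0.
  apply: (@le_trans _ _ (`|u| + 1)); last by rewrite lerDl sumr_ge0.
  have [/andP[_ fn] _] := hf n.
  have := a0 n; rewrite le_eqVlt => /orP[/eqP <-|fn0].
    by rewrite (semigroup0 hT) lerDl.
  have := hr (f n).1; rewrite /ball/= sub0r normrN (ger0_norm (a0 n)) => h.
  have {}h : `|u - T (f n).1 u| <= 1.
    apply: h fn0; apply: le_lt_trans fn (le_lt_trans _ hm).
    by rewrite lef_pV2 ?posrE// ler_nat.
  rewrite -[T _ _](subKr u); apply: le_trans (ler_normB _ _) _.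
  by rewrite lerD2l.
have [M hM] := Banach_Steinhauss F1 F2 1.
have [n nM] : exists n : nat, M <= n.+1%:R.
  exists (Num.truncn M); have [M0|M0] := leP 0 M.
    by have /andP[_ /ltW] := truncn_itv M0.
  by apply: le_trans (ltW M0) _.
have [_ lt] := hf n.
have u0 : 0 < `|(f n).2|.
  rewrite normr_gt0; apply/negP => /eqP E; move: lt.
  by rewrite E semigroup_at0// !normr0 mulr0 ltxx.
have := hM (T (f n).1) (ex_intro2 _ _ n I erefl) (`|(f n).2|^-1 *: (f n).2).
rewrite normrZ ger0_norm ?invr_ge0 ?(ltW u0)// mulVf ?gt_eqF// lexx => /(_ isT).
rewrite semigroupZ// normrZ ger0_norm ?invr_ge0 ?(ltW u0)// leNgt => /negP; apply.
apply: le_lt_trans nM _.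
by rewrite mulrC ltr_pdivlMr.
Qed.

Lemma semigroup_growth : exists M w : R, [/\ 0 <= M, 0 <= w &
  forall a u, 0 <= a -> `|T a u| <= M * expR (w * a) * `|u|].
Proof.
have [d [K [d0 K1 hK]]] := semigroup_bounded_near0.
have K0 : 0 < K by exact: lt_le_trans K1.
(* K bounds T on [0, d]; a time a is covered by at most a / d + 1 steps of length d, and K^(a / d) =
   expR (w * a) for w = ln K / d. *)
exists K, (ln K / d); split; rewrite ?(ltW K0)//.
  by rewrite divr_ge0 ?ln_ge0 ?(ltW d0).
have it n a u : 0 <= a <= n.+1%:R * d -> `|T a u| <= K ^+ n.+1 * `|u|.
  elim: n a u => [|n IH] a u /andP[a0 an].
    by rewrite expr1 hK// a0 -[d]mul1r.
  have [ad|da] := leP a d.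
    apply: le_trans (hK _ _ _) _; first by rewrite a0.
    by rewrite ler_wpM2r// -[leLHS]expr1 ler_weXn2l.
  rewrite -(subrKC d a) (semigroupD hT) ?(ltW d0) ?subr_ge0 ?(ltW da)//.
  apply: le_trans (hK _ _ _) _; first by rewrite lexx ltW.
  rewrite exprS -mulrA ler_wpM2l ?(ltW K0)// IH// subr_ge0 ltW//=.
  by move: an; rewrite -(natr1 n.+1) mulrDl mul1r; lra.
move=> a u a0; have ad0 : 0 <= a / d by rewrite divr_ge0// ltW.
have /andP[t1 t2] := truncn_itv ad0.
apply: le_trans (it (Num.truncn (a / d)) _ _ _) _.
  by rewrite a0/= -ler_pdivrMr// ltW.
rewrite ler_wpM2r// exprS ler_wpM2l ?(ltW K0)//.
rewrite -[X in X ^+ _](lnK (x := K)) ?posrE// -expRM_natl ler_expR.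
by rewrite mulrAC -mulrA mulrC ler_wpM2l// ln_ge0.
Qed.

End semigroup.

(** * Damped orbits and the subordinate operator *)

Section orbit.
Context {R : realType} {X : completeNormedModType R}.
Variable T : R -> X -> X.
Hypothesis hT : C0_semigroup T.
Implicit Types (a b h om : R) (u v : X).

(** Factoring out T at the smaller time reduces continuity at any time, from either side, to right
    continuity at 0. *)
Lemma semigroup_diff M w a b u : 0 <= M -> 0 <= w ->
  (forall a u, 0 <= a -> `|T a u| <= M * expR (w * a) * `|u|) ->
  0 <= a -> 0 <= b ->
  `|T a u - T b u| <= M * expR (w * Num.min a b) * `|T `|a - b| u - u|.
Proof.
move=> M0 w0 hM; wlog ab : a b / a <= b.
  move=> H a0 b0; have /orP[ab|ba] := le_total a b; first exact: H.
  by rewrite distrC [in leRHS]minC (distrC a b) H.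
move=> a0 b0; rewrite min_l// ler0_norm ?subr_le0// opprB distrC.
have -> : T b u = T a (T (b - a) u).
  by rewrite -(semigroupD hT) ?subr_ge0// subrKC.
by rewrite -semigroupB// hM.
Qed.

Lemma continuous_orbit u : continuous (fun a => T (Num.max 0 a) u).
Proof.
have [M [w [M0 w0 hM]]] := semigroup_growth hT.
move=> a; apply/cvgrPdist_le => e e0.
pose K := M * expR (w * Num.max 0 a) + 1.
have K0 : 0 < K by rewrite ltr_wpDl// mulr_ge0// expR_ge0.
have eK : 0 < e / K by rewrite divr_gt0.
have /cvgrPdist_le /(_ _ eK) := semigroup_cvg0 hT (u := u).
rewrite near_withinE => /nbhs_ballP [r /= r0 hr].
apply/nbhs_ballP; exists r => //= b; rewrite /ball/= => ab.
set a' := Num.max 0 a; set b' := Num.max 0 b.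
have a'0 : 0 <= a' by rewrite le_max lexx.
have b'0 : 0 <= b' by rewrite le_max lexx.
have ab' : `|a' - b'| < r.
  apply: le_lt_trans ab.
  have := ler_norm (a - b); have := ler_norm (- (a - b)); rewrite normrN.
  rewrite /a' /b' !maxEle; case: ifP; case: ifP => *; rewrite ler_norml; lra.
apply: le_trans (semigroup_diff u M0 w0 hM a'0 b'0) _.
have h1 : `|T `|a' - b'| u - u| <= e / K.
  have [->|ne] := eqVneq `|a' - b'| 0; first by rewrite (semigroup0 hT) subrr normr0 ltW.
  rewrite distrC; apply: hr; last by rewrite lt0r ne/=.
  by rewrite /ball/= sub0r normrN normr_id.
apply: (@le_trans _ _ (K * (e / K))); last by rewrite mulrC divfK// gt_eqF.
apply: ler_pM => //; first by rewrite mulr_ge0// expR_ge0.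
rewrite /K (le_trans (y := M * expR (w * a')))// ?lerDl//.
by rewrite ler_wpM2l// ler_expR ler_wpM2l// ge_min lexx.
Qed.

(* The orbit through [u] in the variable [y = expR (- a)], damped by
   [expR (- om * a)] so that it extends continuously by 0 to [y = 0]. *)
Definition damped_orbit om u (y : R) : X :=
  if 0 < y then expR (om * ln y) *: T (Num.max 0 (- ln y)) u else 0.

Lemma damped_orbitE om u a : 0 <= a ->
  expR (om * a) *: damped_orbit om u (expR (- a)) = T a u.
Proof.
move=> a0; rewrite /damped_orbit expR_gt0 expRK opprK max_r//.
by rewrite scalerA -expRD mulrN subrr expR0 scale1r.
Qed.

Lemma damped_orbitZD om c u v y :
  damped_orbit om (c *: u + v) y = c *: damped_orbit om u y + damped_orbit om v y.
Proof.
rewrite /damped_orbit; case: ifP => _; last by rewrite scaler0 addr0.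
by rewrite semigroupZD ?le_max ?lexx// scalerDr !scalerA mulrC.
Qed.

Lemma damped_orbit_comm om h u y : 0 <= h ->
  T h (damped_orbit om u y) = damped_orbit om (T h u) y.
Proof.
move=> h0; rewrite /damped_orbit; case: ifP => _; last by rewrite semigroup_at0.
have m0 : 0 <= Num.max 0 (- ln y) by rewrite le_max lexx.
by rewrite semigroupZ// -!(semigroupD hT)// addrC.
Qed.

Section growth.
Variables (M w om : R).
Hypotheses (M0 : 0 <= M) (w0 : 0 <= w) (wom : w < om).
Hypothesis hM : forall a u, 0 <= a -> `|T a u| <= M * expR (w * a) * `|u|.

(** For y > 0 the damping leaves the factor y^(om - w), which tends to 0 with y since om > w. This
    gives continuity at 0; the second bound gives the norm of the subordinate operator. *)
Lemma damped_orbit_norm u y : 0 <= y <= 1 ->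
  `|damped_orbit om u y| <= M * `|u| * expR ((om - w) * ln y) /\
  `|damped_orbit om u y| <= M * `|u|.
Proof.
move=> /andP[y0 y1]; rewrite /damped_orbit; case: ifPn => [yp|_]; last first.
  by rewrite normr0 !mulr_ge0// expR_ge0.
have ly : ln y <= 0 by rewrite ln_le0.
have h : `|expR (om * ln y) *: T (Num.max 0 (- ln y)) u| <= M * `|u| * expR ((om - w) * ln y).
  rewrite max_r ?oppr_ge0// normrZ (ger0_norm (expR_ge0 _)).
  apply: (@le_trans _ _ (expR (om * ln y) * (M * expR (w * - ln y) * `|u|))).
    by rewrite ler_wpM2l ?expR_ge0// hM// oppr_ge0.
  rewrite mulrBl mulrN expRD.
  by rewrite le_eqVlt; apply/orP; left; apply/eqP; rewrite -mulrN; ring.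
split=> //; apply: le_trans h _; rewrite ler_piMr ?mulr_ge0//.
by rewrite -expR0 ler_expR mulr_ge0_le0// subr_ge0 ltW.
Qed.

Lemma continuous_damped_orbit u : continuous (damped_orbit om u).
Proof.
move=> y; have [y0|y0|->] := ltgtP y 0.
- have y0' : damped_orbit om u y = 0 by rewrite /damped_orbit ltNge (ltW y0).
  rewrite /continuous_at y0'; apply: cvg_near_cst.
  near=> z; rewrite /damped_orbit ltNge ltW//; near: z.
  exact: lt_nbhsl.
- have c1 : {for y, continuous (fun z => expR (om * ln z))}.
    apply: (@continuous_comp _ _ _ (fun z => om * ln z) expR); last exact: continuous_expR.
    apply: (@continuous_comp _ _ _ (@ln R) ( *%R om)); first exact: continuous_ln.
    exact: mulrl_continuous.
  have c2 : {for y, continuous (fun z => T (Num.max 0 (- ln z)) u)}.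
    apply: (@continuous_comp _ _ _ (fun z => - ln z) (fun a => T (Num.max 0 a) u)).
      apply: (@continuous_comp _ _ _ (@ln R) -%R); first exact: continuous_ln.
      exact: opp_continuous.
    exact: continuous_orbit.
  apply: (@cvg_trans _ ((fun z => expR (om * ln z) *: T (Num.max 0 (- ln z)) u) @ y)).
    apply: near_eq_cvg; near=> z; rewrite /damped_orbit ifT//; near: z.
    exact: lt_nbhsr.
  by rewrite [damped_orbit om u y]/damped_orbit y0; exact: cvgZ c1 c2.
- apply/cvgrPdist_le => e e0; rewrite [damped_orbit om u 0]/damped_orbit ltxx.
  have s0 : 0 < om - w by rewrite subr_gt0.
  have C0 : 0 < M * `|u| + 1 by rewrite ltr_wpDl ?mulr_ge0.
  have L0 : 0 < e / (M * `|u| + 1) by rewrite divr_gt0.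
  (* For 0 < z < r the factor z^(om - w) is at most e / (M * |u| + 1). *)
  pose r := Num.min 1 (expR (ln (e / (M * `|u| + 1)) / (om - w))).
  have r0 : 0 < r by rewrite lt_min ltr01 expR_gt0.
  apply/nbhs_ballP; exists r => //= z; rewrite /ball/= sub0r normrN => zr.
  rewrite sub0r normrN.
  have [z0|z0] := leP z 0; first by rewrite /damped_orbit ltNge z0/= normr0 ltW.
  move: zr; rewrite gtr0_norm// lt_min => /andP[z1 zr].
  have [|h _] := @damped_orbit_norm u z; first by rewrite !ltW.
  apply: le_trans h _.
  apply: (@le_trans _ _ ((M * `|u| + 1) * (e / (M * `|u| + 1)))); last first.
    by rewrite mulrC divfK// gt_eqF.
  apply: ler_pM; rewrite ?mulr_ge0 ?expR_ge0 ?lerDl//.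
  rewrite -[leRHS]lnK ?posrE// ler_expR mulrC -ler_pdivlMr//.
  by rewrite -ler_expR lnK ?posrE// ltW.
Unshelve. all: by end_near. Qed.

Section subordination.
Variable phi : R -> R.
Hypothesis phi_ge0 : positive_functional om phi.

Definition subordinate u : X := bernstein_limit om phi (damped_orbit om u).

Let cvgB u : bernstein_integral om phi N (damped_orbit om u) @[N --> \oo]
  --> subordinate u.
Proof. by apply: bernstein_integral_cvg => //; exact: continuous_damped_orbit. Qed.

Let bernstein_integralZD c u v N :
  bernstein_integral om phi N (damped_orbit om (c *: u + v)) =
  c *: bernstein_integral om phi N (damped_orbit om u) +
  bernstein_integral om phi N (damped_orbit om v).
Proof.
rewrite scaler_sumr -big_split/=; apply: eq_bigr => j _.
by rewrite damped_orbitZD scalerDr !scalerA mulrC.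
Qed.

Lemma subordinateZD c u v :
  subordinate (c *: u + v) = c *: subordinate u + subordinate v.
Proof.
apply: (@cvg_lim X); first exact: norm_hausdorff.
rewrite (funext (bernstein_integralZD c u v)).
by apply: cvgD; [apply: cvgZ; [exact: cvg_cst|exact: cvgB]|exact: cvgB].
Qed.

Lemma subordinate_norm u : `|subordinate u| <= M * phi om * `|u|.
Proof.
apply: (@cvgr_to_le _ \oo _ _
  (fun N => `|bernstein_integral om phi N (damped_orbit om u)|)).
  by apply: cvg_norm.
apply: nearW => N; apply: le_trans (ler_norm_sum _ _ _) _.
rewrite -(bernstein_functional_sum om phi N) mulrAC mulr_sumr.
apply: ler_sum => j _; rewrite normrZ ger0_norm; last exact: bernstein_functional_ge0.
rewrite mulrC ler_wpM2r//; first exact: bernstein_functional_ge0.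
have jN : 0 <= (j%:R : R) / N%:R <= 1.
  (* For N = 0 the only node is 0 / 0, which has the value 0. *)
  rewrite divr_ge0//=; have [->|N0] := eqVneq (N%:R : R) 0; first by rewrite invr0 mulr0.
  have N1 : 0 < N%:R :> R by rewrite lt0r N0 ler0n.
  by rewrite ler_pdivrMr// mul1r ler_nat -ltnS.
by have [] := damped_orbit_norm u jN.
Qed.

Lemma subordinate_comm h u : 0 <= h -> T h (subordinate u) = subordinate (T h u).
Proof.
move=> h0; apply/esym/(@cvg_lim X); first exact: norm_hausdorff.
have -> : (fun N => bernstein_integral om phi N (damped_orbit om (T h u))) =
    T h \o (fun N => bernstein_integral om phi N (damped_orbit om u)).
  apply/funext => N; rewrite /= /bernstein_integral.
  have TD v v' : T h (v + v') = T h v + T h v'.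
    by rewrite -[v in LHS]scale1r semigroupZD// scale1r.
  rewrite (big_morph (T h) TD (semigroup_at0 hT h0)); apply: eq_bigr => j _.
  by rewrite semigroupZ// damped_orbit_comm.
by apply: continuous_cvg => //; exact: (semigroup_bounded hT h0).
Qed.

Lemma subordinate_generator u v :
  generator T (u, v) -> generator T (subordinate u, subordinate v).
Proof.
rewrite /generator/= => uv; apply/cvgrPdist_le => e e0.
have phi0 : 0 <= phi om.
  by rewrite -(exp_functional1 om phi); apply: phi_ge0 => y _; rewrite hornerC.
have K0 : 0 < M * phi om + 1 by rewrite ltr_wpDl// mulr_ge0.
have eK : 0 < e / (M * phi om + 1) by rewrite divr_gt0.
move/cvgrPdist_le : uv => /(_ _ eK) uv.
near=> h; have h0 : 0 < h by near: h; exact: nbhs_right_gt.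
have -> : subordinate v - h^-1 *: (T h (subordinate u) - subordinate u) =
    subordinate (v - h^-1 *: (T h u - u)).
  rewrite (subordinate_comm _ (ltW h0)).
  have jB w1 w2 : subordinate (w1 - w2) = subordinate w1 - subordinate w2.
    by rewrite addrC -scaleN1r subordinateZD scaleN1r addrC.
  have jZ c w1 : subordinate (c *: w1) = c *: subordinate w1.
    have j0 : subordinate 0 = 0 by have := jB 0 0; rewrite subr0 subrr.
    by rewrite -[c *: w1]addr0 subordinateZD j0 addr0.
  by rewrite jB jZ jB.
apply: le_trans (subordinate_norm _) _.
apply: (@le_trans _ _ ((M * phi om + 1) * (e / (M * phi om + 1)))); last first.
  by rewrite mulrC divfK// gt_eqF.
apply: ler_pM; rewrite ?mulr_ge0 ?lerDl//.
by near: h.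
Unshelve. all: by end_near. Qed.

End subordination.
End growth.
End orbit.

(** * The Volterra identity for functions of the random times *)

Section volterra_identity.
Context {R : realType}.
Local Notation leb := (@lebesgue_measure R).
Implicit Types (a b e om t s : R).

(** For both signs sg, the function e / om * expR (om * b) - sg * D b has a nonnegative
    derivative. *)
Lemma exp_mean_value (D d : R -> R) (e om a : R) : 0 < om -> 0 <= e -> continuous D ->
  (forall b, 0 < b -> is_derive b 1 D (d b)) ->
  (forall b, 0 < b -> `|d b| <= e * expR (om * b)) -> 0 <= a ->
  `|D a - D 0| <= e / om * expR (om * a).
Proof.
move=> om0 e0 cD dD hd a0.
have eo : 0 <= e / om by rewrite divr_ge0// ltW.
have key (sg : R) : `|sg| = 1 -> sg * (D a - D 0) <= e / om * expR (om * a).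
  move=> sg1; pose H b := (e / om) * expR (om * b) - sg * D b.
  have dH b : 0 < b -> is_derive b 1 H (e * expR (om * b) - sg * d b).
    move=> b0; have dDb := dD b b0; have dE := is_derive_expRM om b.
    have h1 := is_deriveZ (e / om) dE; have h2 := is_deriveZ sg dDb.
    have := is_deriveB h1 h2; rewrite /GRing.scale/=.
    by rewrite mulrA divfK ?gt_eqF.
  have cH : continuous H.
    move=> b; apply: cvgB.
      by apply: cvgM; [exact: cvg_cst|exact: continuous_expRM].
    by apply: cvgM; [exact: cvg_cst|exact: cD].
  have HE b : H b = (e / om) * expR (om * b) - sg * D b by [].
  clearbody H; have : H 0 <= H a.
    apply: (@ger0_derive1_ndecr _ H 0 a) => //.
    - move=> b; rewrite in_itv/= => /andP[b0 _].
      exact: (@ex_derive _ _ _ _ _ _ _ (dH b b0)).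
    - move=> b; rewrite in_itv/= => /andP[b0 _]; rewrite derive1E.
      rewrite (@derive_val _ _ _ _ _ _ _ (dH b b0)) subr_ge0.
      apply: le_trans (ler_norm _) _.
      by rewrite normrM sg1 mul1r hd.
    - exact: continuous_subspaceT.
  rewrite !HE mulr0 expR0 mulr1 mulrBr => h.
  have : 0 <= e / om by []. move: h; set x := e / om; lra.
have := key 1; rewrite normr1 mul1r => /(_ erefl) k1.
have := key (-1); rewrite normrN1 mulN1r => /(_ erefl) k2.
by rewrite ler_norml k1 andbT lerNl.
Qed.

Lemma is_derive_exp_sum n (c l : nat -> R) (a : R) :
  is_derive a 1 (fun b => \sum_(i < n) c i * expR (l i * b))
    (\sum_(i < n) c i * (l i * expR (l i * a))).
Proof.
elim: n => [|n IH].
  rewrite big_ord0 (_ : (fun _ => _) = cst 0); first exact: is_derive_cst.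
  by apply/funext => b; rewrite big_ord0.
rewrite big_ord_recr/= (_ : (fun _ => _) =
  (fun b => \sum_(i < n) c i * expR (l i * b)) \+ (c n \*: (fun b => expR (l n * b)))).
  exact: is_deriveD IH (is_deriveZ (c n) (is_derive_expRM (l n) a)).
by apply/funext => b; rewrite big_ord_recr.
Qed.

Context {d : measure_display} {Omega : measurableType d}.
Variables (P : probability Omega R) (k : R -> R -> R).
Hypothesis hk : admissible_kernel k.

Lemma measurable_exp_functional om (p : {poly R}) t : 0 < t ->
  measurable_fun (`]0, t[ : set R) (fun s => exp_functional om (kernel_series k s) p).
Proof.
move=> t0; apply: measurable_sum => i; apply: measurable_funM => //.
exact: measurable_kernel_series.
Qed.

Variable A : R -> Omega -> R.
Hypothesis hA : forall s, 0 <= s -> has_mgf P (A s) (kernel_series k s).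

(** The approximation is made on the derivative: g is replaced by expR (om * a) * p.[expR (- a)],
    which has a sum of exponentials as antiderivative because no om - i vanishes. All errors are
    multiples of E expR (om * A(s)), which is bounded for s in [0, t]. *)
Lemma volterra_identity (om t : R) (f g G m : R -> R) : 0 < t -> 0 < om ->
  (forall i : nat, om - i%:R != 0) ->
  continuous f -> (forall a, 0 <= a -> g a = expR (om * a) * f (expR (- a))) ->
  continuous G -> (forall a, 0 < a -> is_derive a 1 G (g a)) ->
  (forall s, 0 < s < t -> m s = \int[P]_w g (A s w)) ->
  \int[P]_w G (A t w) - G 0 = \int[leb]_(s in `]0, t[) (k t s * m s).
Proof.
move=> t0 om0 omi cf gE cG dG mE.
have [B B0 hB] := kernel_series_le om hk t0.
have [mA A0 hmgf] := hA (ltW t0).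
(* For the approximant the identity is exact. The first bound is thus the error of replacing G by
   the new antiderivative, the second that of replacing m. *)
have approx e : 0 < e -> exists p : {poly R},
    [/\ `|\int[P]_w G (A t w) - G 0 - \int[leb]_(s in `]0, t[)
            (k t s * exp_functional om (kernel_series k s) p)| <= e / om * B &
        forall s, 0 < s < t ->
          `|m s - exp_functional om (kernel_series k s) p| <= e * B].
  move=> e0; have [p hp] := weierstrass_approximation cf e0; exists p.
  have hgp a : 0 <= a ->
      `|g a - expR (om * a) * p.[expR (- a)]| <= e * expR (om * a).
    move=> a0; rewrite gE// -mulrBr normrM ger0_norm ?expR_ge0// mulrC distrC.
    by rewrite ler_wpM2r ?expR_ge0// hp// expR_ge0/= -expR0 ler_expR oppr_le0.
  have ev_int s (s0 : 0 <= s) := exp_functionalE om (hA s0).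
  have gm s : 0 <= s -> measurable_fun setT (fun w => g (A s w)).
    move=> s0; have [mAs As0 _] := hA s0.
    have -> : (fun w => g (A s w)) = fun w => expR (om * A s w) * f (expR (- A s w)).
      by apply/funext => w; rewrite gE.
    apply: measurable_funM.
      by apply: measurableT_comp => //; exact: measurable_funM.
    apply: (@measurableT_comp _ _ _ _ _ _ f); first exact: continuous_measurable_fun.
    by apply: measurableT_comp => //; exact: measurableT_comp.
  split.
    (* The division by om - i integrates the exponentials. *)
    pose c i := p`_i / (om - i%:R); pose l (i : nat) := om - i%:R.
    pose Gp a := \sum_(i < size p) c i * expR (l i * a).
    have cl i : c i * l i = p`_i by rewrite /c divfK.
    have dGp a : is_derive a 1 Gp (expR (om * a) * p.[expR (- a)]).
      have -> : expR (om * a) * p.[expR (- a)] =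
          \sum_(i < size p) c i * (l i * expR (l i * a)).
        rewrite horner_coef mulr_sumr; apply: eq_bigr => i _.
        by rewrite [RHS]mulrA cl mulrCA -expRM_natl -expRD /l mulrBl mulrN.
      exact: is_derive_exp_sum.
    have cGp : continuous Gp.
      move=> a; apply/differentiable_continuous/derivable1_diffP.
      exact: (@ex_derive _ _ _ _ _ _ _ (dGp a)).
    have hD a : 0 <= a -> `|(G a - Gp a) - (G 0 - Gp 0)| <= e / om * expR (om * a).
      move=> a0; apply: (@exp_mean_value (fun a => G a - Gp a)
        (fun a => g a - expR (om * a) * p.[expR (- a)])) => //; first exact: ltW.
      - by move=> b; apply: cvgB; [exact: cG|exact: cGp].
      - by move=> b b0; have := dG b b0 => dGb; exact: is_deriveB.
      - by move=> b b0; apply: hgp; exact: ltW.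
    have iGp : P.-integrable setT (EFin \o (fun w => Gp (A t w))) /\
        \int[P]_w Gp (A t w) = \sum_(i < size p) c i * kernel_series k t (l i).
      have ii (i : 'I_(size p)) : P.-integrable setT (EFin \o (fun w => c i * expR (l i * A t w))).
        rewrite (_ : EFin \o _ = fun w =>
          ((c i)%:E * (expR (l i * A t w))%:E)%E); last exact/funext.
        by apply: integrableZl => //; exact: (mgf_integrable (hA (ltW t0))).
      have [j1 j2] := Rintegral_sum (index_enum _) measurableT ii.
      split=> //; rewrite j2; apply: eq_bigr => i _; rewrite RintegralZl//.
        by rewrite /Rintegral hmgf.
      exact: (mgf_integrable (hA (ltW t0))).
    have Gpk : \int[P]_w Gp (A t w) - Gp 0 = \int[leb]_(s in `]0, t[)
        (k t s * exp_functional om (kernel_series k s) p).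
      have ik (i : 'I_(size p)) : leb.-integrable `]0, t[
          (EFin \o (fun s => k t s * kernel_series k s (om - i%:R) * p`_i)).
        apply: lebesgue_integrableZr => //.
        have [B' _ hB'] := kernel_series_le (om - i%:R) hk t0.
        apply: (kernel_integrableM (B := B')) => //.
          exact: measurable_kernel_series.
        by move=> s /andP[s0 st]; rewrite hB'// !ltW.
      have [_ j2] := @Rintegral_sum _ _ _ leb `]0, t[%classic _ (index_enum _) _
        (measurable_itv _) ik.
      transitivity (\int[leb]_(s in `]0, t[)
          \sum_(i < size p) (k t s * kernel_series k s (om - i%:R) * p`_i)); last first.
        apply: eq_Rintegral => s _; rewrite mulr_sumr; apply: eq_bigr => i _.
        by rewrite -mulrA; congr (_ * _); exact: mulrC.
      rewrite j2 iGp.2 /Gp -sumrB; apply: eq_bigr => i _.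
      (* The exponential of exponent l_i contributes c_i (Phi(t, l_i) - 1), that is c_i l_i times an
         integral, and c_i l_i is the coefficient of p. *)
      rewrite mulr0 expR0 -mulrBr -kernel_series_integral// mulrA cl mulrC.
      rewrite RintegralZr//.
      have [B' _ hB'] := kernel_series_le (om - i%:R) hk t0.
      apply: (kernel_integrableM (B := B')) => //.
        exact: measurable_kernel_series.
      by move=> s /andP[s0 st]; rewrite hB'// !ltW.
    have mGA : measurable_fun setT (fun w => G (A t w)).
      by apply: (@measurableT_comp _ _ _ _ _ _ G) => //; exact: continuous_measurable_fun.
    have mGpA : measurable_fun setT (fun w => Gp (A t w)).
      by apply: (@measurableT_comp _ _ _ _ _ _ Gp) => //; exact: continuous_measurable_fun.
    have [iD hI] := mgf_dominated (hA (ltW t0))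
      (measurable_funB (measurable_funB mGA mGpA) (measurable_cst (G 0 - Gp 0)))
      (fun w => hD _ (A0 w)).
    have iC c' : P.-integrable setT (EFin \o (fun _ : Omega => c')).
      exact: finite_measure_integrable_cst.
    have iG : P.-integrable setT (EFin \o (fun w => G (A t w))).
      rewrite (_ : EFin \o _ = fun w => ((G (A t w) - Gp (A t w) - (G 0 - Gp 0))%:E +
        ((Gp (A t w))%:E + (G 0 - Gp 0)%:E))%E); last first.
        by apply/funext => w /=; rewrite -!EFinD; congr EFin; ring.
      by apply: integrableD => //; apply: integrableD => //; [exact: iGp.1|exact: iC].
    rewrite -Gpk.
    have -> : \int[P]_w G (A t w) - G 0 - (\int[P]_w Gp (A t w) - Gp 0) =
        \int[P]_w (G (A t w) - Gp (A t w) - (G 0 - Gp 0)).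
      rewrite RintegralB//; last first.
        rewrite (_ : EFin \o _ = fun w => ((G (A t w))%:E - (Gp (A t w))%:E)%E); last exact/funext.
        by apply: integrableB => //; exact: iGp.1.
      rewrite RintegralB//; last exact: iGp.1.
      rewrite Rintegral_cst// (_ : fine _ = 1); first ring.
      by have := congr1 fine (@probability_setT _ _ _ P).
    apply: le_trans hI _; rewrite ler_wpM2l//; first by rewrite divr_ge0// ltW.
    by apply: le_trans (ler_norm _) _; rewrite hB// lexx ltW.
  move=> s /andP[s0 st].
  have [_ evE] := ev_int s (ltW s0) p; have [ie _] := ev_int s (ltW s0) p.
  rewrite mE ?s0// -evE.
  have mq : measurable_fun setT (fun w => expR (om * A s w) * p.[expR (- A s w)]).
    by apply/measurable_EFinP; exact: measurable_int ie.
  have [_ As0 _] := hA (ltW s0).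
  have [iD hI] := mgf_dominated (hA (ltW s0)) (measurable_funB (gm s (ltW s0)) mq)
    (fun w => hgp _ (As0 w)).
  rewrite -RintegralB//; last first.
    rewrite (_ : EFin \o _ = fun w => ((g (A s w) - expR (om * A s w) * p.[expR (- A s w)])%:E +
      (expR (om * A s w) * p.[expR (- A s w)])%:E)%E); last first.
      by apply/funext => w; rewrite -EFinD subrK.
    by apply: integrableD.
  apply: le_trans hI _; rewrite ler_wpM2l ?(ltW e0)//.
  by apply: le_trans (ler_norm _) _; rewrite hB// !ltW.
have n0 (n : nat) : 0 < n.+1%:R^-1 :> R by rewrite invr_gt0.
have [pn hpn] := choice (fun n => approx _ (n0 n)).
(* m is given only through expectations; it is measurable as the pointwise limit of the functionals
   of the approximating polynomials. *)
have mm : measurable_fun (`]0, t[ : set R) m.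
  apply: (@measurable_fun_cvg _ _ _ _
    (fun n s => exp_functional om (kernel_series k s) (pn n))).
    by move=> n; exact: measurable_exp_functional.
  move=> s /=; rewrite in_itv/= => st; apply/cvgrPdist_le => e e0.
  have : harmonic n * B @[n --> \oo] --> (0 : R).
    by rewrite -(mul0r B); apply: cvgM; [exact: cvg_harmonic|exact: cvg_cst].
  move/cvgr0Pnorm_le => /(_ _ e0); apply: filterS => n; apply: le_trans.
  by apply: le_trans ((hpn n).2 s st) _; exact: ler_norm.
have [Mf hMf] : exists Mf, forall y, 0 <= y <= 1 -> `|f y| <= Mf.
  have [c _ hc] := @EVT_max R (fun y => `|f y|) 0 1 ler01
    (continuous_subspaceT (fun y => continuous_comp (cf y) (@norm_continuous _ _ _))).
  by exists `|f c| => y y01; apply: hc; rewrite in_itv.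
have ikm : leb.-integrable `]0, t[ (EFin \o (fun s => k t s * m s)).
  have Mf0 : 0 <= Mf by apply: le_trans (hMf 0 _) => //; rewrite lexx ler01.
  apply: (kernel_integrableM (B := Mf * B)) => // s /andP[s0 st].
  rewrite mE ?s0//; have [mAs As0 _] := hA (ltW s0).
  have mg : measurable_fun setT (fun w => g (A s w)).
    have -> : (fun w => g (A s w)) = fun w => expR (om * A s w) * f (expR (- A s w)).
      by apply/funext => w; rewrite gE.
    apply: measurable_funM.
      by apply: measurableT_comp => //; exact: measurable_funM.
    apply: (@measurableT_comp _ _ _ _ _ _ f); first exact: continuous_measurable_fun.
    by apply: measurableT_comp => //; exact: measurableT_comp.
  have gb w : `|g (A s w)| <= Mf * expR (om * A s w).
    rewrite gE// normrM ger0_norm ?expR_ge0// mulrC ler_wpM2r ?expR_ge0//.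
    by rewrite hMf// expR_ge0/= -expR0 ler_expR oppr_le0.
  have [_ h1] := mgf_dominated (hA (ltW s0)) mg gb.
  apply: le_trans h1 _; rewrite ler_wpM2l//.
  by apply: le_trans (ler_norm _) _; rewrite hB// !ltW.
set K := \int[leb]_(s in `]0, t[) `|k t s|.
have K0 : 0 <= K by exact: Rintegral_ge0.
apply/eqP; rewrite -subr_eq0 -normr_le0; apply/ler_addgt0Pr => e e0; rewrite add0r.
(* Collects the error e' * B / om from G and the error e' * B * K from m. *)
pose C := B / om + B * K; have C0 : 0 <= C by rewrite addr_ge0 ?mulr_ge0 ?invr_ge0 ?(ltW om0).
have e'0 : 0 < e / (C + 1) by rewrite divr_gt0// ltr_wpDl.
have [p [h1 h2]] := approx _ e'0; set e' := e / (C + 1) in e'0 h1 h2.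
have iev : leb.-integrable `]0, t[
    (EFin \o (fun s => k t s * exp_functional om (kernel_series k s) p)).
  have ii (i : 'I_(size p)) : leb.-integrable `]0, t[
      (EFin \o (fun s => k t s * kernel_series k s (om - i%:R) * p`_i)).
    apply: lebesgue_integrableZr => //.
    have [B' _ hB'] := kernel_series_le (om - i%:R) hk t0.
    apply: (kernel_integrableM (B := B')) => //.
      exact: measurable_kernel_series.
    by move=> s /andP[s0 st]; rewrite hB'// !ltW.
  have [j1 _] := @Rintegral_sum _ _ _ leb `]0, t[%classic _ (index_enum _) _ (measurable_itv _) ii.
  rewrite (_ : (fun s => k t s * exp_functional om (kernel_series k s) p) =
    fun s => \sum_(i < size p) k t s * kernel_series k s (om - i%:R) * p`_i)//.
  apply/funext => s; rewrite mulr_sumr; apply: eq_bigr => i _.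
  by rewrite -mulrA; congr (_ * _); exact: mulrC.
have h3 : `|\int[leb]_(s in `]0, t[) (k t s * exp_functional om (kernel_series k s) p) -
    \int[leb]_(s in `]0, t[) (k t s * m s)| <= e' * B * K.
  rewrite -RintegralB// mulrC /K -RintegralZr//; last first.
    exact: (integrable_norm (kernel_integrable hk t0)).
  apply: le_trans (le_normr_Rintegral _ _) _ => //.
    exact: lebesgue_integrableB.
  apply: le_Rintegral => //.
  - exact: (integrable_norm (lebesgue_integrableB _ iev ikm)).
  - apply: lebesgue_integrableZr => //.
    exact: (integrable_norm (kernel_integrable hk t0)).
  - move=> s /=; rewrite in_itv/= => st; rewrite -mulrBr normrM ler_wpM2l//.
    by rewrite distrC h2.
rewrite -(subrKA (\int[leb]_(s in `]0, t[) (k t s * exp_functional om (kernel_series k s) p))).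
apply: le_trans (ler_normD _ _) _; apply: le_trans (lerD h1 h3) _.
have -> : e' / om * B + e' * B * K = e' * C by rewrite /C; ring.
by rewrite /e' mulrAC ler_pdivrMr ?ltr_wpDl// ler_wpM2l ?(ltW e0)// lerDl.
Qed.

End volterra_identity.

(** * Simple maps and existence of the Bochner integral *)

Section simple_maps.
Context {d : measure_display} {T : measurableType d} {R : realType}.
Variables (mu : {measure set T -> \bar R}) (D : set T).
Hypotheses (mD : measurable D) (muD : (mu D < +oo)%E).

(** Values lie in a bare type and every fibre is measurable, so that pairs of simple maps are simple
    and serve as common refinements. On a set of finite measure this agrees with [bochner_simple],
    which sets the fibre of 0 apart. *)
Definition simple_map {Z : Type} (z : T -> Z) : Prop :=
  finite_set (z @` D) /\ forall c, measurable (D `&` z @^-1` [set c]).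

Lemma simple_map_comp {Z Z' : Type} (z : T -> Z) (h : Z -> Z') :
  simple_map z -> simple_map (h \o z).
Proof.
move=> [fz mz]; split; first by rewrite -image_comp; exact: finite_image.
move=> c; rewrite (_ : _ `&` _ =
  \bigcup_(e in (z @` D) `&` h @^-1` [set c]) (D `&` z @^-1` [set e])).
  by apply: fin_bigcup_measurable => //; exact: finite_setIl.
apply/seteqP; split => x.
  by move=> [Dx /= hx]; exists (z x) => //; split => //; exists x.
by move=> [e [_ /= he] [Dx /= ze]]; split => //=; rewrite ze.
Qed.

Lemma simple_map_pair {Z Z' : Type} (z : T -> Z) (z' : T -> Z') :
  simple_map z -> simple_map z' -> simple_map (fun x => (z x, z' x)).
Proof.
move=> [fz mz] [fz' mz']; split.
  apply: (@sub_finite_set _ _ ((z @` D) `*` (z' @` D))); last exact: finite_setX.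
  by move=> _ [x Dx <-]; split; exists x.
move=> [c c']; rewrite (_ : _ `&` _ =
  (D `&` z @^-1` [set c]) `&` (D `&` z' @^-1` [set c'])); first exact: measurableI.
by apply/seteqP; split => x /=; [move=> [Dx [-> ->]]|move=> [[Dx ->] [_ ->]]].
Qed.

Lemma simple_map_integral {Z : choiceType} (z : T -> Z) (h : Z -> R) : simple_map z ->
  mu.-integrable D (EFin \o (fun x => h (z x))) /\
  \int[mu]_(x in D) h (z x) =
    \sum_(c <- fset_set (z @` D)) h c * fine (mu (D `&` z @^-1` [set c])).
Proof.
move=> [fz mz]; set r := fset_set _.
have mfin c : (mu (D `&` z @^-1` [set c]) < +oo)%E.
  apply: le_lt_trans muD; apply: le_measure; rewrite ?inE//.
pose u c x : R := h c * \1_(D `&` z @^-1` [set c]) x.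
have iu1 c : mu.-integrable D (EFin \o (\1_(D `&` z @^-1` [set c]) : T -> R)).
  apply/integrableP; split; first exact/measurable_EFinP.
  under eq_integral do rewrite /= ger0_norm//.
  by rewrite integral_indic// setIAC setIid.
have iu c : mu.-integrable D (EFin \o u c).
  rewrite (_ : EFin \o u c = fun x =>
    ((h c)%:E * (\1_(D `&` z @^-1` [set c]) x)%:E)%E); last exact/funext.
  by apply: integrableZl => //; exact: iu1.
have hu x : D x -> h (z x) = \sum_(c <- r) u c x.
  move=> Dx; have zr : z x \in r by rewrite in_fset_set// inE; exists x.
  rewrite (big_fsetD1 (z x) zr)/= big1_fset ?addr0.
    by rewrite /u indicE mem_set ?mulr1.
  move=> c; rewrite in_fsetD1 => /andP[cz _] _.
  by rewrite /u indicE memNset ?mulr0//= => -[_ zc]; rewrite zc eqxx in cz.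
have [j1 j2] := Rintegral_sum (finmap.enum_fset r) mD iu.
have E : \int[mu]_(x in D) h (z x) = \int[mu]_(x in D) \sum_(c <- r) u c x.
  by apply: eq_Rintegral => x; rewrite inE => Dx; exact: hu.
split.
  by apply: eq_integrable j1 => // x; rewrite inE => Dx /=; rewrite hu.
rewrite E j2; apply: eq_bigr => c _.
rewrite RintegralZl//; congr (_ * _).
by rewrite /Rintegral integral_indic// setIAC setIid.
Qed.

Context {X : completeNormedModType R}.
Implicit Types s f : T -> X.

Lemma bochner_simple_map s : bochner_simple mu D s <-> simple_map s.
Proof.
split=> [[fs ms]|[fs ms]]; last first.
  split=> // y _; split => //.
  by apply: le_lt_trans muD; apply: le_measure; rewrite ?inE//.
split=> // c; have [->|c0] := eqVneq c 0; last by have [] := ms c c0.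
rewrite (_ : _ `&` _ =
  D `\` \bigcup_(y in (s @` D) `&` [set y | y != 0]) (D `&` s @^-1` [set y])).
  apply: measurableD => //; apply: fin_bigcup_measurable; first exact: finite_setIl.
  by move=> y [_ y0]; have [] := ms y y0.
apply/seteqP; split => x /=.
  by move=> [Dx s0]; split => // -[y [_ /= y0] [_ /= sy]]; rewrite -sy s0 eqxx in y0.
move=> [Dx nx]; split => //; apply: contrapT => /eqP s0; apply: nx.
by exists (s x) => //; split => //; exists x.
Qed.

(** The sum may be taken over the finer partition into fibres of z, since fibres with equal values
    of h merge. For z a pair of simple functions, both are thus integrated over one partition. *)
Lemma bochner_simple_integralE {Z : choiceType} (z : T -> Z) (h : Z -> X) :
  simple_map z -> bochner_simple_integral mu D (h \o z) =
  \sum_(c <- fset_set (z @` D)) fine (mu (D `&` z @^-1` [set c])) *: h c.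
Proof.
move=> hz; have hs : simple_map (h \o z) by exact: simple_map_comp.
have [fz mz] := hz; have [fs ms] := hs.
rewrite /bochner_simple_integral fsbig_finite//=.
transitivity (\sum_(y <- fset_set ((h \o z) @` D)) \sum_(c <- fset_set (z @` D))
    (((h c == y)%:R * fine (mu (D `&` z @^-1` [set c]))) *: y)).
  apply: eq_big_seq => y ys; rewrite -scaler_suml; congr (_ *: _).
  have [_ <-] := simple_map_integral (fun c => (h c == y)%:R) hz.
  have [_ ->] := simple_map_integral (fun y' => (y' == y)%:R) hs.
  rewrite (big_fsetD1 y ys)/= eqxx mul1r big1_fset ?addr0// => y'.
  by rewrite in_fsetD1 => /andP[/negPf -> _] _; rewrite mul0r.
rewrite exchange_big/=; apply: eq_big_seq => c; rewrite in_fset_set// inE => -[x Dx zx].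
have hc : h c \in fset_set ((h \o z) @` D).
  by rewrite in_fset_set// inE; exists x => //=; rewrite zx.
rewrite (big_fsetD1 (h c) hc)/= eqxx mul1r big1_fset ?addr0// => y.
by rewrite in_fsetD1 => /andP[yc _] _; rewrite eq_sym (negPf yc) mul0r scale0r.
Qed.

Lemma bochner_simple_integral_dist s s' : simple_map s -> simple_map s' ->
  `|bochner_simple_integral mu D s - bochner_simple_integral mu D s'| <=
  \int[mu]_(x in D) `|s x - s' x|.
Proof.
move=> hs hs'; have hz := simple_map_pair hs hs'.
have E1 := bochner_simple_integralE (fun c : X * X => c.1) hz.
have E2 := bochner_simple_integralE (fun c : X * X => c.2) hz.
rewrite [X in `|X - _|]E1 [X in `|_ - X|]E2 -sumrB.
apply: le_trans (ler_norm_sum _ _ _) _.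
have [_ /= ->] := simple_map_integral (fun c : X * X => `|c.1 - c.2|) hz.
apply: ler_sum => c _; rewrite -scalerBr normrZ ger0_norm ?fine_ge0//.
by rewrite mulrC.
Qed.

Lemma bochner_simple_integral_functional s (l : X -> R) :
  (forall (a : R) (u v : X), l (a *: u + v) = a * l u + l v) -> simple_map s ->
  l (bochner_simple_integral mu D s) = \int[mu]_(x in D) l (s x).
Proof.
move=> lin hs.
rewrite -[s in LHS]/(id \o s) bochner_simple_integralE//.
rewrite (big_morph l (functionalD lin) (functional0 lin)) (simple_map_integral l hs).2.
by apply: eq_bigr => c _; rewrite (functionalZ lin) mulrC.
Qed.

(** The simple integrals form a Cauchy sequence because their distances are controlled by the
    integrals of G. The compatibility with functionals is recorded because the evolution equation is
    to be read at each point x. *)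
Lemma bochner_integral_exists f (s : nat -> T -> X) (G : nat -> T -> R) :
  (forall n, simple_map (s n)) ->
  (forall x, D x -> s n x @[n --> \oo] --> f x) ->
  (forall n, mu.-integrable D (EFin \o G n)) ->
  (forall n x, D x -> `|s n x - f x| <= G n x) ->
  \int[mu]_(x in D) G n x @[n --> \oo] --> 0 ->
  exists2 I, is_bochner_integral mu D f I &
    forall (l : X -> R) (C : R),
      (forall (a : R) (u v : X), l (a *: u + v) = a * l u + l v) ->
      (forall u, `|l u| <= C * `|u|) ->
      mu.-integrable D (EFin \o (fun x => l (f x))) /\
      l I = \int[mu]_(x in D) l (f x).
Proof.
move=> hs sf iG sG G0.
(* The norm is a limit of the functions |s n - s m|, which factor through simple maps into pairs. *)
have mn n : measurable_fun D (fun x => `|s n x - f x|).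
  apply: (@measurable_fun_cvg _ _ _ _ (fun m x => `|s n x - s m x|)).
    move=> m; apply/measurable_EFinP.
    have [i1 _] := simple_map_integral (fun c : X * X => `|c.1 - c.2|)
      (simple_map_pair (hs n) (hs m)).
    exact: measurable_int i1.
  move=> x Dx; apply: cvg_norm; apply: cvgB; [exact: cvg_cst|exact: sf].
have inn n : mu.-integrable D (EFin \o (fun x => `|s n x - f x|)).
  apply: le_integrable (iG n) => //; first exact/measurable_EFinP.
  move=> x Dx /=; rewrite lee_fin normr_id; exact: le_trans (sG n x Dx) (ler_norm _).
have leG : forall n, \int[mu]_(x in D) `|s n x - f x| <= \int[mu]_(x in D) G n x.
  by move=> n; apply: le_Rintegral => // x; exact: sG.
have dist : forall n m, `|bochner_simple_integral mu D (s n) - bochner_simple_integral mu D (s m)|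
    <= \int[mu]_(x in D) G n x + \int[mu]_(x in D) G m x.
  move=> n m; apply: le_trans (bochner_simple_integral_dist (hs n) (hs m)) _.
  apply: (@le_trans _ _ (\int[mu]_(x in D) (`|s n x - f x| + `|s m x - f x|))); last first.
    by rewrite RintegralD// lerD.
  apply: le_Rintegral => //.
  - exact: (simple_map_integral (fun c : X * X => `|c.1 - c.2|)
      (simple_map_pair (hs n) (hs m))).1.
  - rewrite (_ : EFin \o _ = fun x =>
      ((`|s n x - f x|)%:E + (`|s m x - f x|)%:E)%E); last exact/funext.
    by apply: integrableD => //; exact: inn.
  - move=> x Dx; rewrite -(subrKA (f x)) (le_trans (ler_normD _ _))//.
    by rewrite lerD2l distrC.
have cI : cvgn (fun n => bochner_simple_integral mu D (s n)).
  apply/cauchy_cvgP/cauchyP => e e0.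
  have e20 : 0 < e / 2 by rewrite divr_gt0.
  move/cvgr0Pnorm_lt : (G0) => /(_ _ e20) [N _ hN].
  exists (bochner_simple_integral mu D (s N)), N => // n /= Nn.
  rewrite -ball_normE /=; apply: le_lt_trans (dist _ _) _.
  rewrite [e]splitr ltrD// (le_lt_trans (ler_norm _))//; first exact: hN (leqnn N).
  exact: hN.
exists (lim (bochner_simple_integral mu D (s n) @[n --> \oo])).
  exists s; split => //.
  - by move=> n; exact/bochner_simple_map.
  - by apply: aeW => x; exact: sf.
  - rewrite (_ : (fun n => _) = EFin \o (fun n => \int[mu]_(x in D) `|s n x - f x|)).
      apply/cvg_EFin; first exact: nearW.
      apply: (@squeeze_cvgr _ _ _ _ (cst 0) (fun n => \int[mu]_(x in D) G n x)) => //.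
        by apply: nearW => n; rewrite leG Rintegral_ge0.
      exact: cvg_cst.
    apply/funext => n /=; rewrite /Rintegral fineK//.
    by apply: integrable_fin_num => //; exact: inn.
move=> l C lin lb.
have lB := functionalB lin; have cl := functional_continuous lin lb.
have c1 : l (bochner_simple_integral mu D (s n)) @[n --> \oo] -->
    l (lim (bochner_simple_integral mu D (s n) @[n --> \oo])).
  by apply: continuous_cvg => //; exact: cl.
have mlf : measurable_fun D (fun x => l (f x)).
  apply: (@measurable_fun_cvg _ _ _ _ (fun m x => l (s m x))).
    by move=> m; apply/measurable_EFinP; exact: measurable_int (simple_map_integral l (hs m)).1.
  by move=> x Dx; apply: continuous_cvg; [exact: cl|exact: sf].
have ilB n : mu.-integrable D (EFin \o (fun x => l (s n x) - l (f x))).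
  rewrite (_ : EFin \o _ = EFin \o (fun x => l (s n x - f x))); last first.
    by apply/funext => x /=; rewrite lB.
  apply: (@le_integrable _ _ _ _ _ mD _ (fun x => (`|C|%:E * (`|s n x - f x|)%:E)%E)).
  - under [EFin \o _]funext do rewrite /= lB.
    apply/measurable_EFinP; apply: measurable_funB => //.
    by apply/measurable_EFinP; exact: measurable_int (simple_map_integral l (hs n)).1.
  - move=> x Dx /=; rewrite lee_fin; apply: le_trans (lb _) _.
    by rewrite ger0_norm ?mulr_ge0// ler_wpM2r// ler_norm.
  - by apply: integrableZl => //; exact: inn.
have ilf : mu.-integrable D (EFin \o (fun x => l (f x))).
  rewrite (_ : EFin \o _ = fun x => ((l (s 0%N x))%:E - (l (s 0%N x) - l (f x))%:E)%E).
    apply: integrableB => //; last exact: ilB.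
    exact: (simple_map_integral l (hs 0%N)).1.
  by apply/funext => x; rewrite -EFinB subKr.
have c2 : l (bochner_simple_integral mu D (s n)) @[n --> \oo] -->
    \int[mu]_(x in D) l (f x).
  apply/cvgrPdist_le => e e0.
  have : `|C| * \int[mu]_(x in D) G n x @[n --> \oo] --> 0.
    by rewrite -(mulr0 `|C|); apply: cvgM => //; exact: cvg_cst.
  move/cvgr0Pnorm_le => /(_ _ e0); apply: filterS => n; apply: le_trans.
  rewrite (bochner_simple_integral_functional lin (hs n)) distrC -RintegralB//; last first.
    exact: (simple_map_integral l (hs n)).1.
  apply: le_trans (le_normr_Rintegral mD (ilB n)) _.
  apply: le_trans (ler_norm _); rewrite -RintegralZl//.
  apply: le_Rintegral => //.
  - exact: integrable_norm (ilB n).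
  - rewrite (_ : EFin \o _ = fun x => (`|C|%:E * (G n x)%:E)%E); last exact/funext.
    by apply: integrableZl => //; exact: iG.
  - move=> x Dx; rewrite -lB; apply: le_trans (lb _) _.
    apply: (@le_trans _ _ (`|C| * `|s n x - f x|)).
      by rewrite ler_wpM2r// ler_norm.
    by rewrite ler_wpM2l// sG.
by split => //; exact: cvg_unique _ c1 c2.
Qed.

End simple_maps.

(** * Bochner integrals against the kernel *)

Section kernel_bochner.
Context {R : realType} {X : completeNormedModType R}.
Local Notation leb := (@lebesgue_measure R).
Variables (k : R -> R -> R) (t : R).
Hypotheses (hk : admissible_kernel k) (t0 : 0 < t).
Local Notation D := (`]0%R, t[%classic : set R).
Local Notation simpleD := (@simple_map _ (measurableTypeR R) D _).

Let mD : @measurable _ (measurableTypeR R) D. Proof. exact: measurable_itv. Qed.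
Let muD : (leb D < +oo)%E.
Proof. by rewrite lebesgue_measure_itv/= lte_fin t0 ltry. Qed.

(** k t is approximated in L^1 by scalar simple functions and W uniformly by simple maps; the
    products are the required approximants. *)
Lemma kernel_bochner (W : R -> X) (C : R) :
  (forall s, 0 < s < t -> `|W s| <= C) ->
  (forall e, 0 < e -> exists2 Y : R -> X, simpleD Y &
     forall s, 0 < s < t -> `|Y s - W s| <= e) ->
  exists2 I, is_bochner_integral leb D (fun s => k t s *: W s) I &
    forall (l : X -> R) (K : R),
      (forall (a : R) (u v : X), l (a *: u + v) = a * l u + l v) ->
      (forall u, `|l u| <= K * `|u|) ->
      leb.-integrable D (EFin \o (fun s => k t s * l (W s))) /\
      l I = \int[leb]_(s in `]0, t[) (k t s * l (W s)).
Proof.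
move=> WC approx; have ik := kernel_integrable hk t0.
have t2 : 0 < t / 2 < t.
  by rewrite divr_gt0//= ltr_pdivrMr// ltr_pMr// ltr1n.
have C0 : 0 <= C by exact: le_trans (WC _ t2).
have n0 (n : nat) : 0 < n.+1%:R^-1 :> R by rewrite invr_gt0.
have ex n : exists Y : R -> X, simpleD Y /\
    forall s, 0 < s < t -> `|Y s - W s| <= n.+1%:R^-1.
  by have [Y hY1 hY2] := approx _ (n0 n); exists Y.
have [Y hY] := choice ex.
have [gs [igs gsk gsL]] := approximation_sfun_integrable mD ik.
pose g n : R -> R := fun x : measurableTypeR R => gs n x.
have ig n : leb.-integrable D (EFin \o g n) by exact: igs.
have gk' s : 0 < s < t -> g n s @[n --> \oo] --> k t s.
  move=> st; have := gsk s; rewrite /= in_itv/= => /(_ st) h.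
  exact: (fine_cvg h).
pose s n x := g n x *: Y n x.
(* |g Y - k W| <= |k - g| |Y| + |k| |Y - W|, where |Y| <= C + 1 because Y is within 1 of W. *)
pose G n x := `|k t x - g n x| * (C + 1) + `|k t x| * n.+1%:R^-1.
have iN := integrable_norm ik.
have iB n : leb.-integrable D (EFin \o (fun x => `|k t x - g n x|)).
  exact: (integrable_norm (lebesgue_integrableB mD ik (ig n))).
have iG n : leb.-integrable D (EFin \o G n).
  rewrite (_ : EFin \o G n = fun x => ((`|k t x - g n x| * (C + 1))%:E +
    (`|k t x| * n.+1%:R^-1)%:E)%E); last exact/funext.
  by apply: integrableD => //; apply: lebesgue_integrableZr.
have sg n : simpleD (s n).
  apply: (@simple_map_comp _ (measurableTypeR R) D _ _
    (fun x => (g n x, Y n x)) (fun c : R * X => c.1 *: c.2)).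
  apply: simple_map_pair; last exact: (hY n).1.
  split; last first.
    by move=> c; apply: measurableI => //; exact: (measurable_funPTI (gs n)).
  apply: (@sub_finite_set _ _ (range (g n))); last exact: (fimfunP (gs n)).
  by move=> _ [x _ <-]; exists x.
have dist n x : 0 < x < t -> `|s n x - k t x *: W x| <= G n x.
  move=> xt; have h2 := (hY n).2 x xt.
  have -> : s n x - k t x *: W x =
      (g n x - k t x) *: Y n x + k t x *: (Y n x - W x).
    by rewrite /s scalerBl scalerBr addrA subrK.
  apply: le_trans (ler_normD _ _) _; rewrite !normrZ [X in X * _ + _]distrC lerD//.
    rewrite ler_wpM2l// -[Y n x](subrK (W x)) (le_trans (ler_normD _ _))// addrC lerD ?WC//.
    by apply: le_trans h2 _; rewrite invf_le1// ler1n.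
  by rewrite ler_wpM2l.
have G0 : \int[leb]_(x in D) G n x @[n --> \oo] --> (0 : R).
  have -> : (fun n => \int[leb]_(x in D) G n x) =
      (fun n => (\int[leb]_(x in D) `|k t x - g n x|) * (C + 1) +
                (\int[leb]_(x in D) `|k t x|) * harmonic n).
    apply/funext => n; rewrite RintegralD//; try exact: lebesgue_integrableZr.
    by rewrite !RintegralZr.
  have c1 : (\int[leb]_(x in D) `|k t x - g n x|) * (C + 1) @[n --> \oo] --> 0 * (C + 1).
    by apply: cvgM; [exact: fine_cvg gsL|exact: cvg_cst].
  have c2 : (\int[leb]_(x in D) `|k t x|) * harmonic n @[n --> \oo]
      --> (\int[leb]_(x in D) `|k t x|) * 0.
    by apply: cvgM; [exact: cvg_cst|exact: cvg_harmonic].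
  have z0 : 0 * (C + 1) + (\int[leb]_(x in D) `|k t x|) * 0 = 0.
    by rewrite mul0r mulr0 addr0.
  by rewrite -[X in _ --> X]z0; exact: cvgD c1 c2.
have [||I hI1 hI2] := @bochner_integral_exists _ _ _ leb D mD muD X
    (fun x => k t x *: W x) s G sg _ iG _ G0.
- move=> x; rewrite /= in_itv/= => xt.
  apply/cvgrPdist_le => e e0.
  have : G n x @[n --> \oo] --> (0 : R).
    have c1 : `|k t x - g n x| * (C + 1) @[n --> \oo] --> `|k t x - k t x| * (C + 1).
      apply: cvgM; last exact: cvg_cst.
      by apply: cvg_norm; apply: cvgB; [exact: cvg_cst|exact: gk'].
    have c2 : `|k t x| * harmonic n @[n --> \oo] --> `|k t x| * 0.
      by apply: cvgM; [exact: cvg_cst|exact: cvg_harmonic].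
    have z0 : `|k t x - k t x| * (C + 1) + `|k t x| * 0 = 0.
      by rewrite subrr normr0 mul0r mulr0 addr0.
    by rewrite -[X in _ --> X]z0; exact: cvgD c1 c2.
  move/cvgr0Pnorm_le => /(_ _ e0); apply: filterS => n; apply: le_trans.
  by rewrite distrC (le_trans (dist n x xt))// ler_norm.
- by move=> n x; rewrite /= in_itv/=; exact: dist.
exists I => // l K lin lb; have [j1 j2] := hI2 l K lin lb.
have E : (fun s => l (k t s *: W s)) = (fun s => k t s * l (W s)).
  by apply/funext => x; rewrite (functionalZ lin).
by rewrite -E.
Qed.

(** Rounding down to multiples of e; boundedness of h leaves finitely many of them. *)
Lemma simple_map_quantize (h : R -> R) (B e : R) : measurable_fun D h -> 0 < e ->
  (forall s, 0 < s < t -> 0 <= h s <= B) ->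
  exists2 q : R -> R, simpleD q &
    forall s, 0 < s < t -> `|q s - h s| <= e.
Proof.
move=> mh e0 hB; pose z s := Num.truncn (h s / e).
have sz : simpleD z.
  split.
    apply: (@sub_finite_set _ _ `I_((Num.truncn (B / e)).+1)) => // _ [s + <-].
    rewrite /= in_itv/= => /hB /andP[h0 hsB]; rewrite ltnS.
    by apply: le_truncn; rewrite ler_wpM2r ?invr_ge0// ltW.
  move=> n; rewrite (_ : _ `&` _ = D `&` h @^-1` `[n%:R * e, n.+1%:R * e[).
    exact: mh.
  apply/seteqP; split => s /= []; rewrite !in_itv/= => /[dup] st /hB /andP[h0 _].
    move=> <-; split=> //; have he : 0 <= h s / e by rewrite divr_ge0// ltW.
    by have /andP[z1 z2] := truncn_itv he; rewrite -ler_pdivlMr// z1 -ltr_pdivrMr.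
  move=> /andP[n1 n2]; split=> //; apply/truncn_def.
  by rewrite ler_pdivlMr// n1 ltr_pdivrMr.
exists ((fun n : nat => n%:R * e) \o z); first exact: simple_map_comp.
move=> s /hB /andP[h0 _]; have he : 0 <= h s / e by rewrite divr_ge0// ltW.
have /andP[z1 z2] := truncn_itv he; move: z1 z2.
rewrite ler_pdivlMr// ltr_pdivrMr// -natr1 mulrDl mul1r /= -/(z s) => z1 z2.
by rewrite ler_norml; lra.
Qed.

(** In a Bernstein sum the vectors are fixed and only the scalar weights depend on s; rounding the
    weights makes it simple. Its distance to the limit is uniform in s because Phi(s, om) is bounded
    on (0, t). *)
Lemma subordinate_simple_approx (T : R -> X -> X) (M w om : R) (v : X) (e : R) :
  C0_semigroup T -> 0 <= M -> 0 <= w -> w < om ->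
  (forall a u, 0 <= a -> `|T a u| <= M * expR (w * a) * `|u|) ->
  (forall s, 0 < s < t -> positive_functional om (kernel_series k s)) -> 0 < e ->
  exists2 Y : R -> X, simpleD Y &
    forall s, 0 < s < t -> `|Y s - subordinate T om (kernel_series k s) v| <= e.
Proof.
move=> hT M0 w0 wom hM pos e0.
have cF : continuous (damped_orbit T om v).
  exact: (continuous_damped_orbit hT M0 wom hM).
have [B B0 hB] := kernel_series_le om hk t0.
have B1 : 0 < B + 1 by rewrite ltr_wpDl.
have e1 : 0 < e / 2 / (B + 1) by rewrite !divr_gt0.
have [N _ /(_ N (leqnn N)) hN] := bernstein_error cF e1.
pose x j := damped_orbit T om v (j%:R / N%:R).
pose wt (j : nat) s := exp_functional om (kernel_series k s) (bernstein N j).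
have phiB s : 0 < s < t -> kernel_series k s om <= B.
  move=> /andP[s0 st]; apply: le_trans (ler_norm _) _.
  by rewrite hB// !ltW.
have wtB j s : (j <= N)%N -> 0 < s < t -> 0 <= wt j s <= B.
  move=> jN st; have p0 := bernstein_functional_ge0 (pos s st) N.
  rewrite p0/=; apply: le_trans (phiB s st).
  rewrite -(bernstein_functional_sum om _ N) (bigD1 (Ordinal (jN : (j < N.+1)%N)))//=.
  by rewrite lerDl sumr_ge0.
pose S := \sum_(j < N.+1) `|x j|.
have S0 : 0 <= S by exact: sumr_ge0.
(* The rounding error allowed for each weight, so that all vectors together contribute at most e /
   2. *)
have e2 : 0 < e / 2 / (S + 1) by rewrite !divr_gt0// ltr_wpDl.
have exq j : exists q : R -> R, (j <= N)%N -> simpleD q /\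
    forall s, 0 < s < t -> `|q s - wt j s| <= e / 2 / (S + 1).
  case: (leqP j N) => [jN|_]; last by exists (fun=> 0).
  have [q q1 q2] := simple_map_quantize (measurable_exp_functional hk om (bernstein N j) t0)
    e2 (fun s => wtB j s jN).
  by exists q.
have [q hq] := choice exq.
exists (fun s => \sum_(j < N.+1) q j s *: x j).
  have : forall n, (n <= N.+1)%N -> simpleD (fun s => \sum_(j < n) q j s *: x j).
    elim=> [|n IH] nN.
      rewrite (_ : (fun _ => _) = cst 0); last by apply/funext => s; rewrite big_ord0.
      split; first by apply: (@sub_finite_set _ _ [set 0]) => // _ [s _ <-].
      move=> c; have [->|c0] := eqVneq 0 c.
        by rewrite (_ : _ `&` _ = D)//; apply/seteqP; split => s //= [].
      rewrite (_ : _ `&` _ = set0)//; apply/seteqP; split => s //= [_ E].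
      by rewrite E eqxx in c0.
    rewrite (_ : (fun _ => _) = (fun c : X * R => c.1 + c.2 *: x n) \o
      (fun s => (\sum_(j < n) q j s *: x j, q n s))); last first.
      by apply/funext => s; rewrite big_ord_recr.
    apply: simple_map_comp; apply: simple_map_pair; first by apply: IH; exact: ltnW.
    exact: (hq n nN).1.
  by apply.
move=> s st.
rewrite -(subrKA (bernstein_integral om (kernel_series k s) N (damped_orbit T om v))).
apply: le_trans (ler_normD _ _) _; rewrite [e]splitr lerD//.
  rewrite -sumrB; apply: le_trans (ler_norm_sum _ _ _) _.
  apply: (@le_trans _ _ (\sum_(j < N.+1) e / 2 / (S + 1) * `|x j|)).
    apply: ler_sum => j _; rewrite -scalerBl normrZ ler_wpM2r//.
    by apply: (hq j _).2 => //; rewrite -ltnS.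
  rewrite -mulr_sumr -/S mulrAC ler_pdivrMr ?ltr_wpDl// ler_wpM2l ?lerDl// ltW// divr_gt0//.
rewrite distrC; apply: le_trans (bernstein_limit_dist (pos s st) cF hN) _.
rewrite mulrAC ler_pdivrMr// ler_wpM2l ?(ltW (divr_gt0 e0 _))//.
by apply: le_trans (phiB s st) _; rewrite lerDl.
Qed.

End kernel_bochner.

(** * Independence, the Feynman-Kac weight and the stochastic representation *)

Section independent_expectation.
Context {R : realType} {d dS : measure_display} {Omega : measurableType d}
  {S : measurableType dS}.
Variables (P : probability Omega R) (Y : {mfun Omega >-> R}) (j : {mfun Omega >-> S}).
Hypothesis indep : forall A B, measurable A -> measurable B ->
  (P (Y @^-1` A `&` j @^-1` B) = P (Y @^-1` A) * P (j @^-1` B))%E.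

(** Independence makes the joint law of (Y, j) the product of the two laws; the rest is Fubini,
    integrability being carried from Omega to the product. The bound C serves the inner integral at
    a fixed a. *)
Lemma independent_expectation (F : R * S -> R) (C : R -> R) :
  measurable_fun setT F -> (forall a s, `|F (a, s)| <= C a) ->
  P.-integrable setT (EFin \o (fun w => F (Y w, j w))) ->
  (\int[P]_w (F (Y w, j w))%:E = \int[P]_w (\int[P]_w' (F (Y w, j w'))%:E))%E.
Proof.
move=> mF FC iF.
have mYj : measurable_fun setT (fun w => (Y w, j w)).
  by apply: measurable_fun_pair => //; exact: measurable_funP.
pose Yj : {mfun Omega >-> (R * S)%type} := mfun_Sub (mem_set mYj).
pose m1 := distribution P Y; pose m2 := distribution P j.
have mEF : measurable_fun setT (EFin \o F) by exact/measurable_EFinP.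
have prodE X : measurable X -> (m1 \x m2)%E X = distribution P Yj X.
  apply: product_measure_unique => A B mA mB.
  by rewrite /distribution /pushforward/= -indep.
have iprod : (m1 \x m2)%E.-integrable setT (EFin \o F).
  apply/integrableP; split => //.
  rewrite (eq_measure_integral (distribution P Yj)); last by move=> A mA _; exact: prodE.
  rewrite ge0_integral_distribution//; last exact: measurableT_comp.
  by case/integrableP : iF.
rewrite -[LHS](@integral_distribution _ _ _ _ _ P Yj (EFin \o F))//.
rewrite (eq_measure_integral (m1 \x m2)%E); last by move=> A mA _; apply/esym; exact: prodE.
rewrite -integral12_prod_meas1//.
have E a : (\int[m2]_s (F (a, s))%:E = \int[P]_w' (F (a, j w'))%:E)%E.
  rewrite (@integral_distribution _ _ _ _ _ P j (fun s => (F (a, s))%:E))//.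
    by apply/measurable_EFinP; exact: measurable_fun_pair2.
  apply: (@le_integrable _ _ _ P _ measurableT _ (EFin \o (fun _ : Omega => C a))).
  - apply/measurable_EFinP.
    apply: (@measurableT_comp _ _ _ _ _ _ (fun s => F (a, s))) => //.
    exact: measurable_fun_pair2.
  - by move=> w _ /=; rewrite lee_fin (le_trans (FC _ _))// ler_norm.
  - exact: finite_measure_integrable_cst.
transitivity (\int[P]_w (fubini_F m2 (EFin \o F) (Y w)))%E; last first.
  by apply: eq_integral => w _; rewrite /fubini_F E.
have iH := integrable_fubini_F iprod.
rewrite -[RHS](@integral_distribution _ _ _ _ _ P Y (fubini_F m2 (EFin \o F)))//.
  exact: measurable_int iH.
apply/integrableP; split.
  apply: measurableT_comp => //; exact: measurable_int iH.
case/integrableP : iH => mH; rewrite ge0_integral_distribution//.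
exact: measurableT_comp.
Qed.

End independent_expectation.

Section feynman_kac_weight.
Context {R : realType} {Q : ptopologicalType} {d : measure_display}
  {Omega : measurableType d}.
Local Notation leb := (@lebesgue_measure R).
Variable xi : R -> {mfun Omega >-> borel Q}.
Local Notation S := (g_sigma_algebraType (process_sigma xi `[0, +oo[)).
Hypothesis hxim : measurable_process xi.

(** Finite arguments give [expR]; both infinities give 0, the value at +oo being 0 because [fine]
    sends +oo to 0. *)
Lemma measurable_fine_expeR : measurable_fun [set: \bar R] (fun x => fine (expeR x)).
Proof.
have mfin : measurable [set x : \bar R | x \is a fin_num].
  rewrite (_ : [set x | _] = ~` ([set -oo%E] `|` [set +oo%E])).
    by apply: measurableC; apply: measurableU; exact: emeasurable_set1.
  apply/seteqP; split => x /=; rewrite fin_numE => /=.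
    by move=> /andP[/eqP h1 /eqP h2] [].
  move=> h; apply/andP; split; apply/eqP => h1; apply: h; [by left|by right].
rewrite (_ : (fun x => _) = (fun x : \bar R => expR (fine x)) \_ [set x | x \is a fin_num]).
  apply/(measurable_restrictT _ mfin); apply: measurable_funTS.
  by apply: measurableT_comp => //.
apply/funext => -[x||]; rewrite /patch.
- by rewrite mem_set.
- by rewrite memNset.
- by rewrite memNset.
Qed.

Variables (V : Q -> R) (c : R).
Hypotheses (mV : measurable_fun [set: borel Q] (V : borel Q -> R))
  (Vc : forall x, V x <= c) (c0 : 0 <= c).

Let Vxi : R * S -> R := (fun p => V (xi p.1 p.2)) \_ (`[0, +oo[ `*` setT).

Let mVxi : measurable_fun setT Vxi.
Proof.
have mD : measurable ((`[0, +oo[ : set R) `*` (setT : set S)) by exact: measurableX.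
apply/(measurable_restrictT _ mD).
by apply: (@measurable_comp _ _ _ _ _ _ setT (V : borel Q -> R)) => //.
Qed.

Let V_section (w : S) : measurable_fun setT (fun s => Vxi (s, w)).
Proof. exact: measurable_fun_pair1. Qed.

Let fk_integralE a w : (\int[leb]_(s in `[0%R, a]) (V (xi s w))%:E =
  \int[leb]_s (((fun s => Vxi (s, w)) \_ `[0, a]) s)%:E)%E.
Proof.
rewrite integral_mkcond; apply: eq_integral => s _; rewrite /patch.
case: ifPn => //; rewrite inE/= in_itv/= => /andP[s0 _].
by rewrite /Vxi /patch mem_set//; split => //=; rewrite in_itv/= s0.
Qed.

Lemma fk_weight_ge0 a w : 0 <= fk_weight xi V a w.
Proof. by rewrite fine_ge0// expeR_ge0. Qed.

(** The integral may be -oo. Dropping the negative part of the integrand leaves values between 0 and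
    c, which is where 0 <= c enters. *)
Lemma fk_weight_le a w : 0 <= a -> fk_weight xi V a w <= expR (c * a).
Proof.
move=> a0; rewrite /fk_weight.
have h : (\int[leb]_(s in `[0%R, a]) (V (xi s w))%:E <= (c * a)%:E)%E.
  have mVs : measurable_fun (`[0, a] : set R) (fun s => V (xi s w)).
    apply: (@eq_measurable_fun _ _ _ _ (`[0, a] : set R) (fun s => Vxi (s, w))).
      move=> s; rewrite inE/= in_itv/= => /andP[s0 _].
      by rewrite /Vxi /patch mem_set//; split => //=; rewrite in_itv/= s0.
    exact: measurable_funTS.
  rewrite integralE; apply: (@le_trans _ _ (\int[leb]_(s in `[0%R, a])
      ((fun s => (V (xi s w))%:E)^\+ s))%E).
    by rewrite -[leRHS]sube0 leeB//; apply: integral_ge0 => s _; exact: funeneg_ge0.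
  apply: (@le_trans _ _ (\int[leb]_(s in `[0%R, a]) c%:E)%E).
    apply: ge0_le_integral => //.
    - by apply: measurable_funepos; exact/measurable_EFinP.
    - by move=> s _; rewrite funeposE ge_max !lee_fin Vc.
  rewrite integral_cst//= lebesgue_measure_itv/=; case: ifPn => _.
    by rewrite sube0 -EFinM.
  by rewrite mule0 lee_fin mulr_ge0.
case: (integral _ _ _) h => [x h| |_].
- by rewrite /= ler_expR -lee_fin.
- by rewrite leye_eq.
- by rewrite /= expR_ge0.
Qed.

(** The limits of integration are moved into the integrand as the condition 0 <= s <= a, and Tonelli
    is applied to the positive and negative parts. *)
Lemma measurable_fk_weight :
  measurable_fun setT (fun p : R * S => fk_weight xi V p.1 p.2).
Proof.
pose h : (R * S) * R -> \bar R := fun q => (((fun q : (R * S) * R => Vxi (q.2, q.1.2))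
  \_ [set q | 0 <= q.2 <= q.1.1]) q)%:E.
have mh : measurable_fun setT h.
  apply/measurable_EFinP.
  have mT : measurable [set q : (R * S) * R | 0 <= q.2 <= q.1.1].
    have mb : measurable_fun [set: (R * S) * R] (fun q => 0 <= q.2 <= q.1.1).
      apply: measurable_and; apply: measurable_fun_ler => //.
      exact: (measurableT_comp measurable_fst measurable_fst).
    by have := mb measurableT [set true] I; rewrite setTI.
  apply/(measurable_restrictT _ mT); apply: measurable_funTS.
  apply: (@measurableT_comp _ _ _ _ _ _ Vxi) => //.
  apply: measurable_fun_pair => //.
  exact: (measurableT_comp measurable_snd measurable_fst).
rewrite (_ : (fun p => _) = fun p : R * S => fine (expeR
    (\int[leb]_s (h^\+ (p, s)) - \int[leb]_s (h^\- (p, s)))%E)).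
  apply: (@measurableT_comp _ _ _ _ _ _ (fun x => fine (expeR x))).
    exact: measurable_fine_expeR.
  apply: emeasurable_funB.
    apply: (measurable_fun_fubini_tonelli_F (m2 := leb) _ (measurable_funepos mh)).
    by move=> x; exact: funepos_ge0.
  apply: (measurable_fun_fubini_tonelli_F (m2 := leb) _ (measurable_funeneg mh)).
  by move=> x; exact: funeneg_ge0.
apply/funext => -[a w]; rewrite /fk_weight fk_integralE; congr (fine (expeR _)).
transitivity (\int[leb]_s h ((a, w), s))%E.
  apply: eq_integral => s _; rewrite /h /patch/=; congr (EFin _).
rewrite integralE; congr (_ - _)%E; apply: eq_integral => s _.
  by rewrite !funeposE.
by rewrite !funenegE.
Qed.

End feynman_kac_weight.

Section subordinated_expectation.
Context {R : realType} {Q : ptopologicalType} {d : measure_display}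
  {Omega : measurableType d}.
Variables (P : Q -> probability Omega R) (xi : R -> {mfun Omega >-> borel Q}).
Local Notation S := (g_sigma_algebraType (process_sigma xi `[0, +oo[)).

(** As Y is nonnegative, the restriction to [0, +oo[ loses nothing; for Re l >= 0 the integrands are
    bounded by 1, which justifies the change of variables. *)
Lemma laplace_transform_nonneg (Pr : probability Omega R) (Y : {mfun Omega >-> R})
    (l : R[i]) : (forall w, 0 <= Y w) ->
  0 <= complex.Re l ->
  laplace_transform (distribution Pr Y) l =
  (\int[Pr]_w complex.Re (cexp (- l * (Y w)%:C))) +i*
  (\int[Pr]_w complex.Im (cexp (- l * (Y w)%:C))).
Proof.
move=> Y0 l0; case: l l0 => a b /= a0.
have tr (g : R -> R) : measurable_fun setT g -> (forall u, `|g u| <= 1) ->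
    \int[distribution Pr Y]_(u in `[0, +oo[) (expR (- a * u) * g u) =
    \int[Pr]_w (expR (- a * Y w) * g (Y w)).
  move=> mg g1; have mh : measurable_fun setT (fun u => expR (- a * u) * g u).
    apply: measurable_funM => //; apply: continuous_measurable_fun.
    exact: continuous_expRM.
  rewrite Rintegral_mkcond /Rintegral.
  set h := (fun u => expR (- a * u) * g u) in mh *.
  have mhD : measurable_fun setT (h \_ `[0, +oo[).
    by apply/(measurable_restrictT _ (measurable_itv _)); exact: measurable_funTS.
  have hY w : (h \_ `[0, +oo[) (Y w) = h (Y w).
    by rewrite /patch mem_set//= in_itv/= Y0.
  rewrite (@integral_distribution _ _ _ _ _ Pr Y (EFin \o h \_ `[0, +oo[)).
  - by congr fine; apply: eq_integral => w _; rewrite /= hY.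
  - exact/measurable_EFinP.
  - apply: (@le_integrable _ _ _ Pr _ measurableT _ (EFin \o cst 1)).
    + by apply/measurable_EFinP; apply: measurableT_comp => //; exact: measurable_funP.
    + move=> w _; rewrite /= lee_fin normr1 hY /h normrM ger0_norm ?expR_ge0//.
      rewrite -[leRHS]mulr1 ler_pM ?expR_ge0//.
      by rewrite -expR0 ler_expR mulNr oppr_le0 mulr_ge0.
    + exact: finite_measure_integrable_cst.
have RE (u : R) : complex.Re (cexp (- (a +i* b) * u%:C)) = expR (- a * u) * cos (- b * u).
  by rewrite /cexp/= !mulr0 subr0 add0r.
have IE (u : R) : complex.Im (cexp (- (a +i* b) * u%:C)) = expR (- a * u) * sin (- b * u).
  by rewrite /cexp/= !mulr0 subr0 add0r.
have cb : continuous (fun u => - b * u) by exact: mulrl_continuous.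
rewrite /laplace_transform; congr (_ +i* _).
  under eq_Rintegral do rewrite RE.
  rewrite (tr (fun u => cos (- b * u))).
  - by apply: eq_Rintegral => w _; exact/esym/RE.
  - apply: continuous_measurable_fun => u.
    by apply: continuous_comp; [exact: cb|exact: continuous_cos].
  - by move=> u; rewrite ler_norml cos_geN1 cos_le1.
under eq_Rintegral do rewrite IE.
rewrite (tr (fun u => sin (- b * u))).
- by apply: eq_Rintegral => w _; exact/esym/IE.
- apply: continuous_measurable_fun => u.
  by apply: continuous_comp; [exact: cb|exact: continuous_sin].
- by move=> u; rewrite ler_norml sin_geN1 sin_le1.
Qed.

(** Only real arguments of the Laplace transform enter: they determine the moments, and the decay of
    the coefficients extends the formula to all real l. *)
Lemma associated_time_mgf (k : R -> R -> R) (t : R) (Y : {mfun Omega >-> R}) x :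
  admissible_kernel k -> 0 <= t -> associated_time P k t Y ->
  has_mgf (P x) Y (kernel_series k t).
Proof.
move=> hk t0 [Y0 hL]; have mY : measurable_fun setT Y by exact: measurable_funP.
split=> // l.
have T0 : 0 < t + 1 by rewrite ltr_wpDl.
apply: (@exp_moment_eq _ _ _ (P x) Y (kernel_coef k ^~ t)) => //.
  move=> b b0; have [g g0 hg] := kernel_coef_le hk T0 b0.
  exists (expR (g * t)); first exact: expR_ge0.
  by move=> n; rewrite mulrC hg// t0 lerDl ler01.
move=> m m0; have := hL x m%:C; rewrite /= m0 => /(_ isT).
rewrite laplace_transform_nonneg// -rmorphN Phi_real// => h.
have hE : \int[P x]_w complex.Re (cexp ((- m)%:C * (Y w)%:C)) = kernel_series k t (- m).
  exact: (congr1 (@complex.Re R) h).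
rewrite -[limn _]/(kernel_series k t (- m)) -hE /Rintegral.
have E : (\int[P x]_w (expR (- (m * Y w)))%:E =
    \int[P x]_w (complex.Re (cexp ((- m)%:C * (Y w)%:C)))%:E)%E.
  by apply: eq_integral => w _; rewrite /cexp/= !(mulr0, oppr0, mul0r, addr0, subr0)
    cos0 mulr1 mulNr.
rewrite -E fineK//.
have i1 : (P x).-integrable setT (EFin \o (fun w => expR (- (m * Y w)))).
  apply: (@le_integrable _ _ _ (P x) _ measurableT _ (EFin \o cst 1)).
  - apply/measurable_EFinP; apply: measurableT_comp => //.
    by apply: measurableT_comp => //; exact: measurable_funM.
  - move=> w _ /=; rewrite lee_fin normr1 ger0_norm ?expR_ge0//.
    by rewrite -expR0 ler_expR oppr_le0 mulr_ge0.
  - exact: finite_measure_integrable_cst.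
exact: (integrable_fin_num measurableT i1).
Qed.

Lemma process_sigma_measurable (E : set Omega) :
  process_sigma xi `[0, +oo[ E -> measurable E.
Proof.
apply: smallest_sub; first exact: sigma_algebra_measurable.
move=> _ [r [B [_ mB ->]]]; rewrite -[X in measurable X]setTI.
exact: measurable_funP.
Qed.

Let mid : measurable_fun setT (fun w : Omega => w : S).
Proof.
move=> _ B; rewrite setTI preimage_id => mB; apply: process_sigma_measurable.
have := mB; rewrite /measurable/= smallest_id//.
exact: smallest_sigma_algebra.
Qed.

(** Independence refers to the sigma-field of the process. The variable paired with Y is therefore
    the identity of Omega, taken with values in Omega under that sigma-field, and f (xi a w) * G a w
    is a jointly measurable function of the pair for a >= 0. *)
Lemma subordinated_expectation (Pr : probability Omega R) (Y : {mfun Omega >-> R})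
    (phi : R -> R) (f : Q -> R) (G : R -> Omega -> R) (C c : R) (u : R -> R) :
  measurable_process xi ->
  independent Pr (process_sigma xi `[0, +oo[) (g_sigma_algebra_preimage Y) ->
  has_mgf Pr Y phi ->
  measurable_fun [set: borel Q] (f : borel Q -> R) -> (forall q, `|f q| <= C) ->
  measurable_fun setT (fun p : R * S => G p.1 p.2) ->
  (forall a w, 0 <= a -> 0 <= G a w <= expR (c * a)) ->
  (forall a, 0 <= a -> u a = fine 'E_Pr[fun w => f (xi a w) * G a w]) ->
  fine 'E_Pr[fun w => f (xi (Y w) w) * G (Y w) w] = \int[Pr]_w u (Y w).
Proof.
move=> hxim ind hY mf fC mG Gb uE; have [mY Y0 hmgf] := hY.
have C0 : 0 <= C by exact: le_trans (fC point).
have mD : measurable ((`[0, +oo[ : set R) `*` (setT : set S)) by exact: measurableX.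
pose F : R * S -> R := (fun p => f (xi p.1 p.2) * G p.1 p.2) \_ (`[0, +oo[ `*` setT).
have mF : measurable_fun setT F.
  apply/(measurable_restrictT _ mD); apply: measurable_funM; last exact: measurable_funTS.
  by apply: (@measurable_comp _ _ _ _ _ _ setT (f : borel Q -> R)).
have FE a (w : S) : 0 <= a -> F (a, w) = f (xi a w) * G a w.
  by move=> a0; rewrite /F /patch mem_set//; split => //=; rewrite in_itv/= a0.
have FC a s : `|F (a, s)| <= C * expR (c * a).
  rewrite /F /patch; case: ifPn => [|_]; last by rewrite normr0 mulr_ge0 ?expR_ge0.
  rewrite inE/= in_itv/= andbT => -[a0 _]; have /andP[G0 G1] := Gb a s a0.
  by rewrite normrM ler_pM// ger0_norm.
pose j : {mfun Omega >-> S} := mfun_Sub (mem_set mid).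
have indep A B : measurable A -> measurable B ->
    (Pr (Y @^-1` A `&` j @^-1` B) = Pr (Y @^-1` A) * Pr (j @^-1` B))%E.
  move=> mA mB; rewrite setIC muleC; apply: ind; last by exists A => //; rewrite setTI.
  have := mB; rewrite /measurable/= smallest_id//.
  exact: smallest_sigma_algebra.
have mFY : measurable_fun setT (fun w => F (Y w, j w)).
  by apply: measurableT_comp => //; apply: measurable_fun_pair.
have [iF _] := mgf_dominated hY mFY (fun w => FC (Y w) (j w)).
have := independent_expectation indep mF FC iF => E.
rewrite unlock.
transitivity (fine (\int[Pr]_w (F (Y w, j w))%:E)%E).
  by congr fine; apply: eq_integral => w _; rewrite FE.
rewrite E /Rintegral; congr fine; apply: eq_integral => w _.
rewrite uE// unlock fineK; last first.
  have mFa : measurable_fun setT (fun w' : Omega => F (Y w, j w')).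
    apply: (@measurableT_comp _ _ _ _ _ _ (fun s => F (Y w, s))) => //.
    exact: measurable_fun_pair2.
  have ia : Pr.-integrable setT (EFin \o (fun w' : Omega => F (Y w, j w'))).
    apply: (@le_integrable _ _ _ Pr _ measurableT _
      (EFin \o (fun _ : Omega => C * expR (c * Y w)))).
    - exact/measurable_EFinP.
    - by move=> w' _ /=; rewrite lee_fin (le_trans (FC _ _))// ler_norm.
    - exact: finite_measure_integrable_cst.
  have := integrable_fin_num measurableT ia.
  by under eq_integral do rewrite /= FE//.
by apply: eq_integral => w' _; rewrite FE.
Qed.

End subordinated_expectation.

(** * Derivatives of orbits and the subordination principle *)

Section orbit_derivative.
Context {R : realType} {X : completeNormedModType R}.
Variable T : R -> X -> X.
Hypothesis hT : C0_semigroup T.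

(** The right derivative at 0 gives a two-sided one at a > 0. For the increment -r, the quotient is
    T (a - r) applied to the right quotient at 0 with increment r, which adds to the error only the
    term T (a - r) (v - T r v). *)
Lemma is_derive_orbit (l : X -> R) (C : R) (u v : X) (a : R) :
  (forall (b : R) (u v : X), l (b *: u + v) = b * l u + l v) ->
  (forall u, `|l u| <= C * `|u|) -> generator T (u, v) -> 0 < a ->
  is_derive a 1 (fun b => l (T (Num.max 0 b) u)) (l (T (Num.max 0 a) v)).
Proof.
move=> lin lb guv a0; have [M [w [M0 w0 hM]]] := semigroup_growth hT.
have lB := functionalB lin; have lZ := functionalZ lin.
have max0 (b : R) : 0 <= b -> Num.max 0 b = b by move=> b0; rewrite max_r.
rewrite max0; last exact: ltW.
pose K := `|C| * (M * expR (w * a)); have K0 : 0 <= K by rewrite !mulr_ge0// expR_ge0.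
have K1 : 0 < K + 1 by rewrite ltr_wpDl.
suff key : h^-1 *: (l (T (Num.max 0 (h *: 1 + a)) u) - l (T (Num.max 0 a) u))
    @[h --> 0^'] --> l (T a v).
  apply: DeriveDef; last by apply: cvg_lim key.
  by apply/cvg_ex; exists (l (T a v)).
apply/cvgrPdist_le => e e0; rewrite (max0 a (ltW a0)).
have e20 : 0 < e / 2 / (K + 1) by rewrite !divr_gt0.
have /cvgrPdist_le /(_ _ e20) := guv.
rewrite near_withinE => /nbhs_ballP [r1 /= r10 hr1].
have /cvgrPdist_le /(_ _ e20) := semigroup_cvg0 hT (u := v).
rewrite near_withinE => /nbhs_ballP [r2 /= r20 hr2].
rewrite near_withinE; apply/nbhs_ballP; exists (Num.min a (Num.min r1 r2)).
  by rewrite /= !lt_min a0 r10.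
move=> h /=; rewrite /ball/= sub0r normrN !lt_min => /and3P[ha h1 h2] hn0.
have n0 : 0 < `|h| by rewrite normr_gt0.
have q1 : `|v - `|h|^-1 *: (T `|h| u - u)| <= e / 2 / (K + 1).
  by apply: hr1 => //=; rewrite /ball/= sub0r normrN normr_id.
have q2 : `|v - T `|h| v| <= e / 2 / (K + 1).
  by apply: hr2 => //=; rewrite /ball/= sub0r normrN normr_id.
have bnd b z : 0 <= b <= a -> `|l (T b z)| <= K * `|z|.
  move=> /andP[b0 ba]; apply: le_trans (functional_le lb _) _.
  rewrite /K -mulrA ler_wpM2l//; apply: le_trans (hM _ _ b0) _.
  by rewrite ler_wpM2r// ler_wpM2l// ler_expR ler_wpM2l.
have small (z1 z2 : X) : `|z1| <= e / 2 / (K + 1) -> `|z2| <= e / 2 / (K + 1) ->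
    K * `|z1| + K * `|z2| <= e.
  move=> hz1 hz2; rewrite -mulrDr.
  apply: (@le_trans _ _ ((K + 1) * (e / (K + 1)))); last by rewrite mulrC divfK// gt_eqF.
  apply: ler_pM; rewrite ?addr_ge0 ?lerDl//.
  apply: le_trans (lerD hz1 hz2) _.
  by rewrite -mulrDl -splitr.
have -> : h *: (1 : R) = h by rewrite /GRing.scale/= mulr1.
rewrite {1}/GRing.scale/=.
have [hp|hneg] := ltP 0 h.
  rewrite gtr0_norm// in q1 q2.
  have -> : l (T a v) - h^-1 * (l (T (Num.max 0 (h + a)) u) - l (T a u)) =
      l (T a (v - h^-1 *: (T h u - u))).
    rewrite max0; last by rewrite addr_ge0// ltW.
    rewrite [h + a]addrC (semigroupD hT) ?ltW//.
    by rewrite !(semigroupB hT, semigroupZ hT) ?ltW// !lB lZ !lB.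
  apply: le_trans (bnd _ _ _) _; first by rewrite lexx ltW.
  apply: le_trans _ (small _ 0 q1 _); rewrite ?normr0 ?mulr0 ?addr0//.
  exact: ltW.
set r := `|h| in n0 q1 q2 ha *; have hr : h = - r by rewrite /r ler0_norm// opprK.
have ar : 0 <= a - r by rewrite subr_ge0 ltW.
have r0 := ltW n0.
have E z : T a z = T (a - r) (T r z) by rewrite -(semigroupD hT)// subrK.
have -> : l (T a v) - h^-1 * (l (T (Num.max 0 (h + a)) u) - l (T a u)) =
    l (T (a - r) (v - r^-1 *: (T r u - u))) - l (T (a - r) (v - T r v)).
  rewrite hr [- r + a]addrC max0// invrN mulNr -mulrN opprB !E.
  rewrite !(semigroupB hT, semigroupZ hT)// !lB lZ lB; ring.
apply: le_trans (ler_normB _ _) _; apply: le_trans _ (small _ _ q1 q2).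
by apply: lerD; apply: bnd; rewrite ar gerBl.
Qed.

End orbit_derivative.

Section subordination_principle.
Context {R : realType} {Q : ptopologicalType} {d : measure_display}
  {Omega : measurableType d} {X : completeNormedModType R}.
Local Notation leb := (@lebesgue_measure R).
Variables (P : Q -> probability Omega R) (xi : R -> {mfun Omega >-> borel Q}).
Local Notation S := (g_sigma_algebraType (process_sigma xi `[0, +oo[)).

Lemma half_integer_neq (R' : realType) (n i : nat) : n%:R + 2^-1 - i%:R != 0 :> R'.
Proof.
have [ni|ni] := leqP i n.
  by rewrite gt_eqF// addrAC ltr_wpDl ?invr_gt0// subr_ge0 ler_nat.
rewrite lt_eqF// subr_lt0.
have : n.+1%:R <= i%:R :> R' by rewrite ler_nat.
rewrite -natr1; lra.
Qed.

(** The factor G unites both representations: it is 1 for the process alone and the Feynman-Kac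
    weight in the presence of a potential. The bound expR (c * a) suffices because A(t) has
    exponential moments of every order. *)
Theorem subordination_solves (iota : X -> Q -> R) (T : R -> X -> X)
    (G : R -> Omega -> R) (c : R) (k : R -> R -> R) (A : R -> {mfun Omega >-> R}) :
  measurable_process xi -> bounded_borel_space iota -> C0_semigroup T ->
  measurable_fun setT (fun p : R * S => G p.1 p.2) ->
  (forall a w, 0 <= a -> 0 <= G a w <= expR (c * a)) ->
  (forall t u0 x, 0 <= t ->
    iota (T t u0) x = fine 'E_(P x)[fun w => iota u0 (xi t w) * G t w]) ->
  admissible_kernel k -> associated_times P k A ->
  (forall t x, 0 <= t -> independent (P x) (process_sigma xi `[0, +oo[)
                                     (g_sigma_algebra_preimage (A t))) ->
  forall u0 : X, Dom (generator T) u0 ->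
  solves iota (generator T) k u0 (fun t x =>
    fine 'E_(P x)[fun w => iota u0 (xi (A t w) w) * G (A t w) w]).
Proof.
move=> hxim hX hT mG Gb rep hk hA ind u0 [v guv].
have [Ci hCi] := space_bounded hX.
have lin x (a : R) (u v' : X) : iota (a *: u + v') x = a * iota u x + iota v' x.
  exact: (space_linear hX).
have lb x u : `|iota u x| <= Ci * `|u| by exact: hCi.
have [M [w [M0 w0 hM]]] := semigroup_growth hT.
(* [om] exceeds the growth bound and is not an integer, so that none of the
   exponentials [expR ((om - i) * a)] used for approximation is constant. *)
pose om : R := (Num.truncn w).+1%:R + 2^-1.
have wom : w < om.
  have /andP[_ h] := truncn_itv w0; apply: lt_trans h _.
  by rewrite ltrDl invr_gt0.
have om0 : 0 < om by exact: le_lt_trans wom.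
have omi i : om - i%:R != 0 by exact: half_integer_neq.
have mgf t x : 0 <= t -> has_mgf (P x) (A t) (kernel_series k t).
  by move=> t0; apply: associated_time_mgf => //; exact: hA.
(* Positivity concerns only the moment generating function, common to all starting points, so it can
   be read off from one of them. *)
have pos t : 0 <= t -> positive_functional om (kernel_series k t).
  by move=> t0; exact: mgf_positive_functional (mgf t point t0).
pose J t := subordinate T om (kernel_series k t).
have cF z := continuous_damped_orbit hT M0 wom hM (u := z).
have JE t x z : 0 <= t -> iota (J t z) x = \int[P x]_w iota (T (A t w) z) x.
  move=> t0; have [_ A0 _] := mgf t x t0.
  rewrite (bernstein_limit_functional om (mgf t x t0) (cF z) (lin x) (lb x)).2.
  apply: eq_Rintegral => w' _.
  rewrite -(functionalZ (l := iota^~ x) (lin x)) damped_orbitE//.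
have uE t x : 0 <= t -> fine 'E_(P x)[fun w => iota u0 (xi (A t w) w) * G (A t w) w] =
    iota (J t u0) x.
  move=> t0; rewrite JE//.
  apply: (subordinated_expectation (C := Ci * `|u0|) (c := c)
    (u := fun a => iota (T a u0) x) hxim (ind t x t0) (mgf t x t0)) => //.
  - exact: (space_measurable hX).
  - by move=> a a0; rewrite rep.
have JW t : 0 < t -> exists2 C, 0 <= C & forall s, 0 < s < t -> `|J s v| <= C.
  move=> t0; have [B B0 hB] := kernel_series_le om hk t0.
  exists (M * B * `|v|); first by rewrite !mulr_ge0.
  move=> s /andP[s0 st].
  apply: le_trans (subordinate_norm hT M0 wom hM (pos s (ltW s0)) v) _.
  rewrite ler_wpM2r// ler_wpM2l//; apply: le_trans (ler_norm _) _.
  by rewrite hB// !ltW.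
have main t : 0 < t -> exists2 I : X,
    is_bochner_integral leb `]0, t[ (fun s => k t s *: J s v) I &
    forall x, leb.-integrable `]0, t[ (EFin \o (fun s => k t s * iota (J s v) x)) /\
      [/\ iota I x = \int[leb]_(s in `]0, t[) (k t s * iota (J s v) x) &
      iota (J t u0) x = iota u0 x + iota I x].
  move=> t0; have [C C0 hC] := JW t t0.
  have ap e : 0 < e -> exists2 Y : R -> X, @simple_map _ (measurableTypeR R) `]0, t[%classic _ Y &
      forall s, 0 < s < t -> `|Y s - J s v| <= e.
    move=> e0; apply: (subordinate_simple_approx hk t0 v hT M0 w0 wom hM _ e0).
    by move=> s /andP[s0 _]; apply: pos; exact: ltW.
  have [I hI1 hI2] := kernel_bochner hk t0 hC ap.
  exists I => // x; have [j1 j2] := hI2 _ _ (lin x) (lb x).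
  split=> //; split=> //; rewrite j2.
  pose Gx a := iota (T (Num.max 0 a) u0) x; pose g a := iota (T (Num.max 0 a) v) x.
  have max0 (b : R) : 0 <= b -> Num.max 0 b = b by move=> b0; rewrite max_r.
  have cl := functional_continuous (l := iota^~ x) (lin x) (lb x).
  have [_ A0 _] := mgf t x (ltW t0).
  (* The Volterra identity for a |-> (T_a u0)(x), whose derivative is (T_a v)(x); by [JE] the
     expectations of the latter are the values of J s v at x. *)
  have Vid : \int[P x]_w' Gx (A t w') - Gx 0 =
      \int[leb]_(s in `]0, t[) (k t s * iota (J s v) x).
    apply: (volterra_identity hk (fun s s0 => mgf s x s0) (om := om)
      (f := fun y => iota (damped_orbit T om v y) x) (g := g)) => //.
    - move=> y; apply: (@continuous_comp _ _ _ (damped_orbit T om v) (iota^~ x)); first exact: cF.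
      exact: cl.
    - move=> a a0; rewrite /g max0// -(functionalZ (l := iota^~ x) (lin x)) damped_orbitE//.
    - rewrite (_ : Gx = (iota^~ x) \o (fun a => T (Num.max 0 a) u0))// => a.
      by apply: continuous_comp; [exact: continuous_orbit | exact: cl].
    - by move=> a a0; exact: (is_derive_orbit hT (lin x) (lb x) guv a0).
    - move=> s /andP[s0 _]; have [_ As0 _] := mgf s x (ltW s0).
      rewrite JE; last exact: ltW.
      by apply: eq_Rintegral => w' _; rewrite /g max0.
  rewrite -Vid {2}/Gx max0// (semigroup0 hT) addrC subrK JE; last exact: ltW.
  by apply: eq_Rintegral => w' _; rewrite /Gx max0.
exists (J^~ u0), (J^~ v); split.
- by move=> t t0; apply/funext => x; rewrite uE.
- move=> t t0; exact: (subordinate_generator hT M0 wom hM (pos t t0) guv).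
- move=> t t0; have [I hI1 hI2] := main t t0; exists I => // x.
  by have [_ [_ hI]] := hI2 x; rewrite uE// ltW.
(* By the equation, u(t, x) - u0(x) is an integral of k t against values of J s v, which are bounded
   for s < 1, and the integral of |k t| tends to 0. *)
- move=> x; apply/cvgrPdist_le => e e0.
  have [C C0 hC] := JW 1 ltr01.
  pose K := `|Ci| * C; have K0 : 0 <= K by rewrite mulr_ge0.
  have eK : 0 < e / (K + 1) by rewrite divr_gt0// ltr_wpDl.
  have [dl dl0 hdl] := kernel_integral_cvg0 hk eK.
  near=> t; have t0 : 0 < t by near: t; exact: nbhs_right_gt.
  have t1 : t < 1 by near: t; exact: nbhs_right_lt.
  have td : t < dl by near: t; exact: nbhs_right_lt.
  have [I _ hI2] := main t t0; have [j1 [j2 j3]] := hI2 x.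
  rewrite uE ?ltW// j3 opprD addNKr normrN j2.
  have ik := integrable_norm (kernel_integrable hk t0).
  apply: (@le_lt_trans _ _ (\int[leb]_(s in `]0, t[) (`|k t s| * K))).
    apply: le_trans (le_normr_Rintegral _ j1) _ => //.
    apply: le_Rintegral => //; first exact: (integrable_norm j1).
      exact: lebesgue_integrableZr.
    move=> s; rewrite /= in_itv/= => /andP[s0 st]; rewrite normrM ler_wpM2l//.
    apply: le_trans (functional_le (l := iota^~ x) (lb x) _) _.
    by rewrite ler_wpM2l// hC// s0 (lt_trans st).
  rewrite RintegralZr//.
  apply: (@le_lt_trans _ _ (e / (K + 1) * K)).
    by rewrite ler_wpM2r// hdl// t0.
  by rewrite mulrAC ltr_pdivrMr ?ltr_wpDl// ltr_pM2l// ltrDl.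
Unshelve. all: by end_near. Qed.

End subordination_principle.

(** * Scaling for homogeneous kernels *)

Section scaling.
Context {R : realType}.
Local Notation leb := (@lebesgue_measure R).

(** Lebesgue measure is t times its image under multiplication by t, as is checked on half-open
    intervals. *)
Lemma ge0_integral_lebesgue_scale (t : R) (D : set R) (f : R -> \bar R) : 0 < t ->
  measurable D -> measurable_fun D f -> (forall x, D x -> (0 <= f x)%E) ->
  (\int[leb]_(x in D) f x = t%:E * \int[leb]_(x in *%R t @^-1` D) f (t * x)%R)%E.
Proof.
move=> t0 mD mf f0.
have mt : measurable_fun [set: measurableTypeR R] ( *%R t : _ -> measurableTypeR R).
  exact: mulrl_measurable.
pose nu0 : {measure set (measurableTypeR R) -> \bar R} :=
  mscale (NngNum (ltW t0)) (pushforward leb ( *%R t : measurableTypeR R -> measurableTypeR R)).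
pose nu := nu0 mt.
have lebE B : measurable B -> leb B = nu B.
  apply: lebesgue_measure_unique => _ [[a b]] _ <-.
  rewrite /nu /nu0/= /mscale /pushforward/=.
  rewrite [X in (_ * lebesgue_measure X)%E](_ : _ = `]a / t, b / t]%classic); last first.
    by apply/seteqP; split => x; rewrite /= !in_itv/= ltr_pdivrMr// ler_pdivlMr// mulrC.
  rewrite !lebesgue_measure_itv/= !lte_fin ltr_pM2r ?invr_gt0//.
  case: ifP => _; last by rewrite mule0.
  by rewrite -!EFinD -EFinM -mulrBl mulrCA divff ?gt_eqF// mulr1.
rewrite (eq_measure_integral nu); last by move=> B mB _; exact: lebE.
rewrite ge0_integral_mscale//= ge0_integral_pushforward//.
by move=> y; rewrite inE; exact: f0.
Qed.

Lemma Rintegral_lebesgue_scale (t : R) (D : set R) (f : R -> R) : 0 < t ->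
  measurable D -> leb.-integrable D (EFin \o f) ->
  \int[leb]_(x in D) f x = t * \int[leb]_(x in *%R t @^-1` D) f (t * x).
Proof.
move=> t0 mD fi; have mD' : measurable (D : set (measurableTypeR R)) := mD.
have mf := measurable_int _ fi.
have P1 := integrable_fin_num mD' (integrable_funepos mD' fi).
have N1 := integrable_fin_num mD' (integrable_funeneg mD' fi).
have posE := ge0_integral_lebesgue_scale t0 mD (measurable_funepos mf)
  (fun x _ => funepos_ge0 _ x).
have negE := ge0_integral_lebesgue_scale t0 mD (measurable_funeneg mf)
  (fun x _ => funeneg_ge0 _ x).
rewrite [in LHS]/Rintegral integralE -!/(EFin \o f) posE negE /Rintegral.
have -> : (\int[leb]_(x in *%R t @^-1` D) (f (t * x)%R)%:E =
   \int[leb]_(x in *%R t @^-1` D) (EFin \o f)^\+ (t * x)%R -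
   \int[leb]_(x in *%R t @^-1` D) (EFin \o f)^\- (t * x)%R)%E.
  rewrite [LHS]integralE; congr (_ - _)%E.
  - by apply: eq_integral => x _; rewrite !funeposE.
  - by apply: eq_integral => x _; rewrite !funenegE.
rewrite posE in P1; rewrite negE in N1.
(* Finiteness of the scaled integrals passes to the unscaled ones, so that positive and negative
   parts may be recombined in R. *)
have cancelt (z : \bar R) : (t%:E * z)%E \is a fin_num -> z \is a fin_num.
  by move: z => [r| |]//=; rewrite ?gt0_muley ?gt0_muleNy ?lte_fin.
move: (cancelt _ P1) (cancelt _ N1).
move=> /fineK <- /fineK <-.
by rewrite -!EFinM -!EFinB/= -mulrBr.
Qed.

(** Under the substitution s = t x, the factor t from the change of variables and t^(theta - 1) from
    the kernel combine into one more t^theta. At t = 0 and n > 0 both sides vanish, since theta >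
    0. *)
Lemma homogeneous_kernel_coef (k : R -> R -> R) (theta : R) n t :
  admissible_kernel k -> 0 < theta -> homogeneous_kernel k theta -> 0 <= t ->
  kernel_coef k n t = (t `^ theta) ^+ n * kernel_coef k n 1.
Proof.
move=> hk th0 hh; elim: n t => [|n IH] t t0; first by rewrite expr0 mul1r.
have [->|tn0] := eqVneq t 0.
  by rewrite powR0 ?gt_eqF// expr0n mul0r /= ltxx.
have {}t0 : 0 < t by rewrite lt_def tn0.
have [g g0 hg] := kernel_coef_le hk t0 ltr01.
rewrite [LHS]/= t0 [kernel_coef k n.+1 1]/= ltr01.
rewrite (Rintegral_lebesgue_scale t0)//; last first.
  apply: (kernel_integrableM (B := expR (g * t)) hk t0).
    by apply: measurable_funTS; exact: measurable_kernel_coef.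
  move=> s /andP[s0 st]; have := hg n s; rewrite expr1n mul1r => h.
  by apply: le_trans (h _) _; rewrite ?(ltW s0) ?(ltW st)// ler_expR ler_wpM2l// ltW.
have -> : *%R t @^-1` `]0, t[ = `]0, 1[%classic.
  by apply/seteqP; split => x; rewrite /= !in_itv/= pmulr_rgt0// gtr_pMr.
have -> : \int[leb]_(x in `]0, 1[) (k t (t * x) * kernel_coef k n (t * x)) =
    \int[leb]_(x in `]0, 1[) (t `^ (theta - 1) * (t `^ theta) ^+ n *
      (k 1 x * kernel_coef k n x)).
  apply: eq_Rintegral => x; rewrite inE/= in_itv/= => /andP[x0 x1].
  rewrite hh ?x0// IH; last by rewrite mulr_ge0// ltW.
  rewrite [kernel_coef k n x]IH ?ltW// powRM ?ltW// exprMn; ring.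
rewrite RintegralZl//; last first.
  have [g' g'0 hg'] := kernel_coef_le hk ltr01 ltr01.
  apply: (kernel_integrableM (B := expR g') hk ltr01).
    by apply: measurable_funTS; exact: measurable_kernel_coef.
  move=> s /andP[s0 st]; have := hg' n s; rewrite expr1n mul1r => h.
  apply: le_trans (h _) _; first by rewrite (ltW s0) (ltW st).
  by rewrite ler_expR ler_piMr ?ltW.
rewrite !mulrA exprS; congr (_ * _ * _).
by rewrite -{1}(powRr1 (ltW t0)) -powRD ?gt_eqF ?implybT// addrC subrK.
Qed.

Lemma homogeneous_Phi (k : R -> R -> R) (theta t : R) (l : R[i]) :
  admissible_kernel k -> 0 < theta -> homogeneous_kernel k theta -> 0 <= t ->
  Phi k t l = Phi k 1 ((t `^ theta)%:C * l).
Proof.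
move=> hk th0 hh t0; rewrite /Phi.
under [in LHS]eq_fun => n.
  rewrite (homogeneous_kernel_coef n hk th0 hh t0) [(_ * _)%:C]rmorphM rmorphXn/=.
  rewrite mulrAC -exprMn mulrC.
  over.
by [].
Qed.

End scaling.

(** * The three assertions *)

Section corollary.
Context {R : realType} {Q : ptopologicalType} {d : measure_display}
  {Omega : measurableType d} {X : completeNormedModType R}.
Variables (P : Q -> probability Omega R) (xi : R -> {mfun Omega >-> borel Q}).
Variables (iota : X -> Q -> R) (k : R -> R -> R).
Hypotheses (hxim : measurable_process xi) (hX : bounded_borel_space iota)
  (hk : admissible_kernel k).

Lemma process_sigma_preimage (A : R -> {mfun Omega >-> R}) t : 0 <= t ->
  g_sigma_algebra_preimage (A t) `<=` process_sigma A `[0, +oo[.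
Proof.
move=> t0 _ [B mB <-]; rewrite setTI; apply: sub_sigma_algebra.
by exists t, B; split=> //; rewrite /= in_itv/= t0.
Qed.

Lemma scaled_time_preimage (Y : {mfun Omega >-> R}) theta t :
  g_sigma_algebra_preimage (scaled_time Y theta t) `<=` g_sigma_algebra_preimage Y.
Proof.
move=> _ [B mB <-]; exists (( *%R^~ (t `^ theta)) @^-1` B) => //.
by rewrite -[X in measurable X]setTI; exact: mulrr_measurable.
Qed.

Lemma independent_subr (Pr : probability Omega R) (F G H : set (set Omega)) :
  H `<=` G -> independent Pr F G -> independent Pr F H.
Proof. by move=> HG FG E E' FE /HG; exact: FG. Qed.

(** The Laplace transform of t^theta Y at l is that of Y at t^theta l, and [Phi] scales in the same
    way. *)
Lemma scaled_associated_times (Y : {mfun Omega >-> R}) (theta : R) :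
  0 < theta -> homogeneous_kernel k theta -> associated_time P k 1 Y ->
  associated_times P k (scaled_time Y theta).
Proof.
move=> th0 hh [Y0 hY] t t0; have s0 : 0 <= t `^ theta := powR_ge0 _ _.
have sY0 w : 0 <= scaled_time Y theta t w by exact: mulr_ge0.
split=> // x l l0.
have sl0 : 0 <= complex.Re ((t `^ theta)%:C * l).
  by case: l l0 => a b /= a0; rewrite mul0r subr0 mulr_ge0.
rewrite (homogeneous_Phi _ hk th0 hh t0) mulrN -(hY x)// !laplace_transform_nonneg//.
have E w : - l * (scaled_time Y theta t w)%:C = - ((t `^ theta)%:C * l) * (Y w)%:C.
  by rewrite /= rmorphM/= !mulNr mulrA mulrAC [l * _]mulrC mulrAC.
by congr (_ +i* _); apply: eq_Rintegral => w _; rewrite E.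
Qed.

Lemma transition_solves (T0 : R -> X -> X) (A : R -> {mfun Omega >-> R}) :
  C0_semigroup T0 -> transition_semigroup iota P xi T0 -> associated_times P k A ->
  (forall t x, 0 <= t -> independent (P x) (process_sigma xi `[0, +oo[)
                                     (g_sigma_algebra_preimage (A t))) ->
  forall u0 : X, Dom (generator T0) u0 ->
  solves iota (generator T0) k u0
    (fun t x => fine 'E_(P x)[fun w => iota u0 (xi (A t w) w)]).
Proof.
move=> hT0 hT0xi hA ind u0 hu0.
have := subordination_solves (G := fun _ _ => 1) (c := 0) hxim hX hT0 _ _ _ hk hA ind hu0.
rewrite (_ : (fun t x => fine 'E_(P x)[fun w => iota u0 (xi (A t w) w) * 1]) =
  (fun t x => fine 'E_(P x)[fun w => iota u0 (xi (A t w) w)])); last first.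
  by apply/funext => t; apply/funext => x; under eq_fun do rewrite mulr1.
apply.
- exact: measurable_cst.
- by move=> a w _; rewrite mul0r expR0 ler01 lexx.
- by move=> t u x t0; rewrite hT0xi//; under [in RHS]eq_fun do rewrite mulr1.
Qed.

Lemma feynman_kac_solves (L0 : set (X * X)) (V : Q -> R) (T : R -> X -> X)
    (A : R -> {mfun Omega >-> R}) :
  feynman_kac_semigroup iota P xi L0 V T -> associated_times P k A ->
  (forall t x, 0 <= t -> independent (P x) (process_sigma xi `[0, +oo[)
                                     (g_sigma_algebra_preimage (A t))) ->
  forall u0 : X, Dom (closure (add_potential iota L0 V)) u0 ->
  solves iota (closure (add_potential iota L0 V)) k u0
    (fun t x => fine 'E_(P x)[fun w =>
       iota u0 (xi (A t w) w) * fk_weight xi V (A t w) w]).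
Proof.
move=> [mV [c hc] hT genE rep] hA ind u0; rewrite genE => hu0.
(* The upper bound of V is raised to a nonnegative one, as the estimate of the weight requires. *)
apply: (subordination_solves (c := Num.max 0 c) hxim hX hT _ _ rep hk hA ind hu0).
- exact: measurable_fk_weight.
- move=> a w a0; rewrite fk_weight_ge0/=; apply: fk_weight_le => //.
    by move=> q; rewrite le_max hc orbT.
  by rewrite le_max lexx.
Qed.

End corollary.

Theorem corollary2p1 (R : realType) (Q : ptopologicalType) (hQ : polish R Q)
  (d : measure_display) (Omega : measurableType d)
  (P : Q -> probability Omega R) (xi : R -> {mfun Omega >-> borel Q})
  (hxi : universal_markov_process P xi) (hxim : measurable_process xi)
  (X : completeNormedModType R) (iota : X -> Q -> R)
  (hX : bounded_borel_space iota)
  (T0 : R -> X -> X) (hT0 : C0_semigroup T0)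
  (hT0xi : transition_semigroup iota P xi T0)
  (k : R -> R -> R) (hk : admissible_kernel k)
  (hcm : forall t, 0 <= t ->
    completely_monotone (fun l : R => complex.Re (Phi k t (- l%:C))))
  (A : R -> {mfun Omega >-> R}) (hA : associated_times P k A)
  (hind : forall x, independent (P x) (process_sigma xi `[0, +oo[)
                                      (process_sigma A `[0, +oo[)) :
  [/\ forall u0 : X, Dom (generator T0) u0 ->
      solves iota (generator T0) k u0
        (fun t x => fine 'E_(P x)[fun w => iota u0 (xi (A t w) w)]),
    forall (V : Q -> R) (T : R -> X -> X),
      feynman_kac_semigroup iota P xi (generator T0) V T ->
      forall u0 : X, Dom (closure (add_potential iota (generator T0) V)) u0 ->
      solves iota (closure (add_potential iota (generator T0) V)) k u0
        (fun t x => fine 'E_(P x)[fun w =>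
           iota u0 (xi (A t w) w) * fk_weight xi V (A t w) w])
    & forall theta : R, 0 < theta -> homogeneous_kernel k theta ->
      (exists Y : {mfun Omega >-> R}, associated_time P k 1 Y /\
         forall x, independent (P x) (process_sigma xi `[0, +oo[)
                                     (g_sigma_algebra_preimage Y)) /\
      forall Y : {mfun Omega >-> R}, associated_time P k 1 Y ->
        (forall x, independent (P x) (process_sigma xi `[0, +oo[)
                                     (g_sigma_algebra_preimage Y)) ->
        [/\ associated_times P k (scaled_time Y theta),
            forall u0 : X, Dom (generator T0) u0 ->
              solves iota (generator T0) k u0
                (fun t x => fine 'E_(P x)[fun w =>
                   iota u0 (xi (Y w * t `^ theta) w)])
          & forall (V : Q -> R) (T : R -> X -> X),
              feynman_kac_semigroup iota P xi (generator T0) V T ->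
              forall u0 : X,
              Dom (closure (add_potential iota (generator T0) V)) u0 ->
              solves iota (closure (add_potential iota (generator T0) V)) k u0
                (fun t x => fine 'E_(P x)[fun w =>
                   iota u0 (xi (Y w * t `^ theta) w) *
                   fk_weight xi V (Y w * t `^ theta) w])]].
Proof.
have indA t x : 0 <= t -> independent (P x) (process_sigma xi `[0, +oo[)
    (g_sigma_algebra_preimage (A t)).
  by move=> t0; apply: independent_subr (hind x); exact: process_sigma_preimage.
split=> [u0 hu0|V T hT u0 hu0|theta th0 hh].
- exact: (transition_solves hxim hX hk hT0 hT0xi hA indA hu0).
- exact: (feynman_kac_solves hxim hX hk hT hA indA hu0).
(* The given family already contains a possible Y, namely its member at time 1. *)
split; first by exists (A 1); split; [exact: hA | move=> x; exact: indA].
move=> Y hY indY.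
have hS := scaled_associated_times hk th0 hh hY.
have indS t x : 0 <= t -> independent (P x) (process_sigma xi `[0, +oo[)
    (g_sigma_algebra_preimage (scaled_time Y theta t)).
  by move=> _; apply: independent_subr (indY x); exact: scaled_time_preimage.
split=> [//|u0 hu0|V T hT u0 hu0].
- exact: (transition_solves hxim hX hk hT0 hT0xi hS indS hu0).
- exact: (feynman_kac_solves hxim hX hk hT hS indS hu0).
Qed.
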